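(* Let $T>0$, let $b:[0,T]\times\mathbb R^d\to\mathbb R^d$ be bounded and measurable, and let $\sigma:[0,T]\times\mathbb R^d\to\mathbb R^{d\times d_W}$ be bounded, measurable and $\eta$-Hölder continuous in space uniformly in time for some $\eta\in(0,1]$, i.e. $\sup_{0\le t\le T}\sup_{\mathbf x\ne\mathbf x'}|\sigma(t,\mathbf x)-\sigma(t,\mathbf x')|/|\mathbf x-\mathbf x'|^\eta<+\infty$. Assume the uniform ellipticity condition $$\inf_{0\le t\le T,\ \mathbf x\in\mathbb R^d}\ \inf_{\zeta\in\mathbb R^d,\,|\zeta|=1}\zeta\cdot\sigma\sigma^\top(t,\mathbf x)\zeta>0 .$$ Let $\mu>0$ and let $\nu(\mathbf x)=\prod_{l=1}^d\dfrac{c_\mu}{(1+x_l^2)^{(\mu+1)/2}}$, where $c_\mu>0$ makes each factor a probability density on $\mathbb R$. Then for every $q\ge0$ there exists a constant $c_\nu>0$ (depending only on $q,b,\sigma,\nu,T$, and not on $N$) such that for every measurable $\gamma:\mathbb R^d\to\mathbb R$ with $\gamma\in L^2_\nu(\mathbb R^d)$ (i.e. $\int\gamma^2\nu\,d\mathbf x<\infty$), every $N\ge1$ and all $N\ge j\ge i\ge0$, $$\mathbb E\left[\frac{|\gamma(X^i_j)|^2(1+|X^i_j|^2)^q}{(1+|X^i_i|^2)^q}\right]\le c_\nu\,\mathbb E\bigl[|\gamma(X^i_i)|^2\bigr],$$ where $X^i_i$ has density $\nu$ and $(X^i_j)_{i\le j\le N}$ is the Euler scheme with time step $\Delta=T/N$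 started from $X^i_i$ at time $t_i$.
   Context: $|\cdot|$ is the Euclidean norm, $W$ is a standard $d_W$-dimensional Brownian motion, $\Delta=T/N$, $t_j=j\Delta$. The initial value $X^i_i$ is independent of the increments of $W$ after $t_i$. The Euler scheme is $X^i_{j+1}=X^i_j+b(t_j,X^i_j)\Delta+\sigma(t_j,X^i_j)(W_{t_{j+1}}-W_{t_j})$ for $j\ge i$. *)

(* Defs.v *)
(* Vectors of R^n are column vectors 'cV[R]_n. *)
From HB Require Import structures.
From mathcomp Require Import all_boot all_order all_algebra.
From mathcomp Require Import all_classical all_reals all_analysis.

Set Implicit Arguments.
Unset Strict Implicit.
Unset Printing Implicit Defensive.

Import Order.TTheory GRing.Theory Num.Theory.
Import numFieldTopology.Exports numFieldNormedType.Exports.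

Local Open Scope classical_set_scope.
Local Open Scope ring_scope.

Definition measure_matrix_display : measure_display -> measure_display.
Proof. exact. Qed.

(* The product sigma-algebra on matrices, as the library does for n.-tuple T;
   for T = R it is the Borel sigma-algebra. *)
Section measurable_matrix.
Context {d : measure_display} {T : measurableType d}.
Variables m n : nat.

Definition matrix_measurable : set (set 'M[T]_(m, n)) :=
  <<s \bigcup_(ij in [set: 'I_m * 'I_n])
        preimage_set_system setT (fun A : 'M[T]_(m, n) => A ij.1 ij.2)
          measurable >>.

Let mx_set0 : matrix_measurable set0.
Proof. exact: sigma_algebra0. Qed.

Let mx_setC A : matrix_measurable A -> matrix_measurable (~` A).
Proof. exact: sigma_algebraC. Qed.

Let mx_bigcup (F : _^nat) : (forall i, matrix_measurable (F i)) ->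
  matrix_measurable (\bigcup_i (F i)).
Proof. exact: sigma_algebra_bigcup. Qed.

HB.instance Definition _ := @isMeasurable.Build (measure_matrix_display d)
  'M[T]_(m, n) matrix_measurable mx_set0 mx_setC mx_bigcup.

End measurable_matrix.

Lemma measurable_mx_entry (d : measure_display) (T : measurableType d)
    (m n : nat) (i : 'I_m) (j : 'I_n) :
  measurable_fun setT (fun A : 'M[T]_(m, n) => A i j).
Proof.
move=> _ B mB; apply: sub_sigma_algebra; exists (i, j) => //.
by exists B => //; rewrite setTI.
Qed.

Lemma measurable_fun_matrix (d d' : measure_display) (S : measurableType d)
    (T : measurableType d') (m n : nat) (f : S -> 'M[T]_(m, n)) :
  (forall i j, measurable_fun setT (fun x => f x i j)) -> measurable_fun setT f.
Proof.
move=> mf; apply: (@measurability _ _ _ _ _ _ (\bigcup_(ij in [set: 'I_m * 'I_n])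
  preimage_set_system setT (fun A : 'M[T]_(m, n) => A ij.1 ij.2) measurable)) => //.
move=> _ [_ [[i j] _ [B mB <-]] <-].
have := mf i j measurableT B mB.
by rewrite !setTI.
Qed.

Section lebesgue_cV.
Context {R : realType}.

Definition cons_cV (n : nat) (p : 'cV[R]_n * R) : 'cV[R]_n.+1 :=
  col_mx (p.2%:M : 'cV[R]_1) p.1.

Lemma measurable_cons_cV (n : nat) : measurable_fun setT (@cons_cV n).
Proof.
apply: measurable_fun_matrix => i j; rewrite (ord1 j).
have [k ->|k ->] := split_ordP (i : 'I_(1 + n)).
  rewrite (_ : (fun x => _) = snd); first exact: measurable_snd.
  apply/funext => x; rewrite /cons_cV (@col_mxEu R 1 n 1) (ord1 k) mxE.
  by rewrite eqxx mulr1n.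
rewrite (_ : (fun x => _) = (fun v : 'cV[R]_n => v k ord0) \o fst).
  by apply: measurableT_comp; [exact: measurable_mx_entry|exact: measurable_fst].
by apply/funext => x; rewrite /cons_cV (@col_mxEd R 1 n 1).
Qed.

(* Lebesgue measure on R^n, the n-fold product of the one-dimensional one: in
   dimension n.+1 it is the pushforward of (lebesgue_cV n \x lebesgue_measure)
   by cons_cV. The head constant is the library's canonical measure structure on
   a pushforward, applied by hand because it takes a measurability proof. *)
Fixpoint lebesgue_cV (n : nat) : {measure set 'cV[R]_n -> \bar R} :=
  match n with
  | 0 => \d_(0 : 'cV[R]_0)
  | n.+1 =>
      measure_function_pushforward__canonical__measure_function_Measure
        (lebesgue_cV n \x lebesgue_measure)%E (@measurable_cons_cV n)
  end.

End lebesgue_cV.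

Lemma lebesgue_cV_box (R : realType) (n : nat) (A : 'I_n -> set R) :
  (forall l, measurable (A l)) ->
  lebesgue_cV n [set x : 'cV[R]_n | forall l, A l (x l 0)] =
    (\prod_(l < n) lebesgue_measure (A l))%E.
Proof.
elim: n A => [|n IH] A mA.
  rewrite big_ord0 /= diracE mem_set //.
  by move=> -[].
pose B := [set x : 'cV[R]_n | forall l, A (lift ord0 l) (x l 0)].
have mB : measurable B.
  have -> : B = \bigcap_(l in [set: 'I_n])
      ((fun x : 'cV[R]_n => x l 0) @^-1` A (lift ord0 l)).
    by apply/seteqP; split=> x h l; [move=> _|]; apply: h.
  apply: fin_bigcap_measurable => [|l _]; first exact: finite_finset.
  have := @measurable_mx_entry _ _ n 1 l 0 measurableT _ (mA (lift ord0 l)).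
  by rewrite setTI.
rewrite big_ord_recl muleC -(IH (fun l => A (lift ord0 l)))//.
transitivity ((lebesgue_cV n \x lebesgue_measure)%E (B `*` A ord0)); last first.
  by rewrite (product_measure1E (lebesgue_cV n) lebesgue_measure mB (mA ord0)).
rewrite /= /pushforward; congr (product_measure1 _ _ _); apply/seteqP; split=> -[v y].
  move=> h; split=> /=.
    move=> l; have := h (lift ord0 l).
    have -> : lift ord0 l = rshift 1 l by exact: val_inj.
    by rewrite /cons_cV (@col_mxEd R 1 n 1).
  have := h ord0.
  have E : cons_cV (v, y) ord0 0 = y.
    have -> : (ord0 : 'I_n.+1) = @lshift 1 n ord0 by exact: val_inj.
    by rewrite /cons_cV (@col_mxEu R 1 n 1) mxE eqxx mulr1n.
  by rewrite E.
move=> [hv hy] l.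
case: (unliftP ord0 l) => [k ->|->].
  have := hv k; have -> : lift ord0 k = rshift 1 k by exact: val_inj.
  by rewrite /cons_cV (@col_mxEd R 1 n 1).
have -> : cons_cV (v, y) ord0 0 = y.
  have -> : (ord0 : 'I_n.+1) = @lshift 1 n ord0 by exact: val_inj.
  by rewrite /cons_cV (@col_mxEu R 1 n 1) mxE eqxx mulr1n.
exact: hy.
Qed.

(* Frobenius norm; the Euclidean norm on column vectors. (The library's norm
   `|A| on matrices is the max norm.) *)
Definition enorm {R : realType} (m n : nat) (A : 'M[R]_(m, n)) : R :=
  Num.sqrt (\sum_i \sum_j A i j ^+ 2).

Section coefficients.
Context {R : realType} {d m n : nat}.
Implicit Type f : R -> 'cV[R]_d -> 'M[R]_(m, n).

Definition measurable_coef (T : R) f : Prop :=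
  measurable_fun (`[0, T] `*` [set: 'cV[R]_d])
    (fun p : R * 'cV[R]_d => f p.1 p.2).

Definition bounded_coef (T : R) f : Prop :=
  exists M : R, forall (t : R) (x : 'cV[R]_d),
    0 <= t <= T -> enorm (f t x) <= M.

Definition holder_in_space (T eta : R) f : Prop :=
  (ereal_sup [set ereal_sup
     [set (enorm (f t p.1 - f t p.2) / enorm (p.1 - p.2) `^ eta)%R%:E
        | p in [set p : 'cV[R]_d * 'cV[R]_d | p.1 <> p.2]]
     | t in `[0%R, T]] < +oo)%E.

End coefficients.

Definition uniformly_elliptic {R : realType} (d m : nat) (T : R)
    (sigma : R -> 'cV[R]_d -> 'M[R]_(d, m)) : Prop :=
  (0 < ereal_inf [set ereal_inf
     [set ((zeta^T *m (sigma p.1 p.2 *m (sigma p.1 p.2)^T *m zeta)) 0 0)%R%:E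
        | zeta in [set zeta : 'cV[R]_d | enorm zeta = 1%R]]
     | p in `[0%R, T] `*` [set: 'cV[R]_d]])%E.

Section random_vectors.
Context {R : realType} (dO : measure_display) (Omega : measurableType dO).
Variable P : probability Omega R.

Definition has_density (n : nat) (X : Omega -> 'cV[R]_n) (f : 'cV[R]_n -> R) :
    Prop :=
  forall A : set 'cV[R]_n, measurable A ->
    P (X @^-1` A) = (\int[lebesgue_cV n]_(x in A) (f x)%:E)%E.

Definition sigma_gen (I : Type) (D : set I) (n : nat)
    (X : I -> Omega -> 'cV[R]_n) : set (set Omega) :=
  <<s \bigcup_(i in D) preimage_set_system setT (X i) measurable >>.

Definition independent_salg (F G : set (set Omega)) : Prop :=
  forall A B, F A -> G B -> P (A `&` B) = (P A * P B)%E.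

(* Density of N(0, v I_n), v > 0; the second parameter of normal_pdf is the
   standard deviation. *)
Definition gaussian_density (n : nat) (v : R) (x : 'cV[R]_n) : R :=
  \prod_(l < n) normal_pdf 0 (Num.sqrt v) (x l 0).

(* Standard n-dimensional Brownian motion on the time interval [0, T]; the
   values of W outside [0, T] are irrelevant. *)
Definition brownian_motion (n : nat) (T : R) (W : R -> Omega -> 'cV[R]_n) :
    Prop :=
  [/\ forall t, 0 <= t <= T -> measurable_fun setT (W t),
      {ae P, forall w, W 0 w = 0},
      forall s t, 0 <= s -> s < t -> t <= T ->
        has_density (fun w => W t w - W s w) (gaussian_density (t - s)),
      forall s t, 0 <= s -> s < t -> t <= T ->
        independent_salg (sigma_gen `[0, s] W)
          (sigma_gen [set: unit] (fun _ w => W t w - W s w)) &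
      {ae P, forall w, {within `[0, T], continuous (fun t => W t w)}}].

(* x0 is independent of (W u - W s, r <= s <= u <= T). *)
Definition indep_future_increments (d n : nat) (T r : R)
    (W : R -> Omega -> 'cV[R]_n) (x0 : Omega -> 'cV[R]_d) : Prop :=
  independent_salg (sigma_gen [set: unit] (fun=> x0))
    (sigma_gen [set su : R * R | r <= su.1 /\ su.1 <= su.2 <= T]
       (fun su w => W su.2 w - W su.1 w)).

Definition grid (T : R) (N j : nat) : R := j%:R * (T / N%:R).

(* (X j)_(i <= j <= N) is the Euler scheme with step T / N started from X i at
   time grid T N i; the other values of X are irrelevant. *)
Definition euler_scheme (d n : nat) (b : R -> 'cV[R]_d -> 'cV[R]_d)
    (sigma : R -> 'cV[R]_d -> 'M[R]_(d, n)) (W : R -> Omega -> 'cV[R]_n)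
    (T : R) (N i : nat) (X : nat -> Omega -> 'cV[R]_d) : Prop :=
  forall (j : nat) (w : Omega), (i <= j < N)%N ->
    X j.+1 w = X j w + (T / N%:R) *: b (grid T N j) (X j w)
      + sigma (grid T N j) (X j w)
          *m (W (grid T N j.+1) w - W (grid T N j) w).

End random_vectors.

Definition nu_factor {R : realType} (c mu y : R) : R :=
  c / (1 + y ^+ 2) `^ ((mu + 1) / 2).

Definition nu {R : realType} (d : nat) (c mu : R) (x : 'cV[R]_d) : R :=
  \prod_(l < d) nu_factor c mu (x l 0).

(* Main.v *)
(* Parametrix for the mollified, weighted law of the scheme. Put
   h(y) = nu(y) / (1 + |y|^2)^q, w = (1 + |X_i|^2)^(-q), and let g_S be the
   centred Gaussian density with covariance S. Since nu has polynomial tails, h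
   changes at most polynomially under translations, so smoothing h by g_s gives
   at most C (1 + s)^m h.
   Freezing the diffusion coefficient at y, one Euler step maps g_S(. - y) to a
   Gaussian in X_k whose covariance and mean differ from the frozen ones by a
   Hoelder term and a drift; this costs
     C Delta (t_j - t_k)^(eta/2 - 1) g_(4 L (s + t_j - t_k))(X_k - y).
   Summing over the steps gives a weakly singular Gronwall inequality for
   E[w g_s(X_j - y)], hence E[w g_s(X_j - y)] <= M h(y) uniformly in N and in
   s <= 1. Letting s -> 0 against bounded Lipschitz functions, which are dense in
   L^1 of the laws of X_i and X_j, gives E[w F(X_j)] <= M E[w F(X_i)] for every
   F >= 0; take F = |gamma|^2 (1 + |.|^2)^q. *)
Require Import Defs.
From HB Require Import structures.
From mathcomp Require Import all_boot all_order all_algebra all_fingroup.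
From mathcomp Require Import all_classical all_reals all_analysis.
From mathcomp Require Import measurable_realfun normal_distribution.
From mathcomp Require Import ring lra.

Set Implicit Arguments.
Unset Strict Implicit.
Unset Printing Implicit Defensive.

Import Order.TTheory GRing.Theory Num.Theory.
Import numFieldTopology.Exports numFieldNormedType.Exports.

Local Open Scope classical_set_scope.
Local Open Scope ring_scope.

(** * Positive definite quadratic forms *)

(** The kernels in the error terms are wider than the initial one, by the fixed factor 4 L and by
    the elapsed time. Iterating the parametrix expansion would compound this factor; instead the
    estimate being proved is reapplied to the widened kernel. It is therefore stated for every s > 0
    with a factor (1 + s)^pw, and each use costs only the constant [K4]. Polynomial tails make this
    possible, since smoothing at scale s multiplies the weight by no more than a power of 1 + s.
    Starting from s > 0 keeps every covariance nondegenerate, even before any noise has been added,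
    so the density of X_j never enters. Spectral theory is replaced by two-sided bounds on quadratic
    forms, and determinants are controlled through the Leibniz formula. *)

Section quadratic_forms.
Context {R : realFieldType} {n : nat}.
Implicit Types (u v w : 'cV[R]_n) (S Q D : 'M[R]_n).

Definition qform S u v : R := (u^T *m S *m v) 0 0.
Definition sqn m (v : 'cV[R]_m) : R := \sum_i v i 0 ^+ 2.

Lemma qformE S u v : qform S u v = \sum_i \sum_j u i 0 * S i j * v j 0.
Proof.
rewrite /qform mxE exchange_big /=; apply: eq_bigr => j _.
by rewrite mxE mulr_suml; apply: eq_bigr => i _; rewrite mxE.
Qed.

Lemma sqn_ge0 v : 0 <= sqn v.
Proof. by apply: sumr_ge0 => i _; exact: sqr_ge0. Qed.

Lemma sqnE v : sqn v = (v^T *m v) 0 0.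
Proof. by rewrite mxE; apply: eq_bigr => i _; rewrite mxE expr2. Qed.

Lemma qform1 v : qform 1%:M v v = sqn v.
Proof. by rewrite /qform mulmx1 sqnE. Qed.

Lemma sqn_eq0 v : sqn v = 0 -> v = 0.
Proof.
move=> /eqP; rewrite psumr_eq0 => [/allP h|i _]; last exact: sqr_ge0.
apply/matrixP => i j; rewrite ord1 mxE; apply/eqP.
by have := h i (mem_index_enum _); rewrite /= sqrf_eq0.
Qed.

Lemma qformDl S u v w : qform S (u + v) w = qform S u w + qform S v w.
Proof. by rewrite /qform linearD /= !mulmxDl mxE. Qed.

Lemma qformDr S u v w : qform S w (u + v) = qform S w u + qform S w v.
Proof. by rewrite /qform mulmxDr mxE. Qed.

Lemma qformZl S a u v : qform S (a *: u) v = a * qform S u v.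
Proof. by rewrite /qform linearZ /= -!scalemxAl mxE. Qed.

Lemma qformZr S a u v : qform S u (a *: v) = a * qform S u v.
Proof. by rewrite /qform -scalemxAr mxE. Qed.

Lemma qform_addm S D u v : qform (S + D) u v = qform S u v + qform D u v.
Proof. by rewrite /qform mulmxDr mulmxDl mxE. Qed.

Lemma qform_scalem a S u v : qform (a *: S) u v = a * qform S u v.
Proof. by rewrite /qform -scalemxAr -scalemxAl mxE. Qed.

Lemma qformC S u v : S^T = S -> qform S u v = qform S v u.
Proof.
move=> sS; rewrite /qform.
have -> : (u^T *m S *m v) 0 0 = (u^T *m S *m v)^T 0 0 by rewrite [RHS]mxE.
by rewrite !trmx_mul trmxK sS mulmxA.
Qed.

Lemma sqnZ a v : sqn (a *: v) = a ^+ 2 * sqn v.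
Proof. by rewrite -!qform1 qformZl qformZr mulrA expr2. Qed.

(** A spectrum contained in [[l], [L]], expressed by quadratic forms so that such bounds add and
    scale directly. *)
Definition pdbounds (l L : R) S : Prop :=
  S^T = S /\ forall v, l * sqn v <= qform S v v <= L * sqn v.

Lemma pdbounds_unit l L S : 0 < l -> pdbounds l L S -> S \in unitmx.
Proof.
move=> l0 [_ hS]; rewrite -row_free_unit -kermx_eq0; apply/rowV0P => v /sub_kermxP vS.
apply: trmx_inj; rewrite linear0; apply: sqn_eq0; apply/eqP; rewrite eq_le sqn_ge0 andbT.
have /andP[+ _] := hS v^T.
by rewrite /qform trmxK vS mul0mx mxE pmulr_rle0.
Qed.

Section inverse.
Variables (l L : R) (S : 'M[R]_n).
Hypotheses (l0 : 0 < l) (hS : pdbounds l L S).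
Let Q := invmx S.
Let uS : S \in unitmx := pdbounds_unit l0 hS.

Lemma pdbounds_inv_sym : Q^T = Q.
Proof. by rewrite /Q trmx_inv (proj1 hS). Qed.

Lemma qform_inv v : qform Q v v = qform S (Q *m v) (Q *m v).
Proof.
rewrite /qform trmx_mul pdbounds_inv_sym -!mulmxA (mulmxA S) mulmxV//.
by rewrite mul1mx.
Qed.

(** Expand |v - l Q v|^2 >= 0 and use l |Q v|^2 <= v^T Q v, which is the lower bound on [S] at the
    vector Q v. *)
Lemma sqn_inv v : sqn (Q *m v) <= sqn v / l ^+ 2.
Proof.
rewrite ler_pdivlMr ?exprn_gt0//.
have /andP[+ _] := (proj2 hS) (Q *m v).
rewrite -qform_inv; set x := sqn _.
have := sqn_ge0 (v - l *: (Q *m v)).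
rewrite -qform1 qformDl !qformDr -scaleNr !qformZl !qformZr !qform1.
have -> : qform 1%:M v (Q *m v) = qform Q v v by rewrite /qform mulmx1 mulmxA.
rewrite (qformC _ _ (trmx1 _ _)).
have -> : qform 1%:M v (Q *m v) = qform Q v v by rewrite /qform mulmx1 mulmxA.
rewrite -/x => h1 h2.
have := ler_wpM2l (ltW l0) h2; lra.
Qed.

Lemma qform_inv_ge0 v : 0 <= qform Q v v.
Proof.
rewrite qform_inv; have /andP[+ _] := (proj2 hS) (Q *m v).
by apply: le_trans; rewrite mulr_ge0 ?sqn_ge0// ltW.
Qed.

(** The same square as for [sqn_inv], eliminating |Q v|^2 instead of v^T Q v. *)
Lemma qform_inv_le v : qform Q v v <= sqn v / l.
Proof.
rewrite ler_pdivlMr//.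
have /andP[+ _] := (proj2 hS) (Q *m v).
rewrite -qform_inv => h2.
have := sqn_ge0 (v - l *: (Q *m v)).
rewrite -qform1 qformDl !qformDr -scaleNr !qformZl !qformZr !qform1.
rewrite (qformC (Q *m v) _ (trmx1 _ _)).
have -> : qform 1%:M v (Q *m v) = qform Q v v by rewrite /qform mulmx1 mulmxA.
move=> h1; have := ler_wpM2l (ltW l0) h2; lra.
Qed.

(** Positivity of the form of [S] at Q v - v / L, a vector that vanishes in the equality case S = L
    I. *)
Lemma qform_inv_ge v : 0 < L -> sqn v / L <= qform Q v v.
Proof.
move=> L0; rewrite ler_pdivrMr//.
have /andP[_ h2] := (proj2 hS) v.
have /andP[h _] := (proj2 hS) (Q *m v - L^-1 *: v).
have := le_trans (mulr_ge0 (ltW l0) (sqn_ge0 _)) h.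
rewrite qformDl !qformDr -scaleNr !qformZl !qformZr -qform_inv.
rewrite (qformC (Q *m v) _ (proj1 hS)).
have -> : qform S v (Q *m v) = sqn v.
  by rewrite /qform mulmxA mulmxK// sqnE.
move=> h3.
have : 0 <= L * qform Q v v - 2 * sqn v + L^-1 * qform S v v.
  have := mulr_ge0 (ltW L0) h3.
  have LL : L * L^-1 = 1 by rewrite mulfV// gt_eqF.
  set a := qform Q v v; set c := qform S v v; set s := sqn v.
  have -> : L * (a + - L^-1 * s + (- L^-1 * s + - L^-1 * (- L^-1 * c))) =
    L * a - 2 * (L * L^-1) * s + (L * L^-1) * (L^-1 * c) by ring.
  by rewrite LL; lra.
have : L^-1 * qform S v v <= sqn v by rewrite mulrC ler_pdivrMr// mulrC.
rewrite (mulrC L); lra.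
Qed.

End inverse.

End quadratic_forms.

(** * Perturbation of inverses, products and determinants *)

Section perturbation.
Context {R : realFieldType} {n : nat}.
Implicit Types (u v w : 'cV[R]_n) (S Q D : 'M[R]_n) (l L e K : R).

Lemma normM_le_sqr (x y : R) : `|x * y| <= (x ^+ 2 + y ^+ 2) / 2.
Proof.
by rewrite ler_norml; have := sqr_ge0 (x - y); have := sqr_ge0 (x + y);
  rewrite !expr2; lra.
Qed.

(** Each |u_i v_j| is at most (u_i^2 + v_j^2) / 2; the factor n counts how often each square
    occurs. *)
Lemma qform_entries_le D e u v : (forall i j, `|D i j| <= e) ->
  `|qform D u v| <= e * (n%:R * (sqn u + sqn v) / 2).
Proof.
move=> hD; rewrite qformE.
apply: (@le_trans _ _ (\sum_i \sum_j e * ((u i 0 ^+ 2 + v j 0 ^+ 2) / 2))).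
  apply: le_trans (ler_norm_sum _ _ _) _; apply: ler_sum => i _.
  apply: le_trans (ler_norm_sum _ _ _) _; apply: ler_sum => j _.
  rewrite mulrAC [_ * D i j]mulrC normrM.
  apply: ler_pM => //. exact: normM_le_sqr.
rewrite le_eqVlt; apply/orP; left; apply/eqP.
transitivity (\sum_i (e * ((n%:R * u i 0 ^+ 2 + sqn v) / 2))).
  apply: eq_bigr => i _; rewrite -mulr_sumr -mulr_suml big_split /=.
  by rewrite sumr_const card_ord mulr_natl.
rewrite -mulr_sumr -mulr_suml big_split /= -mulr_sumr sumr_const card_ord.
by rewrite -(mulr_natl (sqn v)) mulrDr.
Qed.

Lemma invmx_sub S Q : S \in unitmx -> Q \in unitmx ->
  invmx S - invmx Q = invmx S *m (Q - S) *m invmx Q.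
Proof.
by move=> uS uQ; rewrite mulmxBr mulmxBl mulmxK// mulVmx// mul1mx.
Qed.

(** The identity [invmx_sub] turns the difference of the inverse forms into the form of Q - S at the
    vectors S^-1 v and Q^-1 v, whose norms [sqn_inv] controls. *)
Lemma qform_inv_perturb l L e S Q v : 0 < l -> 0 <= e ->
  pdbounds l L S -> pdbounds l L Q -> (forall i j, `|(S - Q) i j| <= e) ->
  `|qform (invmx S) v v - qform (invmx Q) v v| <= e * (n%:R * (sqn v / l ^+ 2)).
Proof.
move=> l0 e0 hS hQ he.
have -> : qform (invmx S) v v - qform (invmx Q) v v =
    qform (Q - S) (invmx S *m v) (invmx Q *m v).
  rewrite -[X in _ + X]mulN1r -qform_scalem -qform_addm scaleN1r.
  rewrite invmx_sub ?(pdbounds_unit l0 hS) ?(pdbounds_unit l0 hQ)//.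
  by rewrite /qform trmx_mul (pdbounds_inv_sym hS) !mulmxA.
apply: le_trans (qform_entries_le (e := e) _ _ _) _.
  by move=> i j; rewrite -normrN -opprB mxE opprK.
rewrite -mulrA; apply: ler_wpM2l => //; apply: ler_wpM2l; first exact: ler0n.
by have := sqn_inv l0 hS v; have := sqn_inv l0 hQ v; lra.
Qed.

(** The cross term is twice the inner product of [w] and S^-1 v, hence at most |w|^2 + |S^-1
    v|^2. *)
Lemma qform_inv_shift l L e S v w : 0 < l -> 0 <= e -> pdbounds l L S ->
  `|qform (invmx S) (v + e *: w) (v + e *: w) - qform (invmx S) v v| <=
  e * (sqn w + sqn v / l ^+ 2) + e ^+ 2 * (sqn w / l).
Proof.
move=> l0 e0 hS.
rewrite qformDl !qformDr !qformZl !qformZr (qformC v _ (pdbounds_inv_sym hS)).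
set c := qform _ w v.
have -> : forall a b : R, a + e * c + (e * c + e * (e * b)) - a =
  e * (2 * c) + e ^+ 2 * b by move=> a b; ring.
apply: le_trans (ler_normD _ _) _; apply: lerD; rewrite normrM.
  rewrite ger0_norm//; apply: ler_wpM2l => //.
  have -> : c = qform 1%:M w (invmx S *m v) by rewrite /qform mulmx1 mulmxA.
  have := sqn_inv l0 hS v.
  have := sqn_ge0 (w + invmx S *m v); have := sqn_ge0 (w - invmx S *m v).
  rewrite -scaleN1r -!qform1 !qformDl !qformDr !qformZl !qformZr.
  rewrite (qformC _ w (trmx1 _ _)) ler_norml; lra.
rewrite ger0_norm ?exprn_ge0//; apply: ler_wpM2l; first exact: exprn_ge0.
by rewrite ger0_norm ?(qform_inv_le l0 hS)// (qform_inv_ge0 l0 hS).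
Qed.

Lemma sqn_delta i : sqn (delta_mx i 0 : 'cV[R]_n) = 1.
Proof.
rewrite /sqn (bigD1 i)//= !mxE !eqxx expr1n big1 ?addr0// => j ji.
by rewrite mxE (negbTE ji) expr0n.
Qed.

Lemma qform_delta S i j : qform S (delta_mx i 0) (delta_mx j 0) = S i j.
Proof.
rewrite /qform trmx_delta -rowE mxE (bigD1 j)//= !mxE !eqxx mulr1.
by rewrite big1 ?addr0// => k kj; rewrite !mxE (negbTE kj) mulr0.
Qed.

(** Nonnegativity of the form at e_i + e_j and e_i - e_j bounds an entry by the mean of two diagonal
    ones. *)
Lemma pdbounds_entry l L S i j : 0 <= l -> pdbounds l L S -> `|S i j| <= L.
Proof.
move=> l0 hS.
have h (v : 'cV[R]_n) : 0 <= qform S v v <= L * sqn v.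
  have /andP[a ->] := (proj2 hS) v; rewrite andbT; apply: le_trans a.
  by rewrite mulr_ge0 ?sqn_ge0.
set a : 'cV[R]_n := delta_mx i 0; set b : 'cV[R]_n := delta_mx j 0.
have := h a; have := h b; have := h (a + b); have := h (a - b).
rewrite -scaleN1r -!qform1 !qformDl !qformDr !qformZl !qformZr !qform1.
rewrite !sqn_delta (qformC b a (proj1 hS)) (qformC b a (trmx1 _ _)).
rewrite !qform_delta mulr1 => /andP[x1 x2] /andP[y1 y2] /andP[z1 z2] /andP[t1 t2].
by rewrite ler_norml; lra.
Qed.

Lemma invmx_entry l L S i j : 0 < l -> pdbounds l L S -> `|invmx S i j| <= l^-1.
Proof.
move=> l0 hS; rewrite -(ler_pXn2r (n:=2)) ?nnegrE ?invr_ge0 ?(ltW l0)//.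
have := sqn_inv l0 hS (delta_mx j 0); rewrite sqn_delta mul1r -exprVn.
apply: le_trans; rewrite /sqn (bigD1 i)//= -colE mxE real_normK ?num_real//.
by rewrite lerDl sumr_ge0// => k _; exact: sqr_ge0.
Qed.

Lemma prod_sub_le (I : Type) (r : seq I) (a b : I -> R) K e :
  1 <= K -> 0 <= e -> (forall i, `|a i| <= K) -> (forall i, `|b i| <= K) ->
  (forall i, `|a i - b i| <= e) ->
  `|\prod_(i <- r) a i| <= K ^+ size r /\
  `|\prod_(i <- r) a i - \prod_(i <- r) b i| <= (size r)%:R * K ^+ size r * e.
Proof.
move=> K1 e0 ha hb hab; elim: r => [|x r [IH1 IH2]].
  by rewrite !big_nil subrr normr0 normr1 expr0 !mul0r.
rewrite !big_cons /= exprS; split.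
  by rewrite normrM ler_pM.
have -> : forall p q : R, a x * p - b x * q = (a x - b x) * p + b x * (p - q).
  by move=> p q; ring.
apply: le_trans (ler_normD _ _) _; rewrite !normrM -addn1 natrD.
set k := _%:R in IH2 *.
have h1 : `|a x - b x| * `|\prod_(j <- r) a j| <= e * (K * K ^+ size r).
  apply: ler_pM => //; apply: le_trans IH1 _.
  by rewrite ler_peMl// exprn_ge0// (le_trans ler01).
have h2 : `|b x| * `|\prod_(j <- r) a j - \prod_(j <- r) b j| <= K * (k * K ^+ size r * e).
  by apply: ler_pM.
by apply: le_trans (lerD h1 h2) _; rewrite le_eqVlt; apply/orP; left; apply/eqP; ring.
Qed.

Lemma det_norm_le K S : 1 <= K -> (forall i j, `|S i j| <= K) ->
  `|\det S| <= n`!%:R * K ^+ n.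
Proof.
move=> K1 hS; rewrite /determinant.
apply: le_trans (ler_norm_sum _ _ _) _.
apply: (@le_trans _ _ (\sum_(s : 'S_n) K ^+ n)); last first.
  by rewrite sumr_const card_Sn mulr_natl.
apply: ler_sum => s _; rewrite normrM normrX normrN1 expr1n mul1r.
(* Only the size of the product is wanted, so both families are taken equal, with error 0. *)
have h0 i : `|S i (s i) - S i (s i)| <= 0 by rewrite subrr normr0.
have [+ _] := @prod_sub_le _ (index_enum 'I_n) (fun i => S i (s i)) (fun i => S i (s i)) K 0
  K1 (lexx _) (fun i => hS _ _) (fun i => hS _ _) h0.
by rewrite [index_enum _]unlock -enumT size_enum_ord.
Qed.

Lemma det_sub_le K e S Q : 1 <= K -> 0 <= e ->
  (forall i j, `|S i j| <= K) -> (forall i j, `|Q i j| <= K) ->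
  (forall i j, `|(S - Q) i j| <= e) ->
  `|\det S - \det Q| <= n`!%:R * (n%:R * K ^+ n) * e.
Proof.
move=> K1 e0 hS hQ hSQ; rewrite /determinant -sumrB.
apply: le_trans (ler_norm_sum _ _ _) _.
apply: (@le_trans _ _ (\sum_(s : 'S_n) n%:R * K ^+ n * e)); last first.
  by rewrite sumr_const card_Sn -(mulr_natl (n%:R * _ * e)) mulrA.
apply: ler_sum => s _; rewrite -mulrBr normrM normrX normrN1 expr1n mul1r.
have h0 i : `|S i (s i) - Q i (s i)| <= e by have := hSQ i (s i); rewrite !mxE.
have [_] := @prod_sub_le _ (index_enum 'I_n) (fun i => S i (s i)) (fun i => Q i (s i)) K e
  K1 e0 (fun i => hS _ _) (fun i => hQ _ _) h0.
by rewrite [index_enum _]unlock -enumT size_enum_ord.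
Qed.

(** The inverse has entries at most 1 / l, so Leibniz bounds its determinant above, which bounds the
    determinant of [S] below. Adding 1 to l^-1 meets the condition K >= 1 of [det_norm_le]. *)
Lemma det_pdbounds_ge l L S : 0 < l -> pdbounds l L S ->
  (n`!%:R * (1 + l^-1) ^+ n)^-1 <= `|\det S|.
Proof.
move=> l0 hS; have uS := pdbounds_unit l0 hS.
have K1 : 1 <= 1 + l^-1 by rewrite lerDl invr_ge0 ltW.
have := @det_norm_le (1 + l^-1) (invmx S) K1 _.
rewrite det_inv normrV -?unitmxE// => h.
rewrite invf_ple ?posrE ?normr_gt0 ?mulr_gt0 ?ltr0n ?fact_gt0//.
- apply: h => i j; apply: le_trans (invmx_entry i j l0 hS) _.
  by rewrite lerDr.
- by rewrite exprn_gt0// (lt_le_trans ltr01).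
- by move: uS; rewrite unitmxE unitfE.
Qed.

End perturbation.

(** * Rank-one updates of positive definite matrices *)

Section rank_one.
Context {R : realFieldType} {n : nat}.
Implicit Types (b v : 'cV[R]_n) (S : 'M[R]_n).

(* Two block triangular factorizations of the same matrix. *)
Lemma det_rank_one (u w : 'cV[R]_n) :
  \det (1%:M + u *m w^T) = 1 + (w^T *m u) 0 0.
Proof.
have E1 : block_mx (1%:M : 'M[R]_1) 0 u 1%:M *m block_mx 1%:M (- w^T) 0 (1%:M + u *m w^T)
  = block_mx 1%:M (- w^T) u 1%:M :> 'M[R]_(1 + n).
  rewrite mulmx_block !mul1mx !mul0mx !mulmx1 !addr0.
  by rewrite mulmxN addrCA addNr addr0.
have E2 : block_mx (1%:M : 'M[R]_1) (- w^T) 0 1%:M *m block_mx (1%:M + w^T *m u) 0 u 1%:M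
  = block_mx 1%:M (- w^T) u 1%:M :> 'M[R]_(1 + n).
  rewrite mulmx_block !mul1mx !mul0mx !mulmx1 !add0r.
  by rewrite mulNmx addrK.
have := congr1 determinant (etrans E1 (esym E2)).
rewrite !det_mulmx det_lblock det_ublock det_ublock det_lblock !det1 !mul1r mulr1.
by move=> ->; rewrite det_mx11 !mxE eqxx.
Qed.

Variables (l L : R) (S : 'M[R]_n) (b : 'cV[R]_n) (v : R).
Hypotheses (l0 : 0 < l) (hS : pdbounds l L S) (v0 : 0 <= v).
Let Q := invmx S.
Let uS : S \in unitmx := pdbounds_unit l0 hS.

Let c_gt0 : 0 < 1 + v * qform Q b b.
Proof. by rewrite ltr_pwDl// mulr_ge0// (qform_inv_ge0 l0 hS). Qed.

(** The matrix determinant lemma, after factoring out [S]. *)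
Lemma det_rank_one_update :
  \det (S + v *: (b *m b^T)) = \det S * (1 + v * qform Q b b).
Proof.
have -> : S + v *: (b *m b^T) = S *m (1%:M + (v *: (Q *m b)) *m b^T).
  by rewrite mulmxDr mulmx1 -scalemxAl -scalemxAr !mulmxA mulmxV// mul1mx.
by rewrite det_mulmx det_rank_one -scalemxAr mxE /qform mulmxA.
Qed.

(** Sherman-Morrison formula. Invertibility follows from the determinant, so a one-sided product
    check suffices. *)
Lemma invmx_rank_one_update :
  invmx (S + v *: (b *m b^T)) =
  Q - (v / (1 + v * qform Q b b)) *: ((Q *m b) *m (Q *m b)^T).
Proof.
set c := qform Q b b; set Z := RHS.
have uU : S + v *: (b *m b^T) \in unitmx.
  rewrite unitmxE det_rank_one_update unitfE mulf_neq0 ?(gt_eqF c_gt0)//.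
  by move: uS; rewrite unitmxE unitfE.
suff E : (S + v *: (b *m b^T)) *m Z = 1%:M.
  by rewrite -[RHS]mul1mx -(mulVmx uU) -mulmxA E mulmx1.
pose p := Q *m b.
have Sp : S *m p = b by rewrite /p mulmxA mulmxV// mul1mx.
have bQ : b^T *m Q = p^T by rewrite /p trmx_mul (pdbounds_inv_sym hS).
have bp : b^T *m p = c%:M by rewrite /p mulmxA [LHS]mx11_scalar.
rewrite /Z -/p mulmxBr !mulmxDl mulmxV// -!scalemxAr -!scalemxAl.
rewrite [S *m (p *m _)]mulmxA Sp -[b *m b^T *m Q]mulmxA bQ.
rewrite -[b *m b^T *m (p *m _)]mulmxA [b^T *m (p *m _)]mulmxA bp mul_scalar_mx.
rewrite -scalemxAr !scalerA -addrA.
have h : 1 + v * c != 0 by rewrite gt_eqF// c_gt0.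
rewrite -scalerDl -scalerBl -[RHS]addr0; congr (_ + _); apply/eqP.
by rewrite scaler_eq0; apply/orP; left; apply/eqP; field.
Qed.

Lemma qform_rank_one_update (w : 'cV[R]_n) :
  qform (invmx (S + v *: (b *m b^T))) w w =
  qform Q w w - v * qform Q b w ^+ 2 / (1 + v * qform Q b b).
Proof.
rewrite invmx_rank_one_update -scaleNr qform_addm qform_scalem mulNr.
congr (_ - _); rewrite [RHS]mulrAC; congr (_ * _); rewrite /qform.
have -> : w^T *m (Q *m b *m (Q *m b)^T) *m w = (w^T *m Q *m b) *m (b^T *m Q *m w).
  by rewrite trmx_mul (pdbounds_inv_sym hS) -/Q !mulmxA.
rewrite mxE big_ord1 -/(qform Q w b) -/(qform Q b w).
by rewrite (qformC w b (pdbounds_inv_sym hS)) expr2.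
Qed.

(** The lower bound [l] survives unchanged and the upper one may grow: this is what an induction
    over the noise coordinates requires. *)
Lemma pdbounds_rank_one_update :
  exists L', pdbounds l L' (S + v *: (b *m b^T)).
Proof.
exists (L + v * (sqn b * n%:R)); split.
  by rewrite linearD linearZ /= trmx_mul trmxK (proj1 hS).
move=> w; rewrite qform_addm qform_scalem mulrDl -mulrA.
have /andP[h1 h2] := (proj2 hS) w; apply/andP; split.
  rewrite ler_wpDr// mulr_ge0//.
  have -> : qform (b *m b^T) w w = (b^T *m w) 0 0 ^+ 2; last exact: sqr_ge0.
  rewrite /qform !mulmxA -mulmxA mxE big_ord1 expr2; congr (_ * _).
  by rewrite !mxE; apply: eq_bigr => i _; rewrite !mxE mulrC.
apply: lerD => //; apply: ler_wpM2l => //; apply: le_trans (ler_norm _) _.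
apply: le_trans (qform_entries_le (e := sqn b) _ _ _) _.
  move=> i j; rewrite mxE big_ord1 mxE; apply: le_trans (normM_le_sqr _ _) _.
  have hb k : b k 0 ^+ 2 <= sqn b.
    by rewrite /sqn (bigD1 k)//= lerDl sumr_ge0// => *; exact: sqr_ge0.
  by have := hb i; have := hb j; lra.
by rewrite le_eqVlt; apply/orP; left; apply/eqP; field.
Qed.

End rank_one.

(** * Gaussian kernels *)

Section gaussian_kernel.
Context {R : realType}.

(** Factor out exp(-a) and use exp(x) >= 1 + x; keeping exp(-a) on the right retains the Gaussian
    decay. *)
Lemma expR_sub_le (a b : R) : expR (- a) - expR (- b) <= `|a - b| * expR (- a).
Proof.
have -> : expR (- b) = expR (- a) * expR (a - b) by rewrite -expRD; congr expR; ring.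
have : expR (- a) * (1 + (a - b)) <= expR (- a) * expR (a - b).
  by apply: ler_wpM2l; [exact: expR_ge0|exact: expR_ge1Dx].
have : (b - a) * expR (- a) <= `|a - b| * expR (- a).
  by apply: ler_wpM2r; [exact: expR_ge0|rewrite distrC ler_norm].
lra.
Qed.

(** Uses ln(1 + x) <= (1 + x) / k + ln k with [k] so large that m / k <= c; the 1 added in [k] keeps
    it positive when m = 0. *)
Lemma powR_expR_bound (m c : R) : 0 <= m -> 0 < c ->
  exists2 C, 0 < C & forall x, 0 <= x -> (1 + x) `^ m * expR (- (c * x)) <= C.
Proof.
move=> m0 c0; pose k := m / c + 1.
have k0 : 0 < k by rewrite ltr_wpDl// divr_ge0// ltW.
exists (expR (c + m * ln k)); first exact: expR_gt0.
move=> x x0; have x1 : 0 < 1 + x by rewrite ltr_pwDl.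
rewrite /powR gt_eqF// -expRD ler_expR.
have h : ln (1 + x) <= (1 + x) / k + ln k.
  have -> : 1 + x = (1 + x) / k * k by rewrite divfK// gt_eqF.
  rewrite lnM ?posrE ?divr_gt0// divfK ?gt_eqF// lerD2r.
  have := le_ln1Dx (x := (1 + x) / k - 1).
  have -> : 1 + ((1 + x) / k - 1) = (1 + x) / k by ring.
  have p : 0 < (1 + x) / k by rewrite divr_gt0.
  by move=> /(_ _); lra.
have : m * ((1 + x) / k) <= c * (1 + x).
  rewrite mulrCA [c * _]mulrC ler_wpM2l//; first exact: ltW.
  rewrite ler_pdivrMr// /k mulrDr mulr1.
  by rewrite mulrC divfK ?gt_eqF// lerDl ltW.
have := ler_wpM2l m0 h; rewrite mulrDr; lra.
Qed.

Lemma invsqrt_sub_le (c x y : R) : 0 < c -> c <= x -> c <= y ->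
  `|(Num.sqrt x)^-1 - (Num.sqrt y)^-1| <= `|x - y| / (c * Num.sqrt c).
Proof.
move=> c0 cx cy.
have x0 := lt_le_trans c0 cx; have y0 := lt_le_trans c0 cy.
have sc0 : 0 < Num.sqrt c by rewrite sqrtr_gt0.
have sx : Num.sqrt c <= Num.sqrt x by rewrite ler_wsqrtr.
have sy : Num.sqrt c <= Num.sqrt y by rewrite ler_wsqrtr.
have sx0 := lt_le_trans sc0 sx; have sy0 := lt_le_trans sc0 sy.
have -> : x - y = (Num.sqrt x - Num.sqrt y) * (Num.sqrt x + Num.sqrt y).
  by rewrite -subr_sqr !sqr_sqrtr ?ltW.
have -> : (Num.sqrt x)^-1 - (Num.sqrt y)^-1 =
    - ((Num.sqrt x - Num.sqrt y) / (Num.sqrt x * Num.sqrt y)).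
  by field; rewrite !gt_eqF.
rewrite normrN !normrM -mulrA; apply: ler_wpM2l; first exact: normr_ge0.
rewrite ger0_norm; last by rewrite invr_ge0 mulr_ge0 ?ltW.
rewrite ger0_norm; last by rewrite addr_ge0 ?ltW.
have : c = Num.sqrt c ^+ 2 by rewrite sqr_sqrtr// ltW.
set a := Num.sqrt c in sc0 sx sy *; move=> ->; set u := Num.sqrt x in sx sx0 *.
set w := Num.sqrt y in sy sy0 *.
rewrite -[leLHS]mul1r ler_pdivrMr ?mulr_gt0// mulrAC ler_pdivlMr ?mulr_gt0 ?exprn_gt0//.
rewrite mul1r.
have h1 : a * a <= u * w by apply: ler_pM => //; exact: ltW.
have h2 : a ^+ 2 * a <= (u * w) * (u + w).
  by rewrite expr2; apply: ler_pM => //; [rewrite mulr_ge0// ltW|exact: ltW|lra].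
by rewrite [leRHS]mulrC.
Qed.

(* The absolute value of the determinant spares a proof that it is positive. *)
Definition gauss_unnorm n (M : 'M[R]_n) (v : 'cV[R]_n) : R :=
  expR (- (qform (invmx M) v v / 2)) / Num.sqrt `|\det M|.

(** Half of |r + 2 w|^2 >= 0. *)
Lemma sqn_shift_ge n (r w : 'cV[R]_n) : sqn r / 2 - sqn w <= sqn (r + w).
Proof.
have := sqn_ge0 (r + 2 *: w).
rewrite -!qform1 !qformDl !qformDr !qformZl !qformZr (qformC w r (trmx1 _ _)); lra.
Qed.

Lemma gauss_unnorm_perturb n (l L K E : R) :
  0 < l -> 0 < L -> 0 <= K -> 0 <= E ->
  exists2 C, 0 < C & forall (M1 M2 : 'M[R]_n) (r w : 'cV[R]_n) (e dl : R),
    pdbounds l L M1 -> pdbounds l L M2 -> 0 <= dl ->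
    (forall i j, `|(M1 - M2) i j| <= dl) -> sqn w <= K -> 0 <= e <= E ->
    gauss_unnorm M1 (r + e *: w) <= gauss_unnorm M2 r +
      C * (dl + e) * (1 + sqn r) * expR (- (sqn r / (4 * L))).
Proof.
move=> l0 L0 K0 E0.
(* [c] is the lower bound on determinants and [D] the resulting bound on the normalizing factors;
   [CE] is the price of the drift in the exponential, [Cd] the Lipschitz constant of the
   determinant, [Cq] that of the exponent. *)
pose c := (n`!%:R * (1 + l^-1) ^+ n)^-1 : R.
have c0 : 0 < c.
  by rewrite invr_gt0 mulr_gt0 ?ltr0n ?fact_gt0// exprn_gt0// ltr_pwDl// invr_ge0 ltW.
pose D := (Num.sqrt c)^-1; have D0 : 0 < D by rewrite invr_gt0 sqrtr_gt0.
pose CE := expR (E ^+ 2 * K / (2 * L)); have CE0 : 0 < CE by exact: expR_gt0.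
pose Cd := n`!%:R * (n%:R * (1 + L) ^+ n) : R.
have Cd0 : 0 <= Cd by rewrite !mulr_ge0// exprn_ge0// addr_ge0// ltW.
pose Cq := K + E * (K / l) + (1 + n%:R) / l ^+ 2.
have l20 : 0 < l ^+ 2 by exact: exprn_gt0.
have Cq0 : 0 <= Cq.
  by rewrite /Cq !addr_ge0// ?mulr_ge0// ?invr_ge0 ?addr_ge0// ltW.
exists (D * CE * Cq + Cd / (c * Num.sqrt c) + 1).
  rewrite ltr_wpDl// addr_ge0//.
    by rewrite !mulr_ge0// ltW.
  by rewrite mulr_ge0// invr_ge0 mulr_ge0 ?sqrtr_ge0// ltW.
move=> M1 M2 r w e dl h1 h2 dl0 hd wK /andP[e0 eE].
rewrite /gauss_unnorm; set A := qform _ _ _ / 2; set B := qform _ r r / 2.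
set D1 := (Num.sqrt `|\det M1|)^-1; set D2 := (Num.sqrt `|\det M2|)^-1.
set G := expR (- (sqn r / (4 * L))).
have G0 : 0 < G by exact: expR_gt0.
have r0 := sqn_ge0 r; have w0 := sqn_ge0 w.
have c1 := det_pdbounds_ge l0 h1; have c2 := det_pdbounds_ge l0 h2.
have D1D : 0 <= D1 <= D.
  rewrite invr_ge0 sqrtr_ge0/= /D1 /D lef_pV2 ?posrE ?sqrtr_gt0//.
    by rewrite ler_wsqrtr.
  exact: lt_le_trans c1.
have LK : 1 <= 1 + L by lra.
have DD : D1 - D2 <= Cd * dl / (c * Num.sqrt c).
  apply: le_trans (ler_norm _) _; apply: le_trans (invsqrt_sub_le c0 c1 c2) _.
  rewrite ler_wpM2r ?invr_ge0 ?mulr_ge0 ?sqrtr_ge0 ?(ltW c0)//.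
  apply: le_trans (ler_dist_dist _ _) _; apply: det_sub_le => //.
    by move=> i j; apply: le_trans (pdbounds_entry i j (ltW l0) h1) _; lra.
  by move=> i j; apply: le_trans (pdbounds_entry i j (ltW l0) h2) _; lra.
have eA : expR (- A) <= CE * G.
  rewrite -expRD ler_expR.
  have := qform_inv_ge l0 h1 (r + e *: w) L0.
  have := sqn_shift_ge r (e *: w); rewrite sqnZ => s1 s2.
  have s3 : e ^+ 2 * sqn w <= E ^+ 2 * K.
    by apply: ler_pM; rewrite ?sqr_ge0//; rewrite ler_pXn2r ?nnegrE.
  have s4 : (sqn r / 2 - E ^+ 2 * K) / L <= 2 * A.
    rewrite /A [2 * _]mulrC divfK//; apply: le_trans s2.
    by rewrite ler_wpM2r ?invr_ge0 ?(ltW L0) ?(ltW l20)//; lra.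
  have -> : E ^+ 2 * K / (2 * L) + - (sqn r / (4 * L)) =
    - ((sqn r / 2 - E ^+ 2 * K) / L) / 2 by field; rewrite gt_eqF.
  lra.
have eB : expR (- B) <= G.
  rewrite ler_expR lerN2.
  have := qform_inv_ge l0 h2 r L0.
  have -> : sqn r / (4 * L) = (sqn r / L) / 4 by field; rewrite gt_eqF.
  have : 0 <= sqn r / L by rewrite divr_ge0// ltW.
  rewrite /B; lra.
have AB : `|A - B| <= Cq * (dl + e) * (1 + sqn r).
  have t1 := qform_inv_shift r w l0 e0 h1.
  have t2 := qform_inv_perturb r l0 dl0 h1 h2 hd.
  rewrite /A /B -mulrBl normrM [`|2^-1|]ger0_norm//.
  set qa := qform _ (r + _) _ in t1 *; set qb := qform (invmx M1) r r in t1 t2.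
  set qc := qform _ _ _ in t2 *.
  have : `|qa - qc| <= `|qa - qb| + `|qb - qc|.
    by rewrite -[qa - qc](subrKA qb) ler_normD.
  set s := sqn r in r0 t1 t2 *.
  have u1 : e * (sqn w + s / l ^+ 2) <= e * (K * (1 + s) + (1 + s) / l ^+ 2).
    apply: ler_wpM2l => //; apply: lerD.
      by apply: le_trans wK _; rewrite ler_peMr//; lra.
    by rewrite ler_wpM2r ?invr_ge0 ?(ltW L0) ?(ltW l20)//; lra.
  have u2 : e ^+ 2 * (sqn w / l) <= e * (E * (K / l) * (1 + s)).
    rewrite expr2 -mulrA ler_wpM2l//.
    have : e * (sqn w / l) <= E * (K / l).
      by apply: ler_pM => //; [rewrite divr_ge0// ltW|rewrite ler_wpM2r// invr_ge0 ltW].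
    move=> /le_trans; apply; rewrite ler_peMr ?mulr_ge0 ?invr_ge0//; lra.
  have u3 : dl * (n%:R * (s / l ^+ 2)) <= dl * (n%:R * ((1 + s) / l ^+ 2)).
    by rewrite !ler_wpM2l// ler_wpM2r ?invr_ge0 ?(ltW L0) ?(ltW l20)//; lra.
  have u4 : 0 <= dl * ((1 + s) * (K + E * (K / l) + l ^- 2)) by
    rewrite !mulr_ge0// !addr_ge0// ?mulr_ge0 ?invr_ge0 // ltW.
  have u5 : 0 <= e * (n%:R * ((1 + s) / l ^+ 2)) by
    rewrite !mulr_ge0 ?invr_ge0// ?addr_ge0// ltW.
  have -> : Cq * (dl + e) * (1 + s) =
    e * (K * (1 + s) + (1 + s) / l ^+ 2) + e * (E * (K / l) * (1 + s)) +
    dl * (n%:R * ((1 + s) / l ^+ 2)) + dl * ((1 + s) * (K + E * (K / l) + l ^- 2)) +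
    e * (n%:R * ((1 + s) / l ^+ 2)) by rewrite /Cq; ring.
  have := normr_ge0 (qa - qc); lra.
have := expR_sub_le A B => eAB.
have de0 : 0 <= dl + e by rewrite addr_ge0.
have s0 : 1 <= 1 + sqn r by lra.
have x1 : D1 * (expR (- A) - expR (- B)) <= D * (Cq * (dl + e) * (1 + sqn r) * (CE * G)).
  case/andP: D1D => D10 D1D.
  apply: (@le_trans _ _ (D1 * (`|A - B| * expR (- A)))); first exact: ler_wpM2l.
  apply: ler_pM => //.
  by apply: ler_pM => //; exact: expR_ge0.
have x2 : (D1 - D2) * expR (- B) <= Cd / (c * Num.sqrt c) * (dl + e) * (1 + sqn r) * G.
  have k0 : 0 <= Cd / (c * Num.sqrt c).
    by rewrite mulr_ge0// invr_ge0 mulr_ge0 ?sqrtr_ge0// ltW.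
  apply: (@le_trans _ _ (Cd / (c * Num.sqrt c) * dl * expR (- B))).
    by rewrite ler_wpM2r ?expR_ge0// mulrAC.
  move: (Cd / (c * Num.sqrt c)) k0 => X X0.
  have q1 : X * dl <= X * (dl + e) by rewrite ler_wpM2l// lerDl.
  have q2 : X * (dl + e) <= X * (dl + e) * (1 + sqn r) by rewrite ler_peMr// mulr_ge0.
  apply: ler_pM => //; [exact: mulr_ge0|exact: le_trans q1 q2].
have x3 : 0 <= 1 * (dl + e) * (1 + sqn r) * G.
  by rewrite !mulr_ge0// ?(ltW G0)// (le_trans ler01).
have -> : (D * CE * Cq + Cd / (c * Num.sqrt c) + 1) * (dl + e) * (1 + sqn r) * G =
  D * (Cq * (dl + e) * (1 + sqn r) * (CE * G)) +
  Cd / (c * Num.sqrt c) * (dl + e) * (1 + sqn r) * G + 1 * (dl + e) * (1 + sqn r) * G.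
  by ring.
lra.
Qed.

End gaussian_kernel.

(** * Normalized kernels, scaling and rank-one convolution *)

Section gaussk.
Context {R : realType}.

Definition gaussk n (S : 'M[R]_n) (v : 'cV[R]_n) : R :=
  gauss_unnorm S v / Num.sqrt ((2 * pi) ^+ n).

Lemma gaussk_ge0 n (S : 'M[R]_n) v : 0 <= gaussk S v.
Proof. by rewrite !mulr_ge0 ?invr_ge0 ?sqrtr_ge0 ?expR_ge0. Qed.

Lemma invmxZ_unit n (a : R) (M : 'M[R]_n) : a != 0 -> M \in unitmx ->
  invmx (a *: M) = a^-1 *: invmx M.
Proof.
move=> a0 uM.
have uaM : a *: M \in unitmx by rewrite unitmxZ// unitfE.
rewrite -[RHS]mul1mx -(mulVmx uaM) -mulmxA -scalemxAr -scalemxAl scalerA.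
by rewrite mulVf// scale1r mulmxV// mulmx1.
Qed.

Lemma gaussk_scale n (t : R) (M : 'M[R]_n) v : 0 < t -> M \in unitmx ->
  gaussk (t *: M) v =
  gauss_unnorm M ((Num.sqrt t)^-1 *: v) / Num.sqrt ((2 * pi * t) ^+ n).
Proof.
move=> t0 uM; rewrite /gaussk /gauss_unnorm invmxZ_unit ?gt_eqF// qform_scalem.
rewrite qformZl qformZr mulrA -expr2 exprVn sqr_sqrtr ?(ltW t0)//.
rewrite detZ normrM ger0_norm ?exprn_ge0 ?(ltW t0)//.
have p0 : 0 < pi :> R := pi_gt0 R.
rewrite sqrtrM ?exprn_ge0 ?(ltW t0)// [(2 * pi * t) ^+ n]exprMn.
rewrite [Num.sqrt ((2 * pi) ^+ n * _)]sqrtrM ?exprn_ge0 ?mulr_ge0 ?(ltW p0)//.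
by rewrite !invfM; ring.
Qed.

Lemma gaussk_scalarE n (t : R) (v : 'cV[R]_n) : 0 < t ->
  gaussk t%:M v = expR (- (sqn v / (2 * t))) / Num.sqrt ((2 * pi * t) ^+ n).
Proof.
move=> t0; rewrite -scalemx1 gaussk_scale ?unitmx1// /gauss_unnorm.
rewrite invmx1 qform1 det1 normr1 sqrtr1 divr1 sqnZ exprVn sqr_sqrtr ?(ltW t0)//.
by congr (expR (- _) / _); field; rewrite gt_eqF.
Qed.

Lemma gaussian_densityE n (t : R) (v : 'cV[R]_n) : 0 < t ->
  gaussian_density t v = gaussk t%:M v.
Proof.
move=> t0; rewrite gaussk_scalarE// /gaussian_density.
have st : Num.sqrt t != 0 by rewrite gt_eqF// sqrtr_gt0.
under eq_bigr do rewrite normal_pdfE//.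
rewrite big_split /= /normal_peak /normal_fun prodr_const card_ord mulrC.
rewrite sqr_sqrtr ?(ltW t0)//; congr (_ * _).
  rewrite -expR_sum; congr expR; rewrite /sqn mulr_suml -sumrN; apply: eq_bigr => i _.
  by rewrite subr0 mulNr -(mulr_natl t 2).
rewrite exprVn; congr (_^-1); rewrite -(mulr_natl (t * pi) 2).
have -> : 2 * (t * pi) = 2 * pi * t by ring.
have p0 : 0 <= 2 * pi * t by rewrite !mulr_ge0 ?pi_ge0 ?(ltW t0).
elim: n {v} => [|n IH]; first by rewrite !expr0 sqrtr1.
by rewrite exprS IH [in RHS]exprS (sqrtrM _ p0).
Qed.

Lemma pdboundsZ n (a l L : R) (M : 'M[R]_n) : 0 < a ->
  pdbounds l L M -> pdbounds (a * l) (a * L) (a *: M).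
Proof.
move=> a0 [sM hM]; split; first by rewrite linearZ /= sM.
move=> v; rewrite qform_scalem -!mulrA !ler_wpM2l ?(ltW a0)//.
  by case/andP: (hM v).
by case/andP: (hM v).
Qed.

Lemma powR_le1D (x p : R) : 0 <= x -> 0 <= p <= 1 -> x `^ p <= 1 + x.
Proof.
move=> x0 /andP[p0 p1].
have x1 : 1 <= 1 + x by rewrite lerDl.
apply: (@le_trans _ _ ((1 + x) `^ p)).
  by apply: ge0_ler_powR => //; rewrite ?nnegrE ?(le_trans ler01)// lerDr.
by rewrite -[leRHS]powRr1 ?(le_trans ler01)//; apply: ler_powR.
Qed.

(* Rescaling space by [Num.sqrt t] brings both covariances between [l] and [L];
   the Gaussian tail then absorbs the powers of [sqn v / t]. *)
Lemma gaussk_step n (l L T K H eta : R) : 0 < l -> 0 < L -> 0 < T -> 0 <= K ->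
  0 <= H -> 0 < eta <= 1 ->
  exists2 C, 0 < C & forall (S a1 a2 : 'M[R]_n) (v w : 'cV[R]_n) (t D : R),
    0 < D -> D <= t -> D <= T ->
    pdbounds (t * l) (t * L) (S + D *: a1) ->
    pdbounds (t * l) (t * L) (S + D *: a2) ->
    (forall i j, `|(a1 - a2) i j| <= H * sqn v `^ (eta / 2)) -> sqn w <= K ->
    gaussk (S + D *: a1) (v + D *: w) <= gaussk (S + D *: a2) v +
      C * D * (t `^ (eta / 2 - 1) + t `^ (- 2^-1)) * gaussk (4 * L * t)%:M v.
Proof.
move=> l0 L0 T0 K0 H0 /andP[eta0 eta1].
(* In rescaled space the drift is multiplied by D / sqrt t, which is at most sqrt T because D <= t
   and D <= T. *)
have [C C0 hC] := @gauss_unnorm_perturb R n l L K (Num.sqrt T) l0 L0 K0 (sqrtr_ge0 _).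
(* Half of the exponent s / (4 L) pays for (1 + s)^2; the remaining s / (8 L) is the exponent of the
   kernel of covariance 4 L t. *)
have L8 : 0 < (8 * L)^-1 by rewrite invr_gt0 mulr_gt0.
have [C2 C20 hC2] := @powR_expR_bound R 2 (8 * L)^-1 (ler0n _ _) L8.
pose q := Num.sqrt ((4 * L) ^+ n).
have q0 : 0 < q by rewrite sqrtr_gt0 exprn_gt0// mulr_gt0.
exists (C * (H + 1) * C2 * q); first by rewrite !mulr_gt0// ltr_wpDl.
move=> S a1 a2 v w t D D0 Dt DT h1 h2 ha wK.
have t0 := lt_le_trans D0 Dt.
pose M1 := t^-1 *: (S + D *: a1); pose M2 := t^-1 *: (S + D *: a2).
have pM (a : 'M[R]_n) : pdbounds (t * l) (t * L) (S + D *: a) ->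
    pdbounds l L (t^-1 *: (S + D *: a)).
  move=> /(@pdboundsZ _ t^-1 _ _ _); rewrite invr_gt0 => /(_ t0).
  by rewrite !mulKf ?gt_eqF.
have eM (a : 'M[R]_n) : S + D *: a = t *: (t^-1 *: (S + D *: a)).
  by rewrite scalerA mulfV ?gt_eqF// scale1r.
rewrite (eM a1) (eM a2).
rewrite (gaussk_scale _ t0 (pdbounds_unit l0 (pM _ h1))).
rewrite (gaussk_scale _ t0 (pdbounds_unit l0 (pM _ h2))).
pose r := (Num.sqrt t)^-1 *: v; pose s := sqn r.
pose e := D / Num.sqrt t.
have st0 : 0 < Num.sqrt t by rewrite sqrtr_gt0.
have s0 : 0 <= s by exact: sqn_ge0.
have sv : sqn v = t * s.
  by rewrite /s /r sqnZ exprVn sqr_sqrtr ?(ltW t0)// mulrA mulfV ?gt_eqF// mul1r.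
have -> : (Num.sqrt t)^-1 *: (v + D *: w) = r + e *: w.
  by rewrite scalerDr scalerA [_^-1 * D]mulrC.
pose dl := D / t * (H * sqn v `^ (eta / 2)).
have dl0 : 0 <= dl by rewrite !mulr_ge0 ?invr_ge0 ?powR_ge0 ?(ltW t0) ?(ltW D0).
have hd i j : `|(t^-1 *: (S + D *: a1) - t^-1 *: (S + D *: a2)) i j| <= dl.
  rewrite -scalerBr opprD addrACA subrr add0r -scalerBr scalerA mxE normrM.
  rewrite ger0_norm ?mulr_ge0 ?invr_ge0 ?(ltW t0) ?(ltW D0)// [_^-1 * D]mulrC.
  by rewrite ler_wpM2l// divr_ge0 ?(ltW t0) ?(ltW D0).
have eE : 0 <= e <= Num.sqrt T.
  rewrite /e divr_ge0 ?(ltW D0) ?(ltW st0)//= ler_pdivrMr//.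
  rewrite -{1}(sqr_sqrtr (ltW D0)) expr2.
  by apply: ler_pM; rewrite ?sqrtr_ge0// ler_wsqrtr.
have := hC _ _ r w e dl (pM _ h1) (pM _ h2) dl0 hd wK eE; rewrite -/s.
set g1 := gauss_unnorm _ _; set g2 := gauss_unnorm _ _ => hg.
pose A := t `^ (eta / 2 - 1) + t `^ (- 2^-1).
have A0 : 0 <= A by rewrite addr_ge0 ?powR_ge0.
(* The Hoelder term produces t^(eta/2 - 1) and the drift t^(-1/2); both are rounded up by the factor
   1 + s. *)
have hde : dl + e <= (H + 1) * D * A * (1 + s).
  have k1 : dl <= H * D * t `^ (eta / 2 - 1) * (1 + s).
    rewrite /dl sv powRM ?(ltW t0)//.
    have -> : t `^ (eta / 2 - 1) = t `^ (eta / 2) / t.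
      by rewrite /powR gt_eqF// mulrBl mul1r expRB lnK.
    have -> : D / t * (H * (t `^ (eta / 2) * s `^ (eta / 2))) =
      H * D * (t `^ (eta / 2) / t) * s `^ (eta / 2) by ring.
    apply: ler_wpM2l; first by rewrite !mulr_ge0 ?invr_ge0 ?powR_ge0 ?(ltW t0) ?(ltW D0).
    by apply: powR_le1D => //; apply/andP; split; lra.
  have k2 : e <= D * t `^ (- 2^-1) * (1 + s).
    rewrite /e powRN powR12_sqrt ?(ltW t0)// ler_peMr ?lerDl//.
    by rewrite divr_ge0 ?(ltW D0) ?(ltW st0).
  have := powR_ge0 t (eta / 2 - 1); have := powR_ge0 t (- 2^-1).
  rewrite /A; set x := t `^ (- 2^-1) in k2 *; set y := t `^ _ in k1 * => x0 y0.
  have z1 : 0 <= H * D * x * (1 + s) by rewrite !mulr_ge0 ?(ltW D0)// addr_ge0.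
  have z2 : 0 <= D * y * (1 + s) by rewrite !mulr_ge0 ?(ltW D0)// addr_ge0.
  lra.
have hpe : (1 + s) * (1 + s) * expR (- (s / (4 * L))) <= C2 * expR (- (s / (8 * L))).
  have := hC2 _ s0; rewrite (powR_mulrn 2) ?addr_ge0// expr2.
  have -> : expR (- (s / (4 * L))) = expR (- ((8 * L)^-1 * s)) * expR (- (s / (8 * L))).
    by rewrite -expRD; congr expR; field; rewrite gt_eqF.
  by rewrite mulrA => h; rewrite ler_wpM2r ?expR_ge0.
have L4t : 0 < 4 * L * t by rewrite !mulr_gt0.
have p0 : 0 < pi :> R := pi_gt0 R.
have -> : gaussk (4 * L * t)%:M v = expR (- (s / (8 * L))) / q / Num.sqrt ((2 * pi * t) ^+ n).
  rewrite gaussk_scalarE// sv -[RHS]mulrA; congr (expR (- _) * _).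
    by field; rewrite !gt_eqF.
  rewrite -invfM -sqrtrM ?exprn_ge0 ?mulr_ge0 ?(ltW L0)// -exprMn.
  by congr (_^-1); congr (Num.sqrt (_ ^+ _)); ring.
rewrite mulrA -mulrDl; apply: ler_wpM2r; first by rewrite invr_ge0 sqrtr_ge0.
apply: le_trans hg _; rewrite lerD2l.
have -> : C * (H + 1) * C2 * q * D * A * (expR (- (s / (8 * L))) / q) =
  C * ((H + 1) * D * A * (C2 * expR (- (s / (8 * L))))) by field; rewrite gt_eqF.
move: (expR (- (s / (4 * L)))) (expR_ge0 (- (s / (4 * L)))) hpe => x x0 hpe.
have s10 : 0 <= 1 + s by rewrite addr_ge0.
rewrite -!(mulrA C); apply: ler_wpM2l; first exact: ltW.
apply: (@le_trans _ _ ((H + 1) * D * A * (1 + s) * ((1 + s) * x))).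
  by rewrite -mulrA; apply: ler_wpM2r => //; rewrite mulr_ge0.
rewrite -[leLHS]mulrA; apply: ler_wpM2l; first by rewrite mulr_ge0// mulr_ge0 ?(ltW D0)// addr_ge0.
by rewrite mulrA.
Qed.

Local Open Scope ereal_scope.
Notation mu := (@lebesgue_measure R).

(* Complete the square in the integration variable; the determinant and inverse
   of the updated covariance are those of a rank-one update. *)
Lemma gaussk_rank_one n (l L v : R) (S : 'M[R]_n) (b w : 'cV[R]_n) :
  (0 < l)%R -> pdbounds l L S -> (0 < v)%R ->
  \int[mu]_x (gaussk S (w + x *: b) * normal_pdf 0 (Num.sqrt v) x)%:E =
  (gaussk (S + v *: (b *m b^T)) w)%:E.
Proof.
move=> l0 hS v0.
pose Q := invmx S; pose A := qform Q w w; pose B := qform Q b w; pose C := qform Q b b.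
have C0 : (0 <= C)%R by exact: (qform_inv_ge0 l0 hS).
have vC : (0 < 1 + v * C)%R by rewrite ltr_pwDl// mulr_ge0// ltW.
pose s := (v / (1 + v * C))%R; have s0 : (0 < s)%R by rewrite divr_gt0.
pose m := (- (s * B))%R.
pose K := gaussk (S + v *: (b *m b^T)) w.
transitivity (\int[mu]_x (K%:E * (normal_pdf m (Num.sqrt s) x)%:E)).
  apply: eq_integral => x _; rewrite -EFinM; congr EFin.
  rewrite /K /gaussk /gauss_unnorm (qform_rank_one_update b l0 hS (ltW v0) w).
  rewrite (det_rank_one_update b v l0 hS) -/Q -/A -/B -/C.
  rewrite normrM (ger0_norm (ltW vC)) sqrtrM//.
  rewrite !normal_pdfE ?gt_eqF ?sqrtr_gt0// /normal_peak /normal_fun subr0.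
  rewrite !sqr_sqrtr ?(ltW v0) ?(ltW s0)//.
  have -> : Num.sqrt (s * pi *+ 2) = (Num.sqrt (v * pi *+ 2) / Num.sqrt (1 + v * C))%R.
    have -> : (s * pi *+ 2 = (v * pi *+ 2) * (1 + v * C)^-1)%R.
      by rewrite /s -(mulr_natl (v * pi) 2) -(mulr_natl (_ * pi) 2); ring.
    by rewrite sqrtrM ?mulrn_wge0 ?mulr_ge0 ?pi_ge0 ?(ltW v0)// sqrtrV// ltW.
  have -> : qform Q (w + x *: b) (w + x *: b) = (A + 2 * x * B + x ^+ 2 * C)%R.
    rewrite qformDl !qformDr !qformZl !qformZr (qformC w b (pdbounds_inv_sym hS)).
    by rewrite -/A -/B -/C; ring.
  set d := Num.sqrt `|_|; set p := Num.sqrt ((2 * pi) ^+ n).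
  set k := Num.sqrt (v * pi *+ 2); set z := Num.sqrt (1 + v * C).
  have z0 : z != 0%R by rewrite gt_eqF// sqrtr_gt0.
  rewrite !invfM invrK.
  have E : (expR (- ((A + 2 * x * B + x ^+ 2 * C) / 2)) * expR (- x ^+ 2 / (v *+ 2)) =
    expR (- ((A - v * B ^+ 2 / (1 + v * C)) / 2)) * expR (- (x - m) ^+ 2 / (s *+ 2)))%R.
    rewrite -!expRD; congr expR; rewrite /m /s -(mulr_natl v 2) -(mulr_natl (v / _) 2).
    by field; rewrite !gt_eqF.
  transitivity ((expR (- ((A + 2 * x * B + x ^+ 2 * C) / 2)) *
    expR (- x ^+ 2 / (v *+ 2))) / d / p / k)%R.
    by ring.
  by rewrite E; move: (d^-1)%R (p^-1)%R (k^-1)%R => d' p' k'; field.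
rewrite integralZl//; last exact: integrable_normal_pdf.
by rewrite integral_normal_pdf mule1.
Qed.

End gaussk.

(** * Iterated integrals for Lebesgue measure on columns *)

Section sigma_finite_copy.
Context {d : measure_display} {T : measurableType d} {R : realType}.
Variables (mu : {measure set T -> \bar R}).

(* A copy of [mu] carrying its sigma-finiteness, which Fubini's theorem
   requires canonically. *)
Definition sf_measure of sigma_finite setT mu : set T -> \bar R := mu.

HB.instance Definition _ h := Measure.copy (sf_measure h) mu.
HB.instance Definition _ (h : sigma_finite setT mu) :=
  Measure_isSigmaFinite.Build _ _ _ (sf_measure h) h.

End sigma_finite_copy.

Section lebesgue_cV_integral.
Context {R : realType}.
Local Open Scope ereal_scope.
Notation mu := (@lebesgue_measure R).

Lemma sigma_finite_lebesgue_cV n : sigma_finite setT (@lebesgue_cV R n).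
Proof.
exists (fun k => [set x : 'cV[R]_n | forall l, `[(- k%:R)%R, (k%:R : R)]%classic (x l 0%R)]).
  apply/esym; rewrite -subTset => x _.
  pose M := (\sum_l `|x l 0|)%R.
  have [k Mk] : exists k : nat, (M <= k%:R)%R.
    by exists (Num.truncn M).+1; apply/ltW/truncnS_gt.
  exists k => // l /=; rewrite in_itv /= -ler_norml; apply: le_trans Mk.
  by rewrite /M (bigD1 l)//= lerDl sumr_ge0.
move=> k; split.
  have -> : [set x : 'cV[R]_n | forall l, `[(- k%:R)%R, (k%:R : R)]%classic (x l 0%R)] =
      \bigcap_(l in [set: 'I_n]) ((fun x : 'cV[R]_n => x l 0%R) @^-1` `[(- k%:R)%R, (k%:R : R)]%classic).
    by apply/seteqP; split=> x h l; [move=> _|]; apply: h.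
  apply: fin_bigcap_measurable => [|l _]; first exact: finite_finset.
  by rewrite -[X in measurable X]setTI; apply: measurable_mx_entry.
rewrite (@lebesgue_cV_box R n (fun=> `[(- k%:R)%R, (k%:R : R)]%classic))//.
rewrite big_const_ord.
have [a ->] : exists a, mu `[(- k%:R)%R, (k%:R : R)] = a%:E.
  by rewrite lebesgue_measure_itv /=; case: ifP => _; eexists; rewrite -?EFinD.
suff -> : iter n ( *%E a%:E) 1 = (a ^+ n)%:E by rewrite ltry.
by elim: n => [|n IH] //=; rewrite IH -EFinM exprS.
Qed.

Definition sf_lebesgue_cV n : {sigma_finite_measure set 'cV[R]_n -> \bar R} :=
  sf_measure (sigma_finite_lebesgue_cV n).

Lemma ge0_integral_lebesgue_cVS n (f : 'cV[R]_n.+1 -> \bar R) :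
  measurable_fun [set: 'cV[R]_n.+1] f -> (forall x, 0 <= f x) ->
  \int[lebesgue_cV n.+1]_x f x =
  \int[lebesgue_cV n]_v \int[mu]_y f (cons_cV (v, y)).
Proof.
move=> mf f0.
rewrite /= ge0_integral_pushforward//.
rewrite preimage_setT.
rewrite (@fubini_tonelli1 _ _ _ _ _ (sf_lebesgue_cV n) mu (f \o @cons_cV R n))//.
  by apply: measurableT_comp => //; exact: measurable_cons_cV.
  by move=> x; exact: f0.
exact: measurable_cons_cV.
Qed.

End lebesgue_cV_integral.

(** * Measurability of matrix expressions *)

Section measurability.
Context {d : measure_display} {T : measurableType d} {R : realType}.

Lemma measurable_fun_entry m n (f : T -> 'M[R]_(m, n)) i j :
  measurable_fun setT f -> measurable_fun setT (fun x => f x i j).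
Proof.
by move=> mf; apply: (measurableT_comp (measurable_mx_entry i j)).
Qed.

Lemma measurable_fun_addmx m n (f g : T -> 'M[R]_(m, n)) :
  measurable_fun setT f -> measurable_fun setT g ->
  measurable_fun setT (fun x => f x + g x).
Proof.
move=> mf mg; apply: measurable_fun_matrix => i j.
under eq_fun do rewrite mxE.
by apply: measurable_funD; exact: measurable_fun_entry.
Qed.

Lemma measurable_fun_scalemx m n (a : R) (f : T -> 'M[R]_(m, n)) :
  measurable_fun setT f -> measurable_fun setT (fun x => a *: f x).
Proof.
move=> mf; apply: measurable_fun_matrix => i j.
under eq_fun do rewrite mxE.
by apply: measurable_funM => //; exact: measurable_fun_entry.
Qed.

Lemma measurable_fun_mulmx m n p (f : T -> 'M[R]_(m, n)) (g : T -> 'M[R]_(n, p)) :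
  measurable_fun setT f -> measurable_fun setT g ->
  measurable_fun setT (fun x => f x *m g x).
Proof.
move=> mf mg; apply: measurable_fun_matrix => i j.
under eq_fun do rewrite mxE.
by apply: measurable_sum => k; apply: measurable_funM; exact: measurable_fun_entry.
Qed.

Lemma measurable_fun_sqn n (f : T -> 'cV[R]_n) :
  measurable_fun setT f -> measurable_fun setT (fun x => sqn (f x)).
Proof.
move=> mf; apply: measurable_sum => i; apply: measurable_funX.
exact: measurable_fun_entry.
Qed.

Lemma measurable_fun_gaussk n (S : 'M[R]_n) (f : T -> 'cV[R]_n) :
  measurable_fun setT f -> measurable_fun setT (fun x => gaussk S (f x)).
Proof.
move=> mf; apply: measurable_funM => //; apply: measurable_funM => //.
apply: measurableT_comp => //; apply: measurable_funN; apply: measurable_funM => //.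
under eq_fun do rewrite qformE.
apply: measurable_sum => i; apply: measurable_sum => j.
by apply: measurable_funM; [apply: measurable_funM => //|]; exact: measurable_fun_entry.
Qed.

Lemma measurable_fun_gaussian_density n (v : R) (f : T -> 'cV[R]_n) :
  measurable_fun setT f -> measurable_fun setT (fun x => gaussian_density v (f x)).
Proof.
move=> mf; apply: measurable_prod => i _.
apply: (measurableT_comp (measurable_normal_pdf _ _)).
exact: measurable_fun_entry.
Qed.

End measurability.

(** * Convolution with Gaussian noise *)

Section gaussian_convolution.
Context {R : realType}.
Local Open Scope ereal_scope.

Lemma gaussian_density_ge0 n (v : R) (x : 'cV[R]_n) : (0 <= gaussian_density v x)%R.
Proof. by apply: prodr_ge0 => i _; exact: normal_pdf_ge0. Qed.

Lemma cons_cV0 n (v : 'cV[R]_n) (y : R) : cons_cV (v, y) 0%R 0%R = y.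
Proof.
have -> : (0%R : 'I_n.+1) = @lshift 1 n ord0 by exact: val_inj.
by rewrite /cons_cV (@col_mxEu R 1 n 1) mxE eqxx mulr1n.
Qed.

Lemma cons_cVS n (v : 'cV[R]_n) (y : R) i : cons_cV (v, y) (lift ord0 i) 0%R = v i 0%R.
Proof.
have -> : lift ord0 i = rshift 1 i by exact: val_inj.
by rewrite /cons_cV (@col_mxEd R 1 n 1).
Qed.

Lemma gaussian_density_cons n (t : R) (v : 'cV[R]_n) (y : R) :
  gaussian_density t (cons_cV (v, y)) =
  (normal_pdf 0 (Num.sqrt t) y * gaussian_density t v)%R.
Proof.
rewrite /gaussian_density big_ord_recl cons_cV0; congr (_ * _)%R.
by apply: eq_bigr => i _; rewrite cons_cVS.
Qed.

(* Integrate out the noise one coordinate at a time. *)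
Lemma gaussk_convolution n m (l L v : R) (S : 'M[R]_n) (B : 'M[R]_(n, m)) w :
  (0 < l)%R -> pdbounds l L S -> (0 < v)%R ->
  \int[lebesgue_cV m]_x (gaussk S (w + B *m x) * gaussian_density v x)%:E =
  (gaussk (S + v *: (B *m B^T)) w)%:E.
Proof.
move=> l0 + v0.
elim: m L S B w => [|m IH] L S B w hS.
  rewrite /= integral_dirac//; last first.
    apply/measurable_EFinP; apply: measurable_funM; last exact: measurable_fun_gaussian_density.
    apply: measurable_fun_gaussk; apply: measurable_fun_addmx => //.
    by apply: measurable_fun_mulmx.
  rewrite diracT mul1e (thinmx0 B) !mul0mx scaler0 !addr0.
  by rewrite /gaussian_density big_ord0 mulr1.
rewrite ge0_integral_lebesgue_cVS; last 2 first.
- apply/measurable_EFinP; apply: measurable_funM; last exact: measurable_fun_gaussian_density.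
  apply: measurable_fun_gaussk; apply: measurable_fun_addmx => //.
  by apply: measurable_fun_mulmx.
- by move=> x; rewrite lee_fin mulr_ge0 ?gaussk_ge0 ?gaussian_density_ge0.
(* The first column of [B] multiplies the head coordinate of the noise, and B B^T is the sum of the
   contributions of [b0] and [B1]. *)
pose b0 : 'cV[R]_n := @lsubmx R n 1 m B; pose B1 : 'M[R]_(n, m) := @rsubmx R n 1 m B.
have BE : B = @row_mx R n 1 m b0 B1 by rewrite hsubmxK.
have BB : B *m B^T = (b0 *m b0^T + B1 *m B1^T)%R.
  by rewrite BE (@tr_row_mx R n 1 m) (@mul_row_col R n 1 m n).
have Bx x (y : R) : B *m cons_cV (x, y) = (y *: b0 + B1 *m x)%R.
  by rewrite BE /cons_cV /= (@mul_row_col R n 1 m 1) mul_mx_scalar.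
transitivity (\int[lebesgue_cV m]_x
   (gaussk (S + v *: (b0 *m b0^T)) (w + B1 *m x) * gaussian_density v x)%:E).
  apply: eq_integral => x _.
  transitivity (\int[lebesgue_measure]_y ((gaussian_density v x)%:E *
    (gaussk S ((w + B1 *m x) + y *: b0) * normal_pdf 0 (Num.sqrt v) y)%:E)).
    apply: eq_integral => y _; rewrite -EFinM gaussian_density_cons Bx.
    by rewrite (addrC (y *: b0)) addrA; congr EFin; ring.
  rewrite ge0_integralZl//; last 3 first.
  - apply/measurable_EFinP; apply: measurable_funM; last exact: measurable_normal_pdf.
    apply: measurable_fun_gaussk; apply: measurable_fun_addmx => //.
    apply: measurable_fun_matrix => i j; under eq_fun do rewrite mxE.
    by apply: measurable_funM.
  - by move=> y _; rewrite lee_fin mulr_ge0 ?gaussk_ge0 ?normal_pdf_ge0.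
  - by rewrite lee_fin gaussian_density_ge0.
  by rewrite (gaussk_rank_one _ _ l0 hS v0) -EFinM mulrC.
have [L' hS'] := pdbounds_rank_one_update b0 hS (ltW v0).
by rewrite (IH _ _ _ _ hS') BB scalerDr addrA.
Qed.

Lemma pdbounds_scalar n (t : R) : pdbounds t t (t%:M : 'M[R]_n).
Proof.
split; first by rewrite tr_scalar_mx.
by move=> v; rewrite -scalemx1 qform_scalem qform1 lexx.
Qed.

(* [lebesgue_cV] is only known through iterated integrals, so translation
   invariance is replaced by the explicit one-dimensional integrals. *)
Lemma integral_gaussk_scalar n (t : R) (y : 'cV[R]_n) : (0 < t)%R ->
  \int[lebesgue_cV n]_x (gaussk t%:M (x - y))%:E = 1.
Proof.
move=> t0; under eq_integral do rewrite -gaussian_densityE//.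
elim: n y => [|n IH] y.
  rewrite /= integral_dirac//; last first.
    by apply/measurable_EFinP; apply: measurable_fun_gaussian_density;
       apply: measurable_fun_addmx.
  by rewrite diracT mul1e /gaussian_density big_ord0.
rewrite ge0_integral_lebesgue_cVS; last 2 first.
- by apply/measurable_EFinP; apply: measurable_fun_gaussian_density;
    apply: measurable_fun_addmx.
- by move=> x; rewrite lee_fin gaussian_density_ge0.
pose y1 : 'cV[R]_n := \col_i y (lift ord0 i) 0%R.
rewrite -(IH y1); apply: eq_integral => x _.
transitivity (\int[lebesgue_measure]_z ((gaussian_density t (x - y1))%:E *
    (normal_pdf (y 0%R 0%R) (Num.sqrt t) z)%:E)).
  apply: eq_integral => z _; rewrite -EFinM; congr EFin.
  rewrite /gaussian_density big_ord_recl mulrC; congr (_ * _)%R.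
    by apply: eq_bigr => i _; rewrite mxE cons_cVS !mxE.
  rewrite mxE cons_cV0 mxE !normal_pdfE ?gt_eqF ?sqrtr_gt0//.
  by rewrite /normal_fun subr0.
rewrite ge0_integralZl//; last 3 first.
- by apply/measurable_EFinP; exact: measurable_normal_pdf.
- by move=> z _; rewrite lee_fin normal_pdf_ge0.
- by rewrite lee_fin gaussian_density_ge0.
by rewrite integral_normal_pdf mule1.
Qed.

End gaussian_convolution.

(** * Polynomial weights *)

Section weights.
Context {R : realType}.

Lemma enorm_sqn n (x : 'cV[R]_n) : enorm x ^+ 2 = sqn x.
Proof.
rewrite /enorm; under eq_bigr do rewrite big_ord1.
by rewrite sqr_sqrtr ?sqn_ge0.
Qed.

(** Peetre's inequality, read off from |y|^2 / 2 - |x - y|^2 <= |x|^2. *)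
Lemma sqn_sub_peetre n (x y : 'cV[R]_n) :
  1 + sqn y <= 2 * (1 + sqn (x - y)) * (1 + sqn x).
Proof.
have := sqn_shift_ge y (x - y); have -> : y + (x - y) = x by rewrite addrC subrK.
have := mulr_ge0 (sqn_ge0 (x - y)) (sqn_ge0 x).
have := sqn_ge0 (x - y); have := sqn_ge0 x; lra.
Qed.

Lemma powR_div_le (p k a b : R) : 0 <= p -> 0 < a -> 0 < b -> 0 < k -> b <= k * a ->
  (a `^ p)^-1 <= k `^ p / b `^ p.
Proof.
move=> p0 a0 b0 k0 h.
rewrite ler_pdivlMr ?powR_gt0// mulrC ler_pdivrMr ?powR_gt0//.
rewrite -powRM ?(ltW k0) ?(ltW a0)//; apply: ge0_ler_powR => //.
  by rewrite nnegrE ltW.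
by rewrite nnegrE mulr_ge0 ?(ltW k0) ?(ltW a0).
Qed.

(** Density of the law of X_i after reweighting by (1 + |X_i|^2)^(-q). *)
Definition wnu n (c mu q : R) (x : 'cV[R]_n) : R :=
  nu c mu x / (1 + sqn x) `^ q.

Lemma onesqn_gt0 n (x : 'cV[R]_n) : 0 < 1 + sqn x.
Proof. by rewrite ltr_pwDl// sqn_ge0. Qed.

Lemma nu_gt0 n (c mu : R) (x : 'cV[R]_n) : 0 < c -> 0 < nu c mu x.
Proof.
move=> c0; apply: prodr_gt0 => i _.
by rewrite divr_gt0// powR_gt0// ltr_pwDl// sqr_ge0.
Qed.

Lemma wnu_gt0 n (c mu q : R) (x : 'cV[R]_n) : 0 < c -> 0 < wnu c mu q x.
Proof. by move=> c0; rewrite divr_gt0 ?nu_gt0// powR_gt0// onesqn_gt0. Qed.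

(** Peetre's inequality in each coordinate, with |x_i - y_i| enlarged to |x - y|; the n equal
    factors account for the exponent. *)
Lemma nu_shift_le n (c mu : R) (x y : 'cV[R]_n) : 0 < c -> 0 < mu ->
  nu c mu x <= (2 * (1 + sqn (x - y))) `^ (n%:R * ((mu + 1) / 2)) * nu c mu y.
Proof.
move=> c0 mu0; set p := (mu + 1) / 2.
have p0 : 0 <= p by rewrite divr_ge0// addr_ge0// ltW.
set k := 2 * _; have k0 : 0 < k by rewrite mulr_gt0// onesqn_gt0.
have -> : k `^ (n%:R * p) = \prod_(i < n) k `^ p.
  by rewrite prodr_const card_ord mulrC powRrM powR_mulrn// powR_ge0.
rewrite -big_split /=; apply: ler_prod => i _; apply/andP; split.
  by rewrite divr_ge0 ?(ltW c0)// powR_ge0.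
rewrite mulrCA; apply: ler_wpM2l; first exact: ltW.
apply: powR_div_le => //.
- by rewrite ltr_pwDl// sqr_ge0.
- by rewrite ltr_pwDl// sqr_ge0.
have h : (x i 0 - y i 0) ^+ 2 <= sqn (x - y).
  by rewrite /sqn (bigD1 i)//= !mxE lerDl sumr_ge0// => j _; exact: sqr_ge0.
have : 1 + y i 0 ^+ 2 <= 2 * (1 + (x i 0 - y i 0) ^+ 2) * (1 + x i 0 ^+ 2).
  have := sqr_ge0 (2 * x i 0 - y i 0).
  have := mulr_ge0 (sqr_ge0 (x i 0 - y i 0)) (sqr_ge0 (x i 0)).
  lra.
move=> /le_trans; apply; apply: ler_wpM2r; first by rewrite addr_ge0 ?sqr_ge0.
by rewrite /k; lra.
Qed.

Lemma wnu_shift_le n (c mu q : R) (x y : 'cV[R]_n) : 0 < c -> 0 < mu -> 0 <= q ->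
  wnu c mu q x <=
  (2 * (1 + sqn (x - y))) `^ (q + n%:R * ((mu + 1) / 2)) * wnu c mu q y.
Proof.
move=> c0 mu0 q0; set k := 2 * _; have k0 : 0 < k by rewrite mulr_gt0// onesqn_gt0.
rewrite powRD ?(gt_eqF k0) ?implybT//.
rewrite /wnu mulrC.
have -> : forall a b u v : R, a * b * (u / v) = a / v * (b * u) by move=> *; ring.
apply: ler_pM.
- by rewrite invr_ge0 powR_ge0.
- exact/ltW/nu_gt0.
- by apply: powR_div_le; rewrite ?onesqn_gt0 ?sqn_sub_peetre.
- exact: nu_shift_le.
Qed.

(** Half of the Gaussian exponent absorbs the power, which doubles the variance. Measuring |u|^2 in
    units of s makes the constant uniform in s. *)
Lemma sqnpow_gaussk_le n (m : R) : 0 <= m ->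
  exists2 C, 0 < C & forall (s : R) (u : 'cV[R]_n), 0 < s ->
    (1 + sqn u / s) `^ m * gaussk s%:M u <= C * gaussk (2 * s)%:M u.
Proof.
move=> m0; have [C C0 hC] := @powR_expR_bound R m 4^-1 m0 ltac:(by rewrite invr_gt0).
exists (C * Num.sqrt (2 ^+ n)); first by rewrite mulr_gt0// sqrtr_gt0 exprn_gt0.
move=> s u s0; have p0 := pi_gt0 R.
rewrite !gaussk_scalarE ?mulr_gt0//.
have -> : (2 * pi * (2 * s)) ^+ n = 2 ^+ n * (2 * pi * s) ^+ n.
  by rewrite -exprMn; congr (_ ^+ _); ring.
rewrite sqrtrM ?exprn_ge0//.
set z := Num.sqrt (2 ^+ n); set k := Num.sqrt (_ ^+ _).
have z0 : z != 0 by rewrite gt_eqF// sqrtr_gt0 exprn_gt0.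
have k0 : k != 0 by rewrite gt_eqF// sqrtr_gt0 exprn_gt0// !mulr_gt0.
have -> : C * z * (expR (- (sqn u / (2 * (2 * s)))) / (z * k)) =
  C * expR (- (sqn u / (2 * (2 * s)))) / k by field; rewrite z0 k0.
rewrite mulrA; apply: ler_wpM2r; first by rewrite invr_ge0 sqrtr_ge0.
have -> : expR (- (sqn u / (2 * s))) =
  expR (- (4^-1 * (sqn u / s))) * expR (- (sqn u / (2 * (2 * s)))).
  by rewrite -expRD; congr expR; field; rewrite gt_eqF.
rewrite mulrA; apply: ler_wpM2r; first exact: expR_ge0.
by apply: hC; rewrite divr_ge0 ?sqn_ge0// ltW.
Qed.

Lemma measurable_nu n (c mu : R) : measurable_fun [set: 'cV[R]_n] (@nu R n c mu).
Proof.
apply: measurable_prod => i _; apply: measurable_funM => //.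
have -> : (fun x : 'cV[R]_n => ((1 + x i 0 ^+ 2) `^ ((mu + 1) / 2))^-1) =
  (fun x : 'cV[R]_n => (1 + x i 0 ^+ 2) `^ (- ((mu + 1) / 2))).
  by apply/funext => x; rewrite powRN.
apply: (measurableT_comp (measurable_powR _)).
apply: measurable_funD => //; apply: measurable_funX; exact: measurable_mx_entry.
Qed.

Lemma measurable_onesqn_powR n (q : R) :
  measurable_fun setT (fun x : 'cV[R]_n => (1 + sqn x) `^ q).
Proof.
apply: (measurableT_comp (measurable_powR _)).
by apply: measurable_funD => //; exact: measurable_fun_sqn.
Qed.

Lemma measurable_wnu n (c mu q : R) : measurable_fun [set: 'cV[R]_n] (@wnu n c mu q).
Proof.
apply: measurable_funM; first exact: measurable_nu.
have -> : (fun x : 'cV[R]_n => ((1 + sqn x) `^ q)^-1) = (fun x => (1 + sqn x) `^ (- q)).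
  by apply/funext => x; rewrite powRN.
exact: measurable_onesqn_powR.
Qed.

(** Move the weight from x to y by [wnu_shift_le]. Then 1 + |u|^2 <= (1 + s) (1 + |u|^2 / s)
    separates the growth in s from a power that the kernel absorbs. *)
Lemma integral_wnu_gaussk_le n (c mu q : R) : 0 < c -> 0 < mu -> 0 <= q ->
  exists2 C, 0 < C & forall (s : R) (y : 'cV[R]_n), 0 < s ->
   (\int[lebesgue_cV n]_x (wnu c mu q x * gaussk s%:M (x - y))%:E <=
   (C * (1 + s) `^ (q + n%:R * ((mu + 1) / 2)) * wnu c mu q y)%:E)%E.
Proof.
move=> c0 mu0 q0; set m := q + _.
have m0 : 0 <= m by rewrite addr_ge0// mulr_ge0// divr_ge0// addr_ge0// ltW.
have [C C0 hC] := @sqnpow_gaussk_le n m m0.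
exists (2 `^ m * C); first by rewrite mulr_gt0// powR_gt0.
move=> s y s0.
set K := _ * wnu c mu q y.
have K0 : 0 <= K.
  by rewrite mulr_ge0 ?(ltW (wnu_gt0 _ _ _ c0))// !mulr_ge0 ?powR_ge0// ltW.
have md (t : R) : measurable_fun setT (fun x : 'cV[R]_n => gaussk t%:M (x - y)).
  by apply: measurable_fun_gaussk; exact: measurable_fun_addmx.
apply: (@le_trans _ _ (\int[lebesgue_cV n]_x (K%:E * (gaussk (2 * s)%:M (x - y))%:E))%E).
  apply: ge0_le_integral => //.
  - by move=> x _; rewrite lee_fin mulr_ge0 ?gaussk_ge0 ?(ltW (wnu_gt0 _ _ _ c0)).
  - apply/measurable_EFinP; apply: measurable_funM => //; exact: measurable_wnu.
  - by apply: measurable_funeM; apply/measurable_EFinP; exact: md.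
  move=> x _; rewrite -EFinM lee_fin.
  set u := x - y.
  have k1 : 0 < 1 + sqn u / s by rewrite ltr_pwDl// divr_ge0 ?sqn_ge0// ltW.
  have h1 := wnu_shift_le x y c0 mu0 q0.
  have h2 : (2 * (1 + sqn u)) `^ m <= 2 `^ m * (1 + s) `^ m * (1 + sqn u / s) `^ m.
    rewrite -!powRM ?mulr_ge0 ?(ltW k1)//; last 2 first.
    - by rewrite addr_ge0// ltW.
    - by rewrite addr_ge0// ltW.
    apply: ge0_ler_powR => //.
    - by rewrite nnegrE mulr_ge0// (ltW (onesqn_gt0 _)).
    - by rewrite nnegrE !mulr_ge0 ?(ltW k1)// addr_ge0// ltW.
    rewrite -mulrA ler_wpM2l//.
    have -> : (1 + s) * (1 + sqn u / s) = 1 + s + sqn u + sqn u / s.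
      by field; rewrite gt_eqF.
    have : 0 <= sqn u / s by rewrite divr_ge0 ?sqn_ge0// ltW.
    lra.
  have g0 := gaussk_ge0 s%:M u; have w0 := ltW (wnu_gt0 mu q y c0).
  apply: (@le_trans _ _ (2 `^ m * (1 + s) `^ m * (1 + sqn u / s) `^ m * wnu c mu q y * gaussk s%:M u)).
    apply: ler_wpM2r => //; apply: le_trans h1 _; exact: ler_wpM2r.
  have -> : 2 `^ m * (1 + s) `^ m * (1 + sqn u / s) `^ m * wnu c mu q y * gaussk s%:M u =
    2 `^ m * (1 + s) `^ m * wnu c mu q y * ((1 + sqn u / s) `^ m * gaussk s%:M u) by ring.
  have -> : K * gaussk (2 * s)%:M u =
    2 `^ m * (1 + s) `^ m * wnu c mu q y * (C * gaussk (2 * s)%:M u) by rewrite /K; ring.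
  by apply: ler_wpM2l; [rewrite mulr_ge0// mulr_ge0 ?powR_ge0|exact: hC].
rewrite ge0_integralZl//; last 2 first.
- by apply/measurable_EFinP; exact: md.
- by move=> x _; rewrite lee_fin gaussk_ge0.
by rewrite integral_gaussk_scalar ?mulr_gt0// mule1.
Qed.

End weights.

(** * Weakly singular sums *)

Section weakly_singular_sum.
Context {R : realType}.

(** Young's inequality for the product of r^b and 1, with exponents 1 / b and 1 / (1 - b). *)
Lemma powR_tangent_le (b r : R) : 0 < b < 1 -> 0 <= r -> r `^ b <= 1 + b * (r - 1).
Proof.
move=> /andP[b0 b1] r0.
have := @conjugate_powR R (r `^ b) 1 b^-1 (1 - b)^-1 (powR_ge0 _ _) ler01.
rewrite !invrK invr_gt0 b0 invr_gt0 subr_gt0 b1 addrC subrK.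
move=> /(_ isT isT erefl); rewrite mulr1 powR1 -powRrM mulfV ?gt_eqF// powRr1//.
by rewrite mul1r; lra.
Qed.

(* Tangent of the concave function [x `^ b] at [k.+1%:R * D]. *)
Lemma powR_step_le (b D : R) (k : nat) : 0 < b < 1 -> 0 < D ->
  b * (D * (k.+1%:R * D) `^ (b - 1)) <= (k.+1%:R * D) `^ b - (k%:R * D) `^ b.
Proof.
move=> hb D0; set y := k.+1%:R * D; have y0 : 0 < y by rewrite mulr_gt0.
have /(@powR_tangent_le b _ hb) : 0 <= (k%:R * D) / y.
  by rewrite divr_ge0 ?mulr_ge0 ?(ltW D0) ?(ltW y0).
have -> : k%:R * D / y - 1 = - (D / y).
  by rewrite /y -natr1; field; rewrite natr1 pnatr_eq0 gt_eqF.
have E : k%:R * D = k%:R * D / y * y by rewrite divfK// gt_eqF.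
set r := k%:R * D / y in E *; have r0 : 0 <= r.
  by rewrite divr_ge0 ?mulr_ge0 ?(ltW D0) ?(ltW y0).
rewrite E powRM// ?(ltW y0)// => h.
have -> : y `^ (b - 1) = y `^ b / y by rewrite /powR gt_eqF// mulrBl mul1r expRB lnK.
have := ler_wpM2r (powR_ge0 y b) h.
have -> : b * (D * (y `^ b / y)) = b * (D / y) * y `^ b by ring.
lra.
Qed.

(* [expR (- x) <= x `^ (- (a / 2))] leaves a sum that telescopes, with the factor
   [L `^ (- (a / 2))]. *)
Lemma sum_weakly_singular_le (a T e : R) : 0 < a < 1 -> 0 < T -> 0 < e ->
  exists2 L, 0 < L & forall (D : R) (n : nat), 0 < D -> n%:R * D <= T ->
    \sum_(k < n) D * (k.+1%:R * D) `^ (a - 1) * expR (- (L * (k.+1%:R * D))) <= e.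
Proof.
move=> /andP[a0 a1] T0 e0; pose b := a / 2.
have hb : 0 < b < 1 by rewrite /b; lra.
have /andP[b0 b1] := hb.
(* Chosen so that the telescoped bound T^b / (b L^b) equals [e]. *)
pose L := (T `^ b / (b * e)) `^ b^-1.
have k0 : 0 < T `^ b / (b * e) by rewrite divr_gt0 ?powR_gt0 ?mulr_gt0.
have L0 : 0 < L by rewrite powR_gt0.
have Lb : L `^ b = T `^ b / (b * e) by rewrite /L -powRrM mulVf ?gt_eqF// powRr1 ?(ltW k0).
exists L => // D n D0 nT.
have h k : D * (k.+1%:R * D) `^ (a - 1) * expR (- (L * (k.+1%:R * D))) <=
   ((k.+1%:R * D) `^ b - (k%:R * D) `^ b) / (b * L `^ b).
  set y := k.+1%:R * D; have y0 : 0 < y by rewrite mulr_gt0.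
  have Ly : 0 < L * y by rewrite mulr_gt0.
  have ex : expR (- (L * y)) <= ((L * y) `^ b)^-1.
    rewrite expRN lef_pV2 ?posrE ?expR_gt0 ?powR_gt0//.
    apply: le_trans (expR_ge1Dx _); apply: powR_le1D; first exact: ltW.
    by rewrite !ltW.
  rewrite powRM ?(ltW L0) ?(ltW y0)// in ex.
  have ab : y `^ (a - 1) / y `^ b = y `^ (b - 1).
    by rewrite /powR gt_eqF// -expRB; congr expR; rewrite /b; field.
  rewrite ler_pdivlMr ?mulr_gt0 ?powR_gt0//.
  apply: le_trans (powR_step_le k hb D0); rewrite -/y.
  apply: (@le_trans _ _ (D * y `^ (a - 1) * (L `^ b * y `^ b)^-1 * (b * L `^ b))).
    apply: ler_wpM2r; first by rewrite mulr_ge0 ?powR_ge0 ?(ltW b0).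
    by apply: ler_wpM2l => //; rewrite mulr_ge0 ?powR_ge0 ?(ltW D0).
  rewrite -ab le_eqVlt; apply/orP; left; apply/eqP; field.
  by rewrite !gt_eqF ?powR_gt0.
apply: (@le_trans _ _ (\sum_(k < n) ((k.+1%:R * D) `^ b - (k%:R * D) `^ b) / (b * L `^ b))).
  by apply: ler_sum => k _; exact: h.
rewrite -mulr_suml; have -> : \sum_(k < n) ((k.+1%:R * D) `^ b - (k%:R * D) `^ b) = (n%:R * D) `^ b.
  rewrite -(big_mkord xpredT (fun k => (k.+1%:R * D) `^ b - (k%:R * D) `^ b)).
  rewrite (telescope_sumr (fun k => (k%:R * D) `^ b))// mul0r powR0 ?gt_eqF//.
  by rewrite subr0.
rewrite Lb ler_pdivrMr; last by rewrite mulr_gt0.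
have -> : e * (b * (T `^ b / (b * e))) = T `^ b by field; rewrite !gt_eqF.
apply: ge0_ler_powR => //; rewrite ?nnegrE ?mulr_ge0 ?(ltW D0) ?(ltW T0) ?(ltW b0) ?(ltW a0)//.
Qed.

(** Since eta <= 1, the drift singularity t^(-1/2) = t^(1/2 - eta/2) t^(eta/2 - 1) is no worse than
    the Hoelder one on (0, T]. This is the origin of the constant [kappa]. *)
Lemma powR_singular_le (eta T t u : R) : 0 < eta <= 1 -> 0 < T -> 0 < t <= T -> t <= u ->
  u `^ (eta / 2 - 1) + u `^ (- 2^-1) <=
  (1 + T `^ (2^-1 - eta / 2)) * t `^ (eta / 2 - 1).
Proof.
move=> /andP[eta0 eta1] T0 /andP[t0 tT] tu; have u0 := lt_le_trans t0 tu.
have dec (p : R) : 0 <= p -> u `^ (- p) <= t `^ (- p).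
  move=> p0; rewrite !powRN lef_pV2 ?posrE ?powR_gt0//.
  by apply: ge0_ler_powR => //; rewrite nnegrE ltW.
rewrite mulrDl mul1r; apply: lerD.
  by rewrite -[_ - 1]opprB; apply: dec; lra.
apply: le_trans (dec _ _) _; first by rewrite invr_ge0.
have -> : t `^ (- 2^-1) = t `^ (2^-1 - eta / 2) * t `^ (eta / 2 - 1).
  rewrite -powRD; last by rewrite (gt_eqF t0) implybT.
  by have -> : 2^-1 - eta / 2 + (eta / 2 - 1) = - 2^-1 :> R by field.
apply: ler_wpM2r; first exact: powR_ge0.
by apply: ge0_ler_powR; rewrite ?nnegrE ?(ltW t0) ?(ltW T0)//; lra.
Qed.

End weakly_singular_sum.

(** * Comparison of weighted laws by mollification *)

Section weighted_laws.
Context {R : realType} {d : measure_display} {T : measurableType d}.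
Context {d1 d2 : measure_display} {O1 : measurableType d1} {O2 : measurableType d2}.
Variables (m1 : {measure set O1 -> \bar R}) (m2 : {measure set O2 -> \bar R}).
Variables (Y1 : O1 -> T) (Y2 : O2 -> T) (w1 : O1 -> R) (w2 : O2 -> R).
Hypotheses (mY1 : measurable_fun setT Y1) (mY2 : measurable_fun setT Y2).
Hypotheses (mw1 : measurable_fun setT w1) (mw2 : measurable_fun setT w2).
Hypotheses (w10 : forall x, 0 <= w1 x) (w20 : forall x, 0 <= w2 x).
Local Open Scope ereal_scope.
Hypothesis le_sets : forall A, measurable A ->
  \int[m1]_x (w1 x * \1_A (Y1 x))%:E <= \int[m2]_x (w2 x * \1_A (Y2 x))%:E.

Import HBNNSimple.

Let sfun_integral d' (O : measurableType d') (m : {measure set O -> \bar R})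
    (Y : O -> T) (w : O -> R) (f : {nnsfun T >-> R}) :
  measurable_fun setT Y -> measurable_fun setT w -> (forall x, 0 <= w x)%R ->
  \int[m]_x (w x * f (Y x))%:E =
  \sum_(r \in range f) (r%:E * \int[m]_x (w x * \1_(f @^-1` [set r]) (Y x))%:E).
Proof.
move=> mY mw w0.
have mI r : measurable_fun setT (fun x => (w x * \1_(f @^-1` [set r]) (Y x))%:E).
  apply/measurable_EFinP; apply: measurable_funM => //.
  by apply: (measurableT_comp (measurable_indic _)).
transitivity (\int[m]_x (\sum_(r \in range f)
    (r * (w x * \1_(f @^-1` [set r]) (Y x)))%:E)).
  apply: eq_integral => x _; rewrite fimfunE fsumEFin//; congr EFin.
  rewrite mulr_fsumr; apply: eq_fsbigr => r _; ring.
rewrite ge0_integral_fsum//; last 2 first.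
- move=> r; apply/measurable_EFinP; apply: measurable_funM => //.
  by have /measurable_EFinP := mI r.
- move=> r x _; rewrite lee_fin.
  (* A negative level is never attained by the nonnegative [f], so its indicator vanishes. *)
  have [r0|r0] := leP 0%R r; first by rewrite !mulr_ge0.
  rewrite indicE; case: (boolP (Y x \in _)) => [|_]; last by rewrite !mulr0.
  by rewrite inE /= => E; move: r0; rewrite -E ltNge fun_ge0.
apply: eq_fsbigr => r /[!inE] -[y _ <-].
under eq_integral do rewrite EFinM.
by rewrite ge0_integralZl ?lee_fin// => x _; rewrite lee_fin mulr_ge0.
Qed.

(** Simple functions reduce to sets, and monotone convergence does the rest. The two sides may live
    on different spaces, so that a law can be compared with a weighted Lebesgue measure as well as
    with another law. *)
Lemma le_integral_sets (F : T -> R) : measurable_fun setT F -> (forall x, 0 <= F x)%R ->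
  \int[m1]_x (w1 x * F (Y1 x))%:E <= \int[m2]_x (w2 x * F (Y2 x))%:E.
Proof.
move=> mF F0.
have mEF : measurable_fun setT (EFin \o F) by apply/measurable_EFinP.
pose f := nnsfun_approx measurableT mEF.
have mf n : measurable_fun setT (f n) by [].
have fle n x : (f n x <= F x)%R.
  have h : (f k x)%:E @[k --> \oo] --> (F x)%:E.
    by apply: (cvg_nnsfun_approx measurableT mEF) => // y _; rewrite /= lee_fin.
  rewrite -lee_fin -(cvg_lim _ h)//; apply: lime_ge; first by apply/cvg_ex; exists (F x)%:E.
  by exists n => // m /= nm; rewrite lee_fin; exact/lefP/nd_nnsfun_approx.
have -> : \int[m1]_x (w1 x * F (Y1 x))%:E =
    limn (fun n => \int[m1]_x (w1 x * f n (Y1 x))%:E).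
  rewrite -monotone_convergence//.
  - apply: eq_integral => x _; apply/esym/cvg_lim => //.
    under eq_fun do rewrite EFinM.
    rewrite EFinM; apply: cvgeZl => //.
    by apply: cvg_nnsfun_approx => // y _; rewrite /= lee_fin.
  - move=> n; apply/measurable_EFinP; apply: measurable_funM => //.
    exact: measurableT_comp.
  - by move=> n x _; rewrite lee_fin mulr_ge0.
  - move=> x _ a b ab; rewrite lee_fin ler_wpM2l//.
    exact/lefP/nd_nnsfun_approx.
apply: lime_le.
  apply: ereal_nondecreasing_is_cvgn => a b ab.
  apply: ge0_le_integral => //.
  - by move=> x _; rewrite lee_fin mulr_ge0.
  - by apply/measurable_EFinP; apply: measurable_funM => //; exact: measurableT_comp.
  - by apply/measurable_EFinP; apply: measurable_funM => //; exact: measurableT_comp.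
  - by move=> x _; rewrite lee_fin ler_wpM2l//; exact/lefP/nd_nnsfun_approx.
apply: nearW => n.
apply: (@le_trans _ _ (\int[m2]_x (w2 x * f n (Y2 x))%:E)).
  rewrite !sfun_integral//; apply: lee_fsum => // r [y _ <-].
  by apply: lee_wpmul2l; [rewrite lee_fin|exact: le_sets].
apply: ge0_le_integral => //.
- by move=> x _; rewrite lee_fin mulr_ge0.
- by apply/measurable_EFinP; apply: measurable_funM => //; exact: measurableT_comp.
- by apply/measurable_EFinP; apply: measurable_funM => //; exact: measurableT_comp.
- by move=> x _; rewrite lee_fin ler_wpM2l.
Qed.

End weighted_laws.

(** * Approximation of sets by Lipschitz functions *)

Section lipschitz_functions.
Context {R : realType} {n : nat}.
Implicit Types f g : 'cV[R]_n -> R.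

(** Measurability is a separate clause because the sigma-algebra is generated by the entries rather
    than by open sets. The Lipschitz constant is arbitrary: it disappears when s tends to 0. *)
Definition lip01 f := [/\ measurable_fun setT f, forall x, 0 <= f x <= 1 &
  exists2 K, 0 <= K & forall x y, `|f x - f y| <= K * Num.sqrt (sqn (x - y))].

Lemma norm_max_sub (a b c e : R) :
  `|Num.max a b - Num.max c e| <= `|a - c| + `|b - e|.
Proof.
have := normr_ge0 (a - c); have := normr_ge0 (b - e).
have := ler_norm (a - c); have := ler_norm (b - e).
have := ler_norm (c - a); have := ler_norm (e - b).
rewrite (distrC c) (distrC e) ler_norml.
by case: (leP a b) => ?; case: (leP c e) => ?; lra.
Qed.

Lemma norm_min_sub (a b c e : R) :
  `|Num.min a b - Num.min c e| <= `|a - c| + `|b - e|.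
Proof.
have := normr_ge0 (a - c); have := normr_ge0 (b - e).
have := ler_norm (a - c); have := ler_norm (b - e).
have := ler_norm (c - a); have := ler_norm (e - b).
rewrite (distrC c) (distrC e) ler_norml.
by case: (leP a b) => ?; case: (leP c e) => ?; lra.
Qed.

Lemma lip01_compl f : lip01 f -> lip01 (fun x => 1 - f x).
Proof.
move=> [mf f01 [K K0 hK]]; split.
- exact: measurable_funB.
- by move=> x; have := f01 x; lra.
- exists K => // x y; have -> : 1 - f x - (1 - f y) = f y - f x by ring.
  by rewrite distrC.
Qed.

Lemma lip01_max f g : lip01 f -> lip01 g -> lip01 (fun x => Num.max (f x) (g x)).
Proof.
move=> [mf f01 [K K0 hK]] [mg g01 [L L0 hL]]; split.
- exact: measurable_maxr.
- by move=> x; have := f01 x; have := g01 x; case: (leP (f x) (g x)) => _; lra.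
- exists (K + L); first exact: addr_ge0.
  move=> x y; apply: le_trans (norm_max_sub _ _ _ _) _.
  by rewrite mulrDl lerD.
Qed.

Lemma lip01_cst (a : R) : 0 <= a <= 1 -> lip01 (fun=> a).
Proof.
by move=> a01; split => //; exists 0 => // x y; rewrite subrr normr0 mul0r.
Qed.

Lemma entry_le_sqrt_sqn (x : 'cV[R]_n) i : `|x i 0| <= Num.sqrt (sqn x).
Proof.
rewrite -sqrtr_sqr ler_wsqrtr// /sqn (bigD1 i)//= lerDl sumr_ge0// => j _.
exact: sqr_ge0.
Qed.

(** Ramps that increase with k to the indicator of the half-space x_l > a. *)
Lemma lip01_ray (l : 'I_n) (a : R) (k : nat) :
  lip01 (fun x => Num.min 1 (Num.max 0 (k%:R * (x l 0 - a)))).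
Proof.
split.
- apply: measurable_minr => //; apply: measurable_maxr => //.
  apply: measurable_funM => //; apply: measurable_funB => //.
  exact: measurable_mx_entry.
- move=> x; set y := k%:R * _.
  by case: (leP 0 y) => ?; [case: (leP 1 y) => ?|case: (leP 1 0) => ?]; lra.
- exists k%:R => // x y.
  apply: le_trans (norm_min_sub _ _ _ _) _; rewrite subrr normr0 add0r.
  apply: le_trans (norm_max_sub _ _ _ _) _; rewrite subrr normr0 add0r.
  rewrite -mulrBr normrM ger0_norm//; apply: ler_wpM2l => //.
  have -> : x l 0 - a - (y l 0 - a) = (x - y) l 0 by rewrite !mxE; ring.
  exact: entry_le_sqrt_sqn.
Qed.

End lipschitz_functions.

Section lipschitz_density.
Context {R : realType} {n : nat} {d : measure_display} {O : measurableType d}.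
Variables (P : probability O R) (X Y : O -> 'cV[R]_n).
Hypotheses (mX : measurable_fun setT X) (mY : measurable_fun setT Y).
Local Open Scope ereal_scope.

Let dist (f g : 'cV[R]_n -> R) : O -> R :=
  fun w => (`|f (X w) - g (X w)| + `|f (Y w) - g (Y w)|)%R.

(** One function must approximate under both laws: the comparison replaces a set by it at [X] and
    restores the set at [Y]. *)
Let approx (f : 'cV[R]_n -> R) := forall e : R, (0 < e)%R ->
  exists2 g, lip01 g & \int[P]_w (dist f g w)%:E <= e%:E.

Let mdist f g : measurable_fun setT f -> measurable_fun setT g ->
  measurable_fun setT (fun w => (dist f g w)%:E).
Proof.
move=> mf mg; apply/measurable_EFinP; apply: measurable_funD;
  apply: measurableT_comp => //; apply: measurable_funB; exact: measurableT_comp.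
Qed.

Let dist_ge0 f g w : (0 <= dist f g w)%R.
Proof. by rewrite addr_ge0. Qed.

Let approx_limit (F : nat -> 'cV[R]_n -> R) (f : 'cV[R]_n -> R) :
  (forall k, measurable_fun setT (F k)) -> measurable_fun setT f ->
  (forall k x, 0 <= F k x <= 1)%R -> (forall x, 0 <= f x <= 1)%R ->
  (forall x, F ^~ x @ \oo --> f x) -> (forall k, approx (F k)) -> approx f.
Proof.
move=> mF mf F01 f01 Ff aF e e0.
have e20 : (0 < e / 2)%R by rewrite divr_gt0.
have [] := @dominated_convergence _ _ _ P setT measurableT
    (fun k w => (dist f (F k) w)%:E) (cst 0%E) (cst 2%:E) => //.
- by move=> k; exact: mdist.
- apply: aeW => w _; apply: cvg_EFin; first by near=> k.
  rewrite [X in _ --> X](_ : _ = (`|f (X w) - f (X w)| + `|f (Y w) - f (Y w)|)%R).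
    apply: cvgD; apply: cvg_norm; apply: cvgB; try exact: cvg_cst; exact: Ff.
  by rewrite !subrr normr0 addr0.
- exact: finite_measure_integrable_cst.
- apply: aeW => w k _ /=; rewrite lee_fin ger0_norm ?dist_ge0// /dist.
  have := f01 (X w); have := F01 k (X w); have := f01 (Y w); have := F01 k (Y w).
  move=> h1 h2 h3 h4.
  have : (`|f (X w) - F k (X w)| <= 1)%R by rewrite ler_norml; lra.
  have : (`|f (Y w) - F k (Y w)| <= 1)%R by rewrite ler_norml; lra.
  lra.
move=> _ _; rewrite integral0 => /fine_cvgP[hfin /cvgrPdist_lt /(_ _ e20) hlt].
have [k [kfin klt]] := filter_ex (filterI hfin hlt).
have {}kfin : \int[P]_w (dist f (F k) w)%:E <= (e / 2)%:E.
  move: kfin klt => /= kfin klt.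
  rewrite -(fineK kfin) lee_fin; apply: le_trans (ltW klt).
  by rewrite sub0r normrN ler_norm.
have [g lg hg] := aF k _ e20.
have [mg g01 _] := lg.
exists g => //.
apply: (@le_trans _ _ (\int[P]_w ((dist f (F k) w)%:E + (dist (F k) g w)%:E))).
  apply: ge0_le_integral => //.
  - by move=> w _; rewrite lee_fin.
  - exact: mdist.
  - by apply: emeasurable_funD; exact: mdist.
  - move=> w _; rewrite -EFinD lee_fin /dist.
    have h z : (`|f z - g z| <= `|f z - F k z| + `|F k z - g z|)%R.
      by rewrite -[(f z - g z)%R](subrKA (F k z)) ler_normD.
    by have := h (X w); have := h (Y w); lra.
rewrite ge0_integralD//; last 4 first.
- by move=> w _; rewrite lee_fin.
- exact: mdist.
- by move=> w _; rewrite lee_fin.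
- exact: mdist.
by rewrite (splitr e) EFinD leeD.
Unshelve. all: by end_near. Qed.

Let approx_compl f : measurable_fun setT f -> approx f -> approx (fun x => 1 - f x)%R.
Proof.
move=> mf af e e0; have [g lg hg] := af e e0; exists (fun x => 1 - g x)%R.
  exact: lip01_compl.
congr (_ <= _) : hg; apply: eq_integral => w _; congr EFin; rewrite /dist.
have E z : (1 - f z - (1 - g z) = g z - f z)%R by ring.
by rewrite !E distrC [X in (_ + X)%R]distrC.
Qed.

Let approx_max f g : measurable_fun setT f -> measurable_fun setT g ->
  approx f -> approx g -> approx (fun x => Num.max (f x) (g x)).
Proof.
move=> mf mg af ag e e0; have e20 : (0 < e / 2)%R by rewrite divr_gt0.
have [f' lf hf] := af _ e20; have [g' lg hg] := ag _ e20.
exists (fun x => Num.max (f' x) (g' x)); first exact: lip01_max.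
have [mf' _ _] := lf; have [mg' _ _] := lg.
apply: (@le_trans _ _ (\int[P]_w ((dist f f' w)%:E + (dist g g' w)%:E))).
  apply: ge0_le_integral => //.
  - by move=> w _; rewrite lee_fin.
  - by apply: mdist; exact: measurable_maxr.
  - by apply: emeasurable_funD; exact: mdist.
  - move=> w _; rewrite -EFinD lee_fin /dist.
    have := norm_max_sub (f (X w)) (g (X w)) (f' (X w)) (g' (X w)).
    have := norm_max_sub (f (Y w)) (g (Y w)) (f' (Y w)) (g' (Y w)).
    lra.
rewrite ge0_integralD//; last 4 first.
- by move=> w _; rewrite lee_fin.
- exact: mdist.
- by move=> w _; rewrite lee_fin.
- exact: mdist.
by rewrite (splitr e) EFinD leeD.
Qed.

Let approx_lip f : lip01 f -> approx f.
Proof.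
move=> lf e e0; exists f => //.
rewrite (_ : (fun w => _) = cst 0) ?integral0 ?lee_fin ?ltW//.
by apply/funext => w; rewrite /dist !subrr normr0 addr0.
Qed.

(** These sets form a sigma-algebra: complements come from 1 - f, finite unions from maxima,
    countable unions from dominated convergence. *)
Let good (A : set 'cV[R]_n) := measurable A /\ approx \1_A.

Let indic01 (A : set 'cV[R]_n) x : (0 <= (\1_A x : R) <= 1)%R.
Proof. by rewrite indicE; case: (_ \in _); rewrite /= ?lexx ?ler01. Qed.

Let good_compl A : good A -> good (~` A).
Proof.
move=> [mA aA]; split; first exact: measurableC.
have -> : (\1_(~` A) : _ -> R) = (fun x => 1 - \1_A x)%R.
  apply/funext => x; rewrite !indicE in_setC.
  by case: (x \in A); rewrite /= ?subrr ?subr0.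
by apply: approx_compl.
Qed.

Let goodU A B : good A -> good B -> good (A `|` B).
Proof.
move=> [mA aA] [mB aB]; split; first exact: measurableU.
have -> : (\1_(A `|` B) : _ -> R) = (fun x => Num.max (\1_A x) (\1_B x)).
  apply/funext => x; rewrite !indicE in_setU.
  by case: (x \in A); case: (x \in B); rewrite /= ?maxxx//;
    rewrite /Num.max /Order.max ?ltxx ?ltr01// ltNge ler01.
by apply: approx_max.
Qed.

Let good_bigcup (F : nat -> set 'cV[R]_n) : (forall k, good (F k)) -> good (\bigcup_k F k).
Proof.
move=> gF; split; first by apply: bigcup_measurable => k _; case: (gF k).
pose G k := \big[setU/set0]_(i < k) F i.
have gG k : good (G k).
  rewrite /G; elim: k => [|k IH].
    rewrite big_ord0; split => //.
    have -> : (\1_(set0 : set 'cV[R]_n) : _ -> R) = (fun=> 0%R).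
      by apply/funext => x; rewrite indic0.
    by apply/approx_lip/lip01_cst; rewrite lexx ler01.
  by rewrite big_ord_recr /=; exact: goodU.
apply: (approx_limit (F := fun k => \1_(G k))) => //.
- by move=> k; case: (gG k) => mG _; exact: measurable_indic.
- by apply: measurable_indic; apply: bigcup_measurable => k _; case: (gF k).
- move=> x; have [[k _ Fk]|nF] := pselect ((\bigcup_k F k) x).
    apply: cvg_near_cst; exists k.+1 => // j /= kj.
    rewrite !indicE !mem_set//; first by exists k.
    by rewrite /G -bigcup_mkord; exists k.
  rewrite (_ : (fun k => _) = cst (\1_(\bigcup_k F k) x)); first exact: cvg_cst.
  apply/funext => k /=; rewrite !indicE !memNset//.
  by rewrite /G -bigcup_mkord => -[j _ Fj]; apply: nF; exists j.
- by move=> k; case: (gG k).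
Qed.

(** Borel sets of the line are generated by the rays (a, +oo), whose indicators are limits of
    ramps. *)
Let good_coord (l : 'I_n) (B : set R) : measurable B ->
  good ((fun x : 'cV[R]_n => x l 0%R) @^-1` B).
Proof.
move=> mB.
have : (@RGenOInfty.G R).-sigma.-measurable B by rewrite -RGenOInfty.measurableE.
move: B {mB}; apply: smallest_sub => /=; first split.
- rewrite preimage_set0; split => //.
  have -> : (\1_(set0 : set 'cV[R]_n) : _ -> R) = (fun=> 0%R).
    by apply/funext => x; rewrite indic0.
  by apply/approx_lip/lip01_cst; rewrite lexx ler01.
- by move=> B gB; rewrite setTD preimage_setC; exact: good_compl.
- by move=> F gF; rewrite preimage_bigcup; exact: good_bigcup.
move=> _ [a ->]; split.
  rewrite -[X in measurable X]setTI; apply: measurable_mx_entry => //.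
apply: (approx_limit (F := fun k x => Num.min 1 (Num.max 0 (k%:R * (x l 0 - a))))%R) => //.
- by move=> k; case: (lip01_ray l a k).
- apply: measurable_indic; rewrite -[X in measurable X]setTI.
  exact: measurable_mx_entry.
- by move=> k x; case: (lip01_ray l a k).
- move=> x; rewrite indicE; have [ax|xa] := ltP a (x l 0%R).
    rewrite mem_set/=; last by rewrite in_itv /= ax.
    apply: cvg_near_cst.
    exists (Num.truncn (x l 0 - a)^-1%R).+1 => // k /= hk.
    have xa0 : (0 < x l 0 - a)%R by rewrite subr_gt0.
    have h1 : (1 <= k%:R * (x l 0 - a))%R.
      rewrite -ler_pdivrMr// mul1r; apply: le_trans (ltW (truncnS_gt _)) _.
      by rewrite ler_nat.
    by rewrite max_r ?(le_trans ler01)// min_l.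
  rewrite memNset/=; last by rewrite in_itv /= andbT; apply/negP; rewrite -leNgt.
  rewrite (_ : (fun k => _) = cst 0%R); first exact: cvg_cst.
  apply/funext => k /=; rewrite max_l ?min_r//.
  by rewrite mulr_ge0_le0// subr_le0.
- by move=> k; apply: approx_lip; exact: lip01_ray.
Qed.

Lemma lip01_dense (A : set 'cV[R]_n) (e : R) : measurable A -> (0 < e)%R ->
  exists2 g, lip01 g & \int[P]_w
    (`|\1_A (X w) - g (X w)| + `|\1_A (Y w) - g (Y w)|)%:E <= e%:E.
Proof.
move=> mA; suff [_ h] : good A by exact: h.
move: A mA; apply: smallest_sub => /=; first split.
- split => //.
  have -> : (\1_(set0 : set 'cV[R]_n) : _ -> R) = (fun=> 0%R).
    by apply/funext => x; rewrite indic0.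
  by apply/approx_lip/lip01_cst; rewrite lexx ler01.
- by move=> B gB; rewrite setTD; exact: good_compl.
- by move=> F gF; exact: good_bigcup.
move=> _ [[l j] _ [B mB <-]]; rewrite setTI /= (ord1 j); exact: good_coord.
Qed.

End lipschitz_density.

(** * From mollified bounds to inequalities between measures *)

Section mollification.
Context {R : realType} {n : nat} {d : measure_display} {O : measurableType d}.
Variables (P : probability O R) (X : O -> 'cV[R]_n) (w : O -> R).
Hypotheses (mX : measurable_fun setT X) (mw : measurable_fun setT w).
Hypothesis w01 : forall o, 0 <= w o <= 1.
Variables (h : 'cV[R]_n -> R) (M : R).
Hypotheses (mh : measurable_fun setT h) (h0 : forall y, 0 <= h y) (M0 : 0 <= M).
Local Open Scope ereal_scope.
Hypothesis moll : forall (s : R) (y : 'cV[R]_n), (0 < s <= 1)%R ->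
  \int[P]_o (w o * gaussk s%:M (X o - y))%:E <= (M * h y)%:E.

Lemma gausskC (S : 'M[R]_n) (x y : 'cV[R]_n) : gaussk S (x - y) = gaussk S (y - x).
Proof.
have -> : (x - y = -1 *: (y - x))%R by rewrite scaleN1r opprB.
by rewrite /gaussk /gauss_unnorm qformZl qformZr !mulN1r opprK.
Qed.

(** Compare f(x) with the mean of [f] under the kernel centred at x. The error is K times the mean
    displacement, of order sqrt s because sqrt r <= 1 + r for r = |u|^2 / s. *)
Lemma lip_gaussk_le (K s C : R) (f : 'cV[R]_n -> R) (x : 'cV[R]_n) :
  (0 <= K)%R -> (0 < s)%R -> (0 <= C)%R -> lip01 f ->
  (forall y z, `|f y - f z| <= K * Num.sqrt (sqn (y - z)))%R ->
  (forall u : 'cV[R]_n, (1 + sqn u / s) `^ 1 * gaussk s%:M u <= C * gaussk (2 * s)%:M u)%R ->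
  (f x)%:E <= \int[lebesgue_cV n]_y (f y * gaussk s%:M (y - x))%:E +
    (K * C * Num.sqrt s)%:E.
Proof.
move=> K0 s0 C0 [mf f01 _] hK hC.
have mg (t : R) : measurable_fun setT (fun y : 'cV[R]_n => gaussk t%:M (y - x)).
  by apply: measurable_fun_gaussk; exact: measurable_fun_addmx.
have g0 (t : R) y : (0 <= gaussk t%:M (y - x))%R by exact: gaussk_ge0.
have f0 y : (0 <= f y)%R by have /andP[] := f01 y.
have -> : (f x)%:E = \int[lebesgue_cV n]_y ((f x)%:E * (gaussk s%:M (y - x))%:E).
  rewrite ge0_integralZl ?lee_fin//.
  - by rewrite integral_gaussk_scalar// mule1.
  - by apply/measurable_EFinP; exact: mg.
  - by move=> y _; rewrite lee_fin.
have k0 : (0 <= K * C * Num.sqrt s)%R by rewrite !mulr_ge0 ?sqrtr_ge0.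
have -> : (K * C * Num.sqrt s)%:E = \int[lebesgue_cV n]_y
    ((K * C * Num.sqrt s)%:E * (gaussk (2 * s)%:M (y - x))%:E).
  rewrite ge0_integralZl ?lee_fin//.
  - by rewrite integral_gaussk_scalar ?mulr_gt0// mule1.
  - by apply/measurable_EFinP; exact: mg.
  - by move=> y _; rewrite lee_fin.
rewrite -ge0_integralD//; last 4 first.
- by move=> y _; rewrite lee_fin mulr_ge0.
- by apply/measurable_EFinP; apply: measurable_funM.
- by move=> y _; rewrite mule_ge0 ?lee_fin.
- by apply: measurable_funeM; apply/measurable_EFinP; exact: mg.
apply: ge0_le_integral => //.
- by move=> y _; rewrite mule_ge0 ?lee_fin.
- by apply: measurable_funeM; apply/measurable_EFinP; exact: mg.
- apply: emeasurable_funD; first by apply/measurable_EFinP; apply: measurable_funM.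
  by apply: measurable_funeM; apply/measurable_EFinP; exact: mg.
move=> y _; rewrite -!EFinM -EFinD lee_fin.
have h1 : (f x <= f y + K * Num.sqrt (sqn (y - x)))%R.
  by have := ler_norm (f x - f y)%R; have := hK y x; rewrite distrC; lra.
apply: le_trans (ler_wpM2r (g0 s y) h1) _; rewrite mulrDl lerD2l.
set u := (y - x)%R.
have st0 : (0 < Num.sqrt s)%R by rewrite sqrtr_gt0.
have h2 : (Num.sqrt (sqn u) <= Num.sqrt s * (1 + sqn u / s) `^ 1)%R.
  have us : (0 <= sqn u / s)%R by rewrite divr_ge0 ?sqn_ge0 ?ltW.
  rewrite powRr1 ?addr_ge0//.
  have -> : sqn u = (s * (sqn u / s))%R by rewrite mulrC divfK ?gt_eqF.
  rewrite sqrtrM ?(ltW s0)// ler_wpM2l ?(ltW st0)//.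
  rewrite [(s * _)%R]mulrC mulfK ?gt_eqF//.
  rewrite -powR12_sqrt//; apply: powR_le1D => //; lra.
have := ler_wpM2l (ltW st0) (hC u).
have := ler_wpM2r (gaussk_ge0 s%:M u) h2.
move: (gaussk s%:M u) (gaussk (2 * s)%:M u) => a b h3 h4.
have -> : (K * C * Num.sqrt s * b = K * (Num.sqrt s * (C * b)))%R by ring.
by rewrite -mulrA ler_wpM2l//; apply: le_trans h3 _; rewrite -mulrA.
Qed.

(** Smoothing [f] puts the kernel on X; by Tonelli, [moll] then applies for each y, and the
    smoothing error vanishes with s. *)
Lemma integral_lip_le (f : 'cV[R]_n -> R) : lip01 f ->
  \int[P]_o (w o * f (X o))%:E <= M%:E * \int[lebesgue_cV n]_y (f y * h y)%:E.
Proof.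
move=> lf; have [mf f01 [K K0 hK]] := lf.
have f0 y : (0 <= f y)%R by have /andP[] := f01 y.
have w0 o : (0 <= w o)%R by have /andP[] := w01 o.
have [C C0 hC] := @sqnpow_gaussk_le R n 1 ler01.
have mg (s : R) : measurable_fun setT
    (fun p : O * 'cV[R]_n => gaussk s%:M (p.2 - X p.1)).
  apply: measurable_fun_gaussk; apply: measurable_fun_addmx => //.
  have -> : (fun p : O * 'cV[R]_n => - X p.1)%R = (fun p => (-1) *: X p.1)%R.
    by apply/funext => p; rewrite scaleN1r.
  apply: measurable_fun_scalemx; exact: measurableT_comp.
have mF (s : R) : measurable_fun setT
    (fun p : O * 'cV[R]_n => (w p.1 * (f p.2 * gaussk s%:M (p.2 - X p.1)))%:E).
  apply/measurable_EFinP; apply: measurable_funM; first exact: measurableT_comp.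
  apply: measurable_funM => //; exact: measurableT_comp.
have F0 (s : R) (p : O * 'cV[R]_n) :
    0 <= (w p.1 * (f p.2 * gaussk s%:M (p.2 - X p.1)))%:E.
  by rewrite lee_fin mulr_ge0// mulr_ge0// gaussk_ge0.
have step (s : R) : (0 < s <= 1)%R -> \int[P]_o (w o * f (X o))%:E <=
    M%:E * \int[lebesgue_cV n]_y (f y * h y)%:E + (K * C * Num.sqrt s)%:E.
  move=> s01; have /andP[s0 s1] := s01.
  have k0 : (0 <= K * C * Num.sqrt s)%R by rewrite !mulr_ge0 ?sqrtr_ge0 ?(ltW C0).
  pose G o := \int[lebesgue_cV n]_y (w o * (f y * gaussk s%:M (y - X o)))%:E.
  have mG : measurable_fun setT G.
    exact: (measurable_fun_fubini_tonelli_F (m2 := sf_lebesgue_cV n) _ (mF s) (F0 s)).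
  have G0 o : 0 <= G o by apply: integral_ge0 => y _; exact: (F0 s (o, y)).
  apply: (@le_trans _ _ (\int[P]_o (G o + (K * C * Num.sqrt s)%:E))).
    apply: ge0_le_integral => //.
    - by move=> o _; rewrite lee_fin mulr_ge0.
    - by apply/measurable_EFinP; apply: measurable_funM => //; exact: measurableT_comp.
    - exact: emeasurable_funD.
    move=> o _; rewrite EFinM.
    have := @lip_gaussk_le K s C f (X o) K0 s0 (ltW C0) lf hK (fun u => hC s u s0).
    move=> /(lee_wpmul2l _)-/(_ (w o)%:E); rewrite lee_fin => /(_ (w0 o)) /le_trans; apply.
    rewrite ge0_muleDr ?lee_fin//; last first.
      by apply: integral_ge0 => y _; rewrite lee_fin mulr_ge0 ?gaussk_ge0.
    apply: leeD.
      rewrite /G -ge0_integralZl ?lee_fin//.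
        apply/measurable_EFinP; apply: measurable_funM => //.
        by apply: measurable_fun_gaussk; exact: measurable_fun_addmx.
      by move=> y _; rewrite lee_fin mulr_ge0 ?gaussk_ge0.
    by rewrite -EFinM lee_fin ler_piMl//; have /andP[] := w01 o.
  rewrite ge0_integralD//.
  rewrite integral_cst//= [P setT]probability_setT mule1; apply: leeD => //.
  have -> : \int[P]_o G o = \int[lebesgue_cV n]_y \int[P]_o
      (w o * (f y * gaussk s%:M (y - X o)))%:E.
    exact: (@fubini_tonelli _ _ _ _ _ P (sf_lebesgue_cV n) _ (mF s) (F0 s)).
  rewrite -ge0_integralZl ?lee_fin//; last 2 first.
  - by apply/measurable_EFinP; apply: measurable_funM.
  - by move=> y _; rewrite lee_fin mulr_ge0.
  apply: ge0_le_integral => //.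
  - by move=> y _; apply: integral_ge0 => o _; exact: (F0 s (o, y)).
  - exact: (measurable_fun_fubini_tonelli_G (m1 := P) _ (mF s) (F0 s)).
  - by apply: measurable_funeM; apply/measurable_EFinP; apply: measurable_funM.
  move=> y _.
  have := moll y s01 => /(lee_wpmul2l _)-/(_ (f y)%:E); rewrite lee_fin => /(_ (f0 y)).
  rewrite -EFinM mulrCA EFinM; apply: le_trans.
  rewrite [leLHS](_ : _ = \int[P]_o ((f y)%:E * (w o * gaussk s%:M (X o - y))%:E)).
    rewrite ge0_integralZl ?lee_fin//.
    - apply/measurable_EFinP; apply: measurable_funM => //.
      by apply: measurable_fun_gaussk; exact: measurable_fun_addmx.
    - by move=> o _; rewrite lee_fin mulr_ge0 ?gaussk_ge0.
  by apply: eq_integral => o _; rewrite -EFinM mulrCA gausskC.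
apply/lee_addgt0Pr => e e0.
(* With s <= r^2 the error K C sqrt s is at most e; the 1 covers K = 0, and the minimum with 1 keeps
   [s] in the range of [moll]. *)
pose r := (e / (K * C + 1))%R.
have kc : (0 < K * C + 1)%R by rewrite ltr_wpDl// mulr_ge0// ltW.
have r0 : (0 < r)%R by rewrite divr_gt0.
pose s := Num.min 1%R (r ^+ 2)%R.
have s01 : (0 < s <= 1)%R by rewrite /s lt_min ltr01 exprn_gt0//= ge_min lexx.
apply: le_trans (step s s01) _; apply: leeD => //; rewrite lee_fin.
have : (Num.sqrt s <= r)%R.
  by rewrite -[leRHS](ger0_norm (ltW r0)) -sqrtr_sqr ler_wsqrtr// /s ge_min lexx orbT.
move=> /(ler_wpM2l (ltW kc)); rewrite /r [X in (_ <= X)%R]mulrC divfK ?gt_eqF// mulrDl mul1r.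
by have := sqrtr_ge0 s; lra.
Qed.

Section comparison.
Variables (Y : O -> 'cV[R]_n) (w' : O -> R).
Hypotheses (mY : measurable_fun setT Y) (mw' : measurable_fun setT w').
Hypothesis w'01 : forall o, (0 <= w' o <= 1)%R.
Hypothesis hY : forall f : 'cV[R]_n -> R, measurable_fun setT f -> (forall x, 0 <= f x)%R ->
  \int[P]_o (w' o * f (Y o))%:E = \int[lebesgue_cV n]_y (f y * h y)%:E.

Lemma integral_comparison (F : 'cV[R]_n -> R) :
  measurable_fun setT F -> (forall x, 0 <= F x)%R ->
  \int[P]_o (w o * F (X o))%:E <= M%:E * \int[P]_o (w' o * F (Y o))%:E.
Proof.
move=> mF F0.
have w0 o : (0 <= w o)%R by have /andP[] := w01 o.
have w'0 o : (0 <= w' o)%R by have /andP[] := w'01 o.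
have mI (A : set 'cV[R]_n) (V : O -> R) (Z : O -> 'cV[R]_n) : measurable A ->
    measurable_fun setT V -> measurable_fun setT Z ->
    measurable_fun setT (fun o => (V o * \1_A (Z o))%:E).
  move=> mA mV mZ; apply/measurable_EFinP; apply: measurable_funM => //.
  exact: (measurableT_comp (measurable_indic _)).
have key (A : set 'cV[R]_n) : measurable A ->
    \int[P]_o (w o * \1_A (X o))%:E <= \int[P]_o ((M * w' o) * \1_A (Y o))%:E.
  move=> mA; apply/lee_addgt0Pr => e e0.
  have M1 : (0 < M + 1)%R by rewrite ltr_wpDl.
  (* This error is paid once at [X] and M times at [Y], in total e. *)
  have e10 : (0 < e / (M + 1))%R by rewrite divr_gt0.
  have [f lf hf] := lip01_dense P mX mY mA e10.
  have [mf f01 _] := lf.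
  have f0 y : (0 <= f y)%R by have /andP[] := f01 y.
  pose D o := (`|\1_A (X o) - f (X o)| + `|\1_A (Y o) - f (Y o)|)%R.
  have mD : measurable_fun setT (fun o => (D o)%:E).
    apply/measurable_EFinP; apply: measurable_funD; apply: measurableT_comp => //;
      apply: measurable_funB; try exact: measurableT_comp;
      exact: (measurableT_comp (measurable_indic _)).
  have D0 o : (0 <= D o)%R by rewrite addr_ge0.
  have bnd (V : O -> R) (Z : O -> 'cV[R]_n) (a b : 'cV[R]_n -> R) :
      measurable_fun setT V -> measurable_fun setT Z ->
      (forall o, 0 <= V o <= 1)%R ->
      measurable_fun setT a -> measurable_fun setT b ->
      (forall x, 0 <= a x)%R -> (forall x, 0 <= b x)%R ->
      (forall o, `|a (Z o) - b (Z o)| <= D o)%R ->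
      \int[P]_o (V o * a (Z o))%:E <= \int[P]_o (V o * b (Z o))%:E + (e / (M + 1))%:E.
    move=> mV mZ V01 ma mb a0 b0 ab.
    have V0 o : (0 <= V o)%R by have /andP[] := V01 o.
    apply: (@le_trans _ _ (\int[P]_o ((V o * b (Z o))%:E + (D o)%:E))).
      apply: ge0_le_integral => //.
      - by move=> o _; rewrite lee_fin mulr_ge0.
      - by apply/measurable_EFinP; apply: measurable_funM => //; exact: measurableT_comp.
      - apply: emeasurable_funD => //; apply/measurable_EFinP.
        by apply: measurable_funM => //; exact: measurableT_comp.
      move=> o _; rewrite -EFinD lee_fin.
      have h1 : (a (Z o) - b (Z o) <= D o)%R by apply: le_trans (ab o); exact: ler_norm.
      have /andP[_ V1] := V01 o.
      have h2 : (V o * (a (Z o) - b (Z o)) <= V o * D o)%R by rewrite ler_wpM2l.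
      have h3 : (V o * D o <= D o)%R by rewrite ler_piMl.
      by move: h2; rewrite mulrBr; lra.
    rewrite ge0_integralD//; last 3 first.
    - by move=> o _; rewrite lee_fin mulr_ge0.
    - by apply/measurable_EFinP; apply: measurable_funM => //; exact: measurableT_comp.
    - by move=> o _; rewrite lee_fin.
    exact: leeD.
  have I0 (x : 'cV[R]_n) : (0 <= (\1_A x : R))%R by rewrite indicE.
  have mA1 : measurable_fun setT (\1_A : 'cV[R]_n -> R) by exact: measurable_indic.
  apply: le_trans (bnd w X \1_A f mw mX w01 mA1 mf I0 f0 _) _.
    by move=> o; rewrite /D lerDl.
  have h1 := integral_lip_le lf; rewrite -hY// in h1.
  have h2 := bnd w' Y f \1_A mw' mY w'01 mf mA1 f0 I0 _.
  have {}h2 : \int[P]_o (w' o * f (Y o))%:E <=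
      \int[P]_o (w' o * \1_A (Y o))%:E + (e / (M + 1))%:E.
    by apply: h2 => o; rewrite distrC /D lerDr.
  apply: (@le_trans _ _ (M%:E * (\int[P]_o (w' o * \1_A (Y o))%:E + (e / (M + 1))%:E) +
      (e / (M + 1))%:E)).
    apply: leeD => //; apply: le_trans h1 _; apply: lee_wpmul2l => //.
  rewrite ge0_muleDr//; last 2 first.
  - by apply: integral_ge0 => o _; rewrite lee_fin mulr_ge0.
  - by rewrite lee_fin ltW.
  rewrite -addeA; apply: leeD.
    rewrite -ge0_integralZl ?lee_fin//; last 2 first.
    - exact: mI.
    - by move=> o _; rewrite lee_fin mulr_ge0.
    rewrite le_eqVlt; apply/orP; left; apply/eqP; apply: eq_integral => o _.
    by rewrite -EFinM mulrA.
  rewrite -EFinM -EFinD lee_fin le_eqVlt; apply/orP; left; apply/eqP; field.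
  by rewrite gt_eqF.
have := @le_integral_sets R _ _ _ _ O O P P X Y w (fun o => M * w' o)%R mX mY mw
  (measurable_funM (measurable_cst _) mw') w0 (fun o => mulr_ge0 M0 (w'0 o)) key F mF F0.
move=> /le_trans; apply.
rewrite -ge0_integralZl ?lee_fin//; last 2 first.
- by apply/measurable_EFinP; apply: measurable_funM => //; exact: measurableT_comp.
- by move=> o _; rewrite lee_fin mulr_ge0.
rewrite le_eqVlt; apply/orP; left; apply/eqP; apply: eq_integral => o _.
by rewrite -EFinM mulrA.
Qed.

End comparison.
End mollification.

(** * Independence along the Euler scheme *)

Section independence.
Context {R : realType} {d : measure_display} {O : measurableType d}.
Variable P : probability O R.
Local Open Scope ereal_scope.

(** Dynkin's theorem: the events independent of a fixed C form a lambda-system that contains the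
    pi-system [G]. *)
Lemma independent_salg_generated (G H : set (set O)) :
  setI_closed G -> G setT -> G `<=` measurable -> H `<=` measurable ->
  independent_salg P G H -> independent_salg P <<s G>> H.
Proof.
move=> GI GT Gm Hm GH A C GA HC; have mC := Hm _ HC.
have fC := fin_num_measure P C mC.
pose Q (A : set O) := measurable A /\ P (A `&` C) = P A * P C.
have QC (B : set O) : Q B -> Q (~` B).
  clear A GA; move: B => A.
  move=> [mA AC]; split; first exact: measurableC.
  have fA := fin_num_measure P A mA.
  have -> : ~` A `&` C = C `\` A by rewrite setIC setDE.
  have -> : P (C `\` A) = P C - P (C `&` A) by apply: measureD => //; rewrite ltey_eq fC.
  have -> : P (C `&` A) = P A * P C by rewrite setIC.
  rewrite probability_setC//.
  rewrite -(fineK fA) -(fineK fC) -EFinM -!EFinB -EFinM; congr EFin; ring.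
have QU (F : nat -> set O) : trivIset setT F -> (forall k, Q (F k)) -> Q (\bigcup_k F k).
  move=> tF hF; have mF k : measurable (F k) by case: (hF k).
  split; first exact: bigcup_measurable.
  rewrite setI_bigcupl !measure_bigcup//; last 2 first.
  - by move=> k _; exact: measurableI.
  - by move=> k l _ _ [x [[Fk _] [Fl _]]]; apply: (tF k l) => //; exists x.
  rewrite [RHS]muleC -(fineK fC) -nneseriesZl//.
  by apply: eq_eseriesr => k _; rewrite (fineK fC) muleC; case: (hF k).
suff [] : Q A by [].
move: A GA; apply: (@dynkin_induction _ (g_sigma_algebraType G) G Q erefl GI).
- by split => //; exact: GH.
- by move=> A GA; split; [exact: Gm|exact: GH].
- by move=> A _; exact: QC.
- by move=> F _; exact: QU.
Qed.

Context {d1 : measure_display} {T1 : measurableType d1} {n : nat}.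
Variables (Z : O -> T1) (xi : O -> 'cV[R]_n) (g : 'cV[R]_n -> R).
Hypotheses (mZ : measurable_fun setT Z) (mxi : measurable_fun setT xi).
Hypotheses (mg : measurable_fun setT g) (g0 : forall x, (0 <= g x)%R).
Hypothesis xi_g : has_density P xi g.

(** Both inequalities are instances of [le_integral_sets], between the law of [xi] and Lebesgue
    measure weighted by [g]. *)
Lemma integral_has_density (f : 'cV[R]_n -> R) :
  measurable_fun setT f -> (forall x, 0 <= f x)%R ->
  \int[P]_w (f (xi w))%:E = \int[lebesgue_cV n]_x (f x * g x)%:E.
Proof.
move=> mf f0.
have E (A : set 'cV[R]_n) : measurable A ->
    \int[P]_w (1 * \1_A (xi w))%:E = \int[lebesgue_cV n]_x (g x * \1_A x)%:E.
  move=> mA; transitivity (P (xi @^-1` A)).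
    under eq_integral do rewrite mul1r.
    have mE : measurable (xi @^-1` A) by rewrite -[X in measurable X]setTI; exact: mxi.
    rewrite -[in RHS](setIT (xi @^-1` A)) -(integral_indic P measurableT mE).
    apply: eq_integral => w _; rewrite !indicE.
    suff -> : (w \in xi @^-1` A) = (xi w \in A) by [].
    by apply/idP/idP; rewrite !inE.
  rewrite xi_g// integral_mkcond; apply: eq_integral => x _.
  rewrite patchE indicE; case: ifP => _; first by rewrite mulr1.
  by rewrite mulr0.
have E1 (A : set 'cV[R]_n) : measurable A ->
    \int[P]_w (cst 1 w * \1_A (xi w))%:E <= \int[lebesgue_cV n]_x (g x * \1_A (id x))%:E.
  by move=> mA; rewrite E.
have E2 (A : set 'cV[R]_n) : measurable A ->
    \int[lebesgue_cV n]_x (g x * \1_A (id x))%:E <= \int[P]_w (cst 1 w * \1_A (xi w))%:E.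
  by move=> mA; rewrite E.
have leE := @le_integral_sets R _ _ _ _ _ _ P (lebesgue_cV n) xi id (cst 1%R) g
  mxi (@measurable_id _ _ _) (measurable_cst _) mg (fun=> ler01) g0
  E1 f mf f0.
have geE := @le_integral_sets R _ _ _ _ _ _ (lebesgue_cV n) P id xi g (cst 1%R)
  (@measurable_id _ _ _) mxi mg (measurable_cst _) g0 (fun=> ler01)
  E2 f mf f0.
transitivity (\int[P]_w (cst 1 w * f (xi w))%:E).
  by apply: eq_integral => w _; rewrite mul1r.
transitivity (\int[lebesgue_cV n]_x (g x * f (id x))%:E).
  by apply/eqP; rewrite eq_le leE geE.
by apply: eq_integral => x _; rewrite mulrC.
Qed.

Lemma finite_measure_sigma_finite d' (T : measurableType d')
    (m : {measure set T -> \bar R}) : m setT < +oo -> sigma_finite setT m.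
Proof.
by move=> moo; exists (fun=> setT) => [|k]; [rewrite bigcup_const//; exists 0%N|split].
Qed.

(** By uniqueness of product measures, the joint law of [Z] and [xi] is the product of their laws;
    Tonelli then integrates out [xi] through its density. *)
Lemma integral_independent (f : T1 * 'cV[R]_n -> R) :
  (forall A B, measurable A -> measurable B ->
    P (Z @^-1` A `&` xi @^-1` B) = P (Z @^-1` A) * P (xi @^-1` B)) ->
  measurable_fun setT f -> (forall x, 0 <= f x)%R ->
  \int[P]_w (f (Z w, xi w))%:E =
  \int[P]_w \int[lebesgue_cV n]_x (f (Z w, x) * g x)%:E.
Proof.
move=> ind mf f0.
have mZxi : measurable_fun setT (fun w => (Z w, xi w)) by exact: measurable_fun_pair.
pose mz : {measure set T1 -> \bar R} :=
  measure_function_pushforward__canonical__measure_function_Measure P mZ.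
pose mx : {measure set 'cV[R]_n -> \bar R} :=
  measure_function_pushforward__canonical__measure_function_Measure P mxi.
pose mzx : {measure set (T1 * 'cV[R]_n) -> \bar R} :=
  measure_function_pushforward__canonical__measure_function_Measure P mZxi.
have sfz : sigma_finite setT mz.
  by apply: finite_measure_sigma_finite; rewrite /= /pushforward preimage_setT probability_setT ltry.
have sfx : sigma_finite setT mx.
  by apply: finite_measure_sigma_finite; rewrite /= /pushforward preimage_setT probability_setT ltry.
have mEf : measurable_fun setT (EFin \o f) by apply/measurable_EFinP.
have f0E x : 0 <= (EFin \o f) x by rewrite lee_fin.
pose F z := \int[mx]_x (f (z, x))%:E.
have FE z : F z = \int[lebesgue_cV n]_x (f (z, x) * g x)%:E.
  rewrite /F [LHS]ge0_integral_pushforward//; last 2 first.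
  - by apply/measurable_EFinP; exact: (measurableT_comp mf (measurable_pair1 _)).
  - by move=> x _; rewrite lee_fin.
  rewrite preimage_setT; apply: (integral_has_density (f := fun x => f (z, x))) => //.
  exact: (measurableT_comp mf (measurable_pair1 _)).
have mF : measurable_fun setT F.
  exact: (measurable_fun_fubini_tonelli_F (m2 := sf_measure sfx) _ mEf f0E).
transitivity (\int[mzx]_p (f p)%:E).
  by rewrite [RHS]ge0_integral_pushforward ?preimage_setT// => p _; rewrite lee_fin.
transitivity (\int[sf_measure sfz \x sf_measure sfx]_p (f p)%:E).
  apply: eq_measure_integral => A mA _; apply/esym.
  apply: (@product_measure_unique _ _ _ _ _ (sf_measure sfz) (sf_measure sfx) mzx) => //.
rewrite (fubini_tonelli1 _ mEf f0E).
transitivity (\int[mz]_z F z) => //.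
rewrite [LHS]ge0_integral_pushforward//; last first.
  by move=> z _; apply: integral_ge0 => x _; rewrite lee_fin.
by rewrite preimage_setT; apply: eq_integral => w _; rewrite /= FE.
Qed.

End independence.

(** * The time grid *)

Section grid_lemmas.
Context {R : realType}.
Variables (T : R) (N : nat).
Hypotheses (T0 : 0 < T) (N0 : (1 <= N)%N).

Let Nr0 : 0 < N%:R :> R. Proof. by rewrite ltr0n. Qed.

Lemma step_gt0 : 0 < T / N%:R.
Proof. by rewrite divr_gt0. Qed.

Lemma grid_ge0 k : 0 <= grid T N k.
Proof. by rewrite mulr_ge0// ltW// step_gt0. Qed.

Lemma grid_le k l : (k <= l)%N -> grid T N k <= grid T N l.
Proof. by move=> kl; rewrite ler_wpM2r ?ler_nat// ltW// step_gt0. Qed.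

Lemma grid_lt k l : (k < l)%N -> grid T N k < grid T N l.
Proof. by move=> kl; rewrite ltr_pM2r ?ltr_nat// step_gt0. Qed.

Lemma grid_leT k : (k <= N)%N -> grid T N k <= T.
Proof.
move=> kN; apply: le_trans (grid_le kN) _.
by rewrite /grid mulrCA mulfV ?mulr1// gt_eqF.
Qed.

Lemma grid_in k : (k <= N)%N -> 0 <= grid T N k <= T.
Proof. by move=> kN; rewrite grid_ge0 grid_leT. Qed.

Lemma gridS_sub k : grid T N k.+1 - grid T N k = T / N%:R.
Proof. by rewrite /grid -natr1; ring. Qed.

Lemma step_leT : T / N%:R <= T.
Proof. by rewrite ler_pdivrMr// ler_peMr ?(ltW T0)// ler1n. Qed.

End grid_lemmas.

Lemma measurable_coef_at (R : realType) (d m n : nat) (T t : R)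
    (f : R -> 'cV[R]_d -> 'M[R]_(m, n)) :
  measurable_coef T f -> 0 <= t <= T -> measurable_fun setT (f t).
Proof.
move=> mf tT.
have mt : measurable_fun setT (fun x : 'cV[R]_d => (t, x)) by exact: measurable_fun_pair.
have mD : measurable (`[0, T] `*` [set: 'cV[R]_d]) by apply: measurableX.
apply: (measurable_comp mD _ mf mt) => _ [x _ <-].
by split => //=; rewrite in_itv.
Qed.

Section generated_by.
Context {R : realType} {d : measure_display} {O : measurableType d}.

Lemma sigma_gen_preimage (I : Type) (D : set I) n (X : I -> O -> 'cV[R]_n) i A :
  D i -> measurable A -> sigma_gen D X (X i @^-1` A).
Proof.
move=> Di mA; apply: sub_sigma_algebra; exists i => //.
by exists A => //; rewrite setTI.
Qed.

Lemma sigma_gen_measurable (I : Type) (D : set I) n (X : I -> O -> 'cV[R]_n) :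
  (forall i, D i -> measurable_fun setT (X i)) -> sigma_gen D X `<=` measurable.
Proof.
move=> mX; apply: smallest_sub; first exact: sigma_algebra_measurable.
by move=> _ [i Di [A mA <-]]; exact: mX.
Qed.

Lemma sigma_gen_sub (I : Type) (D E : set I) n (X : I -> O -> 'cV[R]_n) :
  D `<=` E -> sigma_gen D X `<=` sigma_gen E X.
Proof.
by move=> DE; apply: sub_sigma_algebra2; exact: bigcup_subset.
Qed.

End generated_by.

(** * Adaptedness of the scheme and independence of the next increment *)

Section euler_independence.
Context {R : realType} {d dW : nat} {dO : measure_display} {Omega : measurableType dO}.
Variables (P : probability Omega R) (T : R) (N i : nat).
Variables (b : R -> 'cV[R]_d -> 'cV[R]_d) (sigma : R -> 'cV[R]_d -> 'M[R]_(d, dW)).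
Variables (W : R -> Omega -> 'cV[R]_dW) (X : nat -> Omega -> 'cV[R]_d).
Hypotheses (T0 : 0 < T) (N0 : (1 <= N)%N).
Hypotheses (mb : measurable_coef T b) (ms : measurable_coef T sigma).
Hypotheses (BM : brownian_motion P T W) (mXi : measurable_fun setT (X i)).
Hypothesis (ind0 : indep_future_increments P T (grid T N i) W (X i)).
Hypothesis (eul : euler_scheme b sigma W T N i X).
Local Notation t := (grid T N).
Local Notation dWk k := (fun w => W (t k.+1) w - W (t k) w).

Let incr (su : R * R) w := W su.2 w - W su.1 w.
Let F (k : nat) := sigma_gen [set su : R * R | t i <= su.1 /\ su.1 <= su.2 <= t k] incr.
Let Fall := sigma_gen [set su : R * R | t i <= su.1 /\ su.1 <= su.2 <= T] incr.

(* A pi-system; the sigma-algebra it generates plays the role of the filtration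
   at time t_k. *)
Let G (k : nat) : set (set Omega) :=
  [set C | exists A B, [/\ measurable A, F k B & C = X i @^-1` A `&` B]].

Let mW u : 0 <= u <= T -> measurable_fun setT (W u).
Proof. by case: BM => + _ _ _ _; exact. Qed.

Let m_sub (d' : measure_display) (S : measurableType d') (f g : S -> 'cV[R]_dW) :
  measurable_fun setT f -> measurable_fun setT g -> measurable_fun setT (fun x => f x - g x).
Proof.
move=> mf mg; apply: measurable_fun_addmx => //.
have -> : (fun x => - g x) = (fun x => (-1) *: g x).
  by apply/funext => x; rewrite scaleN1r.
exact: measurable_fun_scalemx.
Qed.

Let mdW k : (k < N)%N -> measurable_fun setT (dWk k).
Proof. by move=> kN; apply: m_sub; apply: mW; apply: grid_in => //; exact: ltnW. Qed.

Let FallM : Fall `<=` measurable.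
Proof.
apply: sigma_gen_measurable => -[s u] /= [ts /andP[su uT]].
have := grid_ge0 T0 N0 i => ti.
by apply: m_sub; apply: mW; apply/andP; split => /=; lra.
Qed.

Let F_sub k : (k <= N)%N -> F k `<=` Fall.
Proof.
move=> kN; apply: sigma_gen_sub => -[s u] /= [ts /andP[su ut]]; split => //.
by rewrite su/=; apply: le_trans ut _; exact: grid_leT.
Qed.

(** The independence of Brownian increments is stated for the past of [W], while F k is generated by
    increments after t_i; this inclusion connects them. *)
Let F_W k : F k `<=` sigma_gen `[0, t k] W.
Proof.
apply: smallest_sub; first exact: smallest_sigma_algebra.
move=> _ [[s u] /= [ts /andP[su ut]] [A mA <-]].
pose S := g_sigma_algebraType
  (\bigcup_(r in `[0, t k]) preimage_set_system setT (W r) measurable).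
have mWS r : 0 <= r <= t k -> measurable_fun [set: S] (W r).
  by move=> rt _ B mB; rewrite setTI; apply: sigma_gen_preimage => //=; rewrite in_itv.
have ti := grid_ge0 T0 N0 i.
have : measurable_fun [set: S] (incr (s, u)).
  by apply: m_sub; apply: mWS; apply/andP; split => /=; lra.
by move=> /(_ measurableT A mA).
Qed.

Let GI k : setI_closed (G k).
Proof.
move=> _ _ [A [B [mA FB ->]]] [A' [B' [mA' FB' ->]]].
exists (A `&` A'), (B `&` B'); split; first exact: measurableI.
  have SA : sigma_algebra setT (F k) by exact: smallest_sigma_algebra.
  exact: (@measurableI _ (g_sigma_algebraType
    (\bigcup_(r in [set su : R * R | t i <= su.1 /\ su.1 <= su.2 <= t k])
     preimage_set_system setT (incr r) measurable))).
by rewrite preimage_setI setIACA.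
Qed.

Let FT k : F k setT.
Proof. by exact: (@measurableT _ (g_sigma_algebraType _)). Qed.

Let GT k : G k setT.
Proof. by exists setT, setT; split => //; rewrite preimage_setT setIT. Qed.

Let GM k : (k <= N)%N -> G k `<=` measurable.
Proof.
move=> kN _ [A [B [mA FB ->]]]; apply: measurableI.
  by rewrite -[X in measurable X]setTI; exact: mXi.
by apply: FallM; exact: F_sub FB.
Qed.

(** For events A of X_i, B of earlier increments and C of the next one, P(ABC) = P(A) P(BC) = P(A)
    P(B) P(C) = P(AB) P(C). The outer equalities use independence of X_i from all later increments,
    the middle one that of Brownian increments. *)
Let Gind k : (i <= k < N)%N ->
  independent_salg P <<s G k>> (sigma_gen [set: unit] (fun _ => dWk k)).
Proof.
move=> /andP[ik kN]; have k1N := ltnW kN.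
have tk0 := grid_ge0 T0 N0 k; have tkk : t k < t k.+1 by exact: grid_lt.
have tT : t k.+1 <= T by exact: grid_leT.
apply: independent_salg_generated.
- exact: GI.
- exact: GT.
- exact: GM.
- by apply: sigma_gen_measurable => _ _; exact: mdW.
move=> _ C [A [B [mA FB ->]]] HC.
have FaC : Fall C.
  apply: (@sub_sigma_algebra2 _ _ _ _ _ _ HC).
  move=> _ [_ _ [D mD <-]]; exists (t k, t k.+1) => /=.
    by split; [exact: grid_le|rewrite (ltW tkk) tT].
  by exists D.
have FaB := F_sub k1N FB.
have FaBC : Fall (B `&` C).
  exact: (@measurableI _ (g_sigma_algebraType
    (\bigcup_(r in [set su : R * R | t i <= su.1 /\ su.1 <= su.2 <= T])
     preimage_set_system setT (incr r) measurable))).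
have XA : sigma_gen [set: unit] (fun=> X i) (X i @^-1` A).
  exact: (@sigma_gen_preimage _ _ _ _ _ _ (fun=> X i) tt).
rewrite -setIA (ind0 XA FaBC) (ind0 XA FaB) -muleA; congr (_ * _)%E.
by case: BM => _ _ _ + _ => /(_ _ _ tk0 tkk tT) h; apply: h => //; exact: F_W.
Qed.

(** The scheme is adapted: each step is a measurable function of the present state and of one
    increment that ends by t_k. *)
Let XG k l : (i <= l <= k)%N -> (k <= N)%N ->
  measurable_fun [set: g_sigma_algebraType (G k)] (X l).
Proof.
move=> /andP[il]; elim: l il => [|l IH] il lk kN.
  move: il; rewrite leqn0 => /eqP i0.
  move=> _ A mA; rewrite setTI; apply: sub_sigma_algebra; exists A, setT.
  by split => //; rewrite setIT i0.
move: il; rewrite leq_eqVlt => /orP[/eqP <-|il].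
  move=> _ A mA; rewrite setTI; apply: sub_sigma_algebra; exists A, setT.
  by split => //; rewrite setIT.
have lN : (l < N)%N by exact: leq_trans lk kN.
have IHl := IH il (ltnW lk) kN.
have tl : 0 <= t l <= T by apply: grid_in => //; exact: ltnW.
have -> : X l.+1 = (fun w => X l w + (T / N%:R) *: b (t l) (X l w)
      + sigma (t l) (X l w) *m (W (t l.+1) w - W (t l) w)).
  by apply/funext => w; apply: eul; rewrite -ltnS il lN.
have mdWG : measurable_fun [set: g_sigma_algebraType (G k)] (dWk l).
  move=> _ A mA; rewrite setTI; apply: sub_sigma_algebra; exists setT, (dWk l @^-1` A).
  split => //; last by rewrite preimage_setT setTI.
  apply: (@sigma_gen_preimage _ _ _ _ _ _ incr (t l, t l.+1)) => //=.
  by split; [exact: grid_le|rewrite !grid_le].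
apply: measurable_fun_addmx.
  apply: measurable_fun_addmx => //; apply: measurable_fun_scalemx.
  by apply: (measurableT_comp _ IHl); exact: measurable_coef_at mb tl.
apply: measurable_fun_mulmx => //.
by apply: (measurableT_comp _ IHl); exact: measurable_coef_at ms tl.
Qed.

Lemma euler_measurable k : (i <= k <= N)%N -> measurable_fun setT (X k).
Proof.
move=> /andP[ik kN] _ A mA; rewrite setTI.
have : <<s G k>> (X k @^-1` A).
  by have := @XG k k; rewrite ik leqnn => /(_ isT kN measurableT A mA); rewrite setTI.
by apply: smallest_sub; [exact: sigma_algebra_measurable|exact: GM].
Qed.

Lemma increment_measurable k : (k < N)%N -> measurable_fun setT (dWk k).
Proof. exact: mdW. Qed.

Lemma increment_density k : (k < N)%N ->
  has_density P (dWk k) (gaussian_density (T / N%:R)).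
Proof.
move=> kN; rewrite -(gridS_sub T N k); case: BM => _ _ + _ _; apply.
- exact: grid_ge0.
- exact: grid_lt.
- exact: grid_leT.
Qed.

(** X_i is paired with X_k because the weight depends on the starting value. *)
Lemma euler_independent k A B : (i <= k < N)%N ->
  measurable A -> measurable B ->
  (P ((fun w => (X i w, X k w)) @^-1` A `&` dWk k @^-1` B) =
   P ((fun w => (X i w, X k w)) @^-1` A) * P (dWk k @^-1` B))%E.
Proof.
move=> ikN mA mB; have /andP[ik kN] := ikN; apply: (Gind ikN).
  have mXi' : measurable_fun [set: g_sigma_algebraType (G k)] (X i).
    by apply: XG; rewrite ?leqnn ?ik// ltnW.
  have mXk' : measurable_fun [set: g_sigma_algebraType (G k)] (X k).
    by apply: XG; rewrite ?leqnn ?ik// ltnW.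
  by have := measurable_fun_pair mXi' mXk' measurableT mA; rewrite setTI.
exact: (@sigma_gen_preimage _ _ _ _ _ _ (fun=> dWk k) tt).
Qed.

End euler_independence.

(** * Parametrix *)

Section coefficient_bounds.
Context {R : realType} {d dW : nat}.
Variables (T : R) (sigma : R -> 'cV[R]_d -> 'M[R]_(d, dW)).

Lemma enorm_ge0 m n (A : 'M[R]_(m, n)) : 0 <= enorm A.
Proof. exact: sqrtr_ge0. Qed.

Lemma entry_le_enorm m n (A : 'M[R]_(m, n)) i j : `|A i j| <= enorm A.
Proof.
rewrite -sqrtr_sqr ler_wsqrtr// (bigD1 i)//= (bigD1 j)//= -addrA lerDl.
by rewrite addr_ge0 ?sumr_ge0// => *; rewrite ?sumr_ge0// => *; exact: sqr_ge0.
Qed.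

Lemma enorm_powR (v : 'cV[R]_d) (eta : R) : enorm v `^ eta = sqn v `^ (eta / 2).
Proof.
have -> : enorm v = Num.sqrt (sqn v) by rewrite -enorm_sqn sqrtr_sqr ger0_norm ?enorm_ge0.
by rewrite -powR12_sqrt ?sqn_ge0// -powRrM mulrC.
Qed.

Lemma bounded_coef_entry m n (f : R -> 'cV[R]_d -> 'M[R]_(m, n)) :
  bounded_coef T f -> exists2 K, 0 <= K & forall t x i j, 0 <= t <= T -> `|f t x i j| <= K.
Proof.
move=> [K hK]; exists `|K|; first exact: normr_ge0.
move=> t x i j tT; apply: le_trans (entry_le_enorm _ _ _) _.
by apply: le_trans (hK t x tT) _; exact: ler_norm.
Qed.

Lemma bounded_coef_sqn (f : R -> 'cV[R]_d -> 'cV[R]_d) :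
  bounded_coef T f -> exists2 K, 0 <= K & forall t x, 0 <= t <= T -> sqn (f t x) <= K.
Proof.
move=> [K hK]; exists (K ^+ 2); first exact: sqr_ge0.
move=> t x tT; rewrite -enorm_sqn lerXn2r ?nnegrE ?enorm_ge0 ?hK//.
by apply: le_trans (hK t x tT); exact: enorm_ge0.
Qed.

Lemma holder_entry eta : holder_in_space T eta sigma ->
  exists2 H, 0 <= H & forall t x y i j, 0 <= t <= T ->
    `|(sigma t x - sigma t y) i j| <= H * sqn (x - y) `^ (eta / 2).
Proof.
move=> hs.
have [H H0 hH] : exists2 H, 0 <= H & forall t x y, 0 <= t <= T -> x <> y ->
    enorm (sigma t x - sigma t y) / enorm (x - y) `^ eta <= H.
  move: hs; rewrite /holder_in_space; set S := (X in ereal_sup X) => hs.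
  have le_S t x y : 0 <= t <= T -> x <> y ->
      ((enorm (sigma t x - sigma t y) / enorm (x - y) `^ eta)%:E <= ereal_sup S)%E.
    move=> tT xy; apply: (@le_trans _ _ (ereal_sup
      [set (enorm (sigma t p.1 - sigma t p.2) / enorm (p.1 - p.2) `^ eta)%:E
        | p in [set p : 'cV[R]_d * 'cV[R]_d | p.1 <> p.2]])).
      by apply: ereal_sup_ubound; exists (x, y).
    by apply: ereal_sup_ubound; exists t; rewrite //= in_itv.
  case: (ereal_sup S) hs le_S => [r _|//|_] le_S.
    exists `|r|; first exact: normr_ge0.
    move=> t x y tT xy; have := le_S t x y tT xy; rewrite lee_fin => /le_trans; apply.
    exact: ler_norm.
  (* A supremum of -oo contradicts the existence of two distinct points, so any bound serves. *)
  by exists 0 => // t x y tT xy; have := le_S t x y tT xy.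
exists H => // t x y i j tT; rewrite -enorm_powR.
have [->|/eqP xy] := eqVneq x y; first by rewrite !subrr mxE normr0 mulr_ge0 ?powR_ge0.
apply: le_trans (entry_le_enorm _ _ _) _.
have e0 : 0 < enorm (x - y).
  rewrite lt_neqAle enorm_ge0 andbT eq_sym; apply/eqP => e0; apply: xy.
  by apply/subr0_eq/sqn_eq0; rewrite -enorm_sqn e0 expr0n.
by rewrite -ler_pdivrMr ?powR_gt0//; exact: hH.
Qed.

Definition diffusion (t : R) (x : 'cV[R]_d) : 'M[R]_d := sigma t x *m (sigma t x)^T.

Lemma diffusion_sym t x : (diffusion t x)^T = diffusion t x.
Proof. by rewrite /diffusion trmx_mul trmxK. Qed.

Lemma elliptic_bound : uniformly_elliptic T sigma ->
  exists2 l, 0 < l & forall t x v, 0 <= t <= T -> l * sqn v <= qform (diffusion t x) v v.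
Proof.
rewrite /uniformly_elliptic; set S := (X in ereal_inf X) => S0.
have [l l0 lS] : exists2 l : R, 0 < l & (l%:E <= ereal_inf S)%E.
  case: (ereal_inf S) S0 => [r r0|_|//]; first by exists r.
  (* An infimum of +oo means that there is no unit vector, as for d = 0. *)
  by exists 1; rewrite ?leey.
exists l => // t x v tT.
have [v0|v0] := eqVneq (sqn v) 0.
  by rewrite (sqn_eq0 v0) /qform mulmx0 mxE -[in sqn _](scale0r v) sqnZ expr0n mul0r mulr0.
have vp : 0 < sqn v by rewrite lt_neqAle eq_sym v0 sqn_ge0.
pose z := (Num.sqrt (sqn v))^-1 *: v.
have sz : sqn z = 1 by rewrite sqnZ exprVn sqr_sqrtr ?sqn_ge0// mulVf.
have nz : enorm z = 1.
  by apply/eqP; rewrite -(eqrXn2 (n:=2))// ?enorm_ge0// enorm_sqn sz expr1n.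
have : (l%:E <= (qform (diffusion t x) z z)%:E)%E.
  apply: le_trans lS _; apply: (@le_trans _ _ (ereal_inf
    [set ((zeta^T *m (sigma t x *m (sigma t x)^T *m zeta)) 0 0)%R%:E
        | zeta in [set zeta : 'cV[R]_d | enorm zeta = 1%R]])).
    by apply: ereal_inf_lbound; exists (t, x) => //; split => //=; rewrite in_itv.
  by apply: ereal_inf_lbound; exists z => //; rewrite /qform /diffusion !mulmxA.
rewrite lee_fin /z qformZl qformZr mulrA -expr2 exprVn sqr_sqrtr ?sqn_ge0//.
by rewrite mulrC ler_pdivlMr.
Qed.

Lemma diffusion_upper : bounded_coef T sigma ->
  exists2 L, 0 <= L & forall t x v, 0 <= t <= T -> qform (diffusion t x) v v <= L * sqn v.
Proof.
move=> /bounded_coef_entry[K K0 hK].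
exists (dW%:R * K ^+ 2 * d%:R); first by rewrite !mulr_ge0 ?exprn_ge0.
move=> t x v tT; apply: le_trans (ler_norm _) _.
apply: le_trans (qform_entries_le (e := dW%:R * K ^+ 2) _ _ _) _; last first.
  by rewrite le_eqVlt; apply/orP; left; apply/eqP; field.
move=> i j; rewrite mxE; apply: le_trans (ler_norm_sum _ _ _) _.
apply: (@le_trans _ _ (\sum_(k < dW) K ^+ 2)).
  by apply: ler_sum => k _; rewrite normrM expr2 mxE; apply: ler_pM => //; exact: hK.
by rewrite sumr_const card_ord mulr_natl.
Qed.

Lemma diffusion_holder eta : bounded_coef T sigma -> holder_in_space T eta sigma ->
  exists2 H, 0 <= H & forall t x y i j, 0 <= t <= T ->
    `|(diffusion t x - diffusion t y) i j| <= H * sqn (x - y) `^ (eta / 2).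
Proof.
move=> /bounded_coef_entry[K K0 hK] /holder_entry[H H0 hH].
exists (dW%:R * (2 * K * H)); first by rewrite !mulr_ge0.
move=> t x y i j tT; set h := sqn _ `^ _.
have -> : (diffusion t x - diffusion t y) i j = \sum_(k < dW)
    ((sigma t x - sigma t y) i k * sigma t x j k +
     sigma t y i k * (sigma t x - sigma t y) j k).
  rewrite !mxE -sumrB; apply: eq_bigr => k _; rewrite !mxE; ring.
apply: le_trans (ler_norm_sum _ _ _) _.
apply: (@le_trans _ _ (\sum_(k < dW) 2 * K * H * h)); last first.
  by rewrite sumr_const card_ord -(mulr_natl (_ * h)) !mulrA.
apply: ler_sum => k _; apply: le_trans (ler_normD _ _) _; rewrite !normrM.
have h1 : `|(sigma t x - sigma t y) i k| * `|sigma t x j k| <= H * h * K.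
  by apply: ler_pM => //; [exact: hH|exact: hK].
have h2 : `|sigma t y i k| * `|(sigma t x - sigma t y) j k| <= K * (H * h).
  by apply: ler_pM => //; [exact: hK|exact: hH].
by apply: le_trans (lerD h1 h2) _; rewrite le_eqVlt; apply/orP; left; apply/eqP; ring.
Qed.

End coefficient_bounds.

(** * Domination by isotropic Gaussian kernels *)

Section gaussian_domination.
Context {R : realType} {n : nat}.
Implicit Types (S : 'M[R]_n) (v : 'cV[R]_n).

Lemma pdboundsD (l L l' L' : R) S S' : pdbounds l L S -> pdbounds l' L' S' ->
  pdbounds (l + l') (L + L') (S + S').
Proof.
move=> [sS hS] [sS' hS']; split; first by rewrite linearD /= sS sS'.
move=> v; rewrite qform_addm !mulrDl.
by have /andP[? ?] := hS v; have /andP[? ?] := hS' v; rewrite !lerD.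
Qed.

Lemma pdbounds_le (l L l' L' : R) S : l' <= l -> L <= L' ->
  pdbounds l L S -> pdbounds l' L' S.
Proof.
move=> ll LL [sS hS]; split => // v; have /andP[h1 h2] := hS v.
apply/andP; split.
  by apply: le_trans h1; rewrite ler_wpM2r// sqn_ge0.
by apply: le_trans h2 _; rewrite ler_wpM2r// sqn_ge0.
Qed.

(** At unit scale, [det_pdbounds_ge] bounds the normalization and [qform_inv_ge] the exponent. It
    makes the kernel isotropic at the end of the backward chain, before integration against nu. *)
Lemma gaussk_upper (l L : R) : 0 < l -> 0 < L ->
  exists2 C, 0 < C & forall (t : R) S v, 0 < t -> pdbounds (t * l) (t * L) S ->
    gaussk S v <= C * gaussk (L * t)%:M v.
Proof.
move=> l0 L0; pose c := (n`!%:R * (1 + l^-1) ^+ n)^-1 : R.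
have c0 : 0 < c.
  by rewrite invr_gt0 mulr_gt0 ?ltr0n ?fact_gt0// exprn_gt0// ltr_pwDl// invr_ge0 ltW.
have sc0 : 0 < Num.sqrt c by rewrite sqrtr_gt0.
have sL0 : 0 < Num.sqrt (L ^+ n) by rewrite sqrtr_gt0 exprn_gt0.
exists (Num.sqrt (L ^+ n) / Num.sqrt c); first by rewrite divr_gt0.
move=> t S v t0 hS.
pose M := t^-1 *: S.
have hM : pdbounds l L M.
  have : pdbounds (t^-1 * (t * l)) (t^-1 * (t * L)) M by apply: pdboundsZ; rewrite ?invr_gt0.
  by rewrite !mulKf ?gt_eqF.
have -> : S = t *: M by rewrite scalerA mulfV ?gt_eqF// scale1r.
rewrite gaussk_scale ?(pdbounds_unit l0 hM)//.
have p0 := pi_gt0 R.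
rewrite gaussk_scalarE ?mulr_gt0//.
have -> : (2 * pi * (L * t)) ^+ n = L ^+ n * (2 * pi * t) ^+ n.
  by rewrite -exprMn; congr (_ ^+ _); ring.
rewrite sqrtrM ?exprn_ge0 ?(ltW L0)//.
set k := Num.sqrt ((2 * pi * t) ^+ n).
have k0 : 0 < k by rewrite sqrtr_gt0 exprn_gt0// !mulr_gt0.
have -> : Num.sqrt (L ^+ n) / Num.sqrt c *
    (expR (- (sqn v / (2 * (L * t)))) / (Num.sqrt (L ^+ n) * k)) =
    expR (- (sqn v / (2 * (L * t)))) / Num.sqrt c / k.
  by field; rewrite !gt_eqF.
apply: ler_wpM2r; first by rewrite invr_ge0 ltW.
rewrite /gauss_unnorm; apply: ler_pM.
- exact: expR_ge0.
- by rewrite invr_ge0 sqrtr_ge0.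
- rewrite ler_expR lerN2.
  have := qform_inv_ge l0 hM ((Num.sqrt t)^-1 *: v) L0.
  rewrite sqnZ exprVn sqr_sqrtr ?(ltW t0)//.
  have -> : sqn v / (2 * (L * t)) = (t^-1 * sqn v / L) / 2 by field; rewrite !gt_eqF.
  lra.
- have h := det_pdbounds_ge l0 hM.
  rewrite lef_pV2 ?posrE// ?ler_wsqrtr//.
  by rewrite sqrtr_gt0; exact: lt_le_trans h.
Qed.

End gaussian_domination.

(** * One step of the scheme under a Gaussian kernel *)

Section euler_one_step.
Context {R : realType} {d dW : nat} {dO : measure_display} {Omega : measurableType dO}.
Variables (P : probability Omega R) (T : R) (N i : nat).
Variables (b : R -> 'cV[R]_d -> 'cV[R]_d) (sigma : R -> 'cV[R]_d -> 'M[R]_(d, dW)).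
Variables (W : R -> Omega -> 'cV[R]_dW) (X : nat -> Omega -> 'cV[R]_d).
Hypotheses (T0 : 0 < T) (N0 : (1 <= N)%N).
Hypotheses (mb : measurable_coef T b) (ms : measurable_coef T sigma).
Hypotheses (BM : brownian_motion P T W) (mXi : measurable_fun setT (X i)).
Hypothesis (ind0 : indep_future_increments P T (grid T N i) W (X i)).
Hypothesis (eul : euler_scheme b sigma W T N i X).
Variable (w : 'cV[R]_d -> R).
Hypotheses (mw : measurable_fun setT w) (w0 : forall x, 0 <= w x).
Local Notation t := (grid T N).
Local Notation D := (T / N%:R).
Local Open Scope ereal_scope.

(** Given X_i and X_k, the noise of the step is an independent Gaussian, and [gaussk_convolution]
    adds its covariance to [S]. Measurability of [g] is part of the conclusion because Tonelli
    provides it, although X_k enters the covariance. *)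
Lemma euler_one_step k (l L : R) (S : 'M[R]_d) (y : 'cV[R]_d) :
  (i <= k < N)%N -> (0 < l)%R -> pdbounds l L S ->
  let g o := (w (X i o) * gaussk (S + D *: diffusion sigma (t k) (X k o))
     ((X k o - y) + D *: b (t k) (X k o)))%R in
  measurable_fun setT g /\
  \int[P]_o (w (X i o) * gaussk S (X k.+1 o - y))%:E = \int[P]_o (g o)%:E.
Proof.
move=> ikN l0 hS g; have /andP[ik kN] := ikN.
have tk : (0 <= t k <= T)%R by apply: grid_in => //; exact: ltnW.
have mXk : measurable_fun setT (X k).
  by apply: (euler_measurable T0 N0 mb ms BM mXi eul); rewrite ik ltnW.
have mZ : measurable_fun setT (fun o => (X i o, X k o)) by exact: measurable_fun_pair.
have D0 := step_gt0 T0 N0.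
pose v (z : 'cV[R]_d) := ((z - y) + D *: b (t k) z)%R.
pose f (p : ('cV[R]_d * 'cV[R]_d) * 'cV[R]_dW) : R :=
  (w p.1.1 * gaussk S (v p.1.2 + sigma (t k) p.1.2 *m p.2))%R.
have m12 : measurable_fun setT (fun p : ('cV[R]_d * 'cV[R]_d) * 'cV[R]_dW => p.1.2).
  exact: (measurableT_comp measurable_snd measurable_fst).
have m11 : measurable_fun setT (fun p : ('cV[R]_d * 'cV[R]_d) * 'cV[R]_dW => p.1.1).
  exact: (measurableT_comp measurable_fst measurable_fst).
have mf : measurable_fun setT f.
  apply: measurable_funM; first exact: measurableT_comp.
  apply: measurable_fun_gaussk; apply: measurable_fun_addmx.
    apply: measurable_fun_addmx; first exact: measurable_fun_addmx.
    apply: measurable_fun_scalemx.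
    exact: (measurableT_comp (measurable_coef_at mb tk) m12).
  apply: measurable_fun_mulmx => //.
  exact: (measurableT_comp (measurable_coef_at ms tk) m12).
have f0 p : (0 <= f p)%R by rewrite mulr_ge0 ?gaussk_ge0.
pose G p := \int[lebesgue_cV dW]_x (f (p, x) * gaussian_density D x)%:E.
have GE p : G p = (w p.1 * gaussk (S + D *: diffusion sigma (t k) p.2) (v p.2))%:E.
  rewrite EFinM -(gaussk_convolution (sigma (t k) p.2) (v p.2) l0 hS D0).
  rewrite -ge0_integralZl ?lee_fin//; last 2 first.
  - apply/measurable_EFinP; apply: measurable_funM; last exact: measurable_fun_gaussian_density.
    apply: measurable_fun_gaussk; apply: measurable_fun_addmx => //.
    exact: measurable_fun_mulmx.
  - by move=> x _; rewrite lee_fin mulr_ge0 ?gaussk_ge0 ?gaussian_density_ge0.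
  by apply: eq_integral => x _; rewrite -EFinM mulrA.
have mfg : measurable_fun setT (fun p : ('cV[R]_d * 'cV[R]_d) * 'cV[R]_dW =>
    (f p * gaussian_density D p.2)%:E).
  apply/measurable_EFinP; apply: measurable_funM => //.
  by apply: measurable_fun_gaussian_density.
have mG : measurable_fun setT G.
  apply: (measurable_fun_fubini_tonelli_F (m2 := sf_lebesgue_cV dW) _ mfg) => p.
  by rewrite lee_fin mulr_ge0 ?gaussian_density_ge0.
split.
  apply/measurable_EFinP.
  have -> : (EFin \o g) = G \o (fun o => (X i o, X k o)) by apply/funext => o; rewrite /= GE.
  exact: measurableT_comp.
transitivity (\int[P]_o G (X i o, X k o)); last by apply: eq_integral => o _; rewrite GE.
rewrite -(integral_independent (Z := fun o => (X i o, X k o)) mZ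
  (increment_measurable T0 N0 BM kN) (measurable_fun_gaussian_density _ (@measurable_id _ _ _))
  (gaussian_density_ge0 _) (increment_density T0 N0 BM kN) _ mf f0); last first.
  move=> A B mA mB; exact: (euler_independent T0 N0 mb ms BM mXi ind0 eul).
apply: eq_integral => o _; rewrite /f /v /=; congr (EFin (_ * gaussk S _)%R).
by rewrite eul ?ikN// addrAC; congr (_ + _)%R; rewrite addrAC.
Qed.

End euler_one_step.

Lemma ge0_le_integral_affine (R : realType) (d : measure_display)
    (O : measurableType d) (m : {measure set O -> \bar R})
    (f g h : O -> \bar R) (c : R) :
  measurable_fun setT f -> measurable_fun setT g -> measurable_fun setT h ->
  (forall o, 0 <= f o)%E -> (forall o, 0 <= g o)%E -> (forall o, 0 <= h o)%E ->
  0 <= c -> (forall o, f o <= g o + c%:E * h o)%E ->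
  (\int[m]_o f o <= \int[m]_o g o + c%:E * \int[m]_o h o)%E.
Proof.
move=> mf mg mh f0 g0 h0 c0 fgh.
have mch : measurable_fun setT (fun o => c%:E * h o)%E by exact: measurable_funeM.
have ch0 o : (0 <= c%:E * h o)%E by rewrite mule_ge0 ?lee_fin.
have E : (\int[m]_o (c%:E * h o) = c%:E * \int[m]_o h o)%E.
  by rewrite ge0_integralZl ?lee_fin.
rewrite -E -ge0_integralD//; apply: ge0_le_integral => //.
exact: emeasurable_funD.
Qed.

(** * Frozen covariances and the Gronwall argument *)

Section parametrix.
Context {R : realType} {d dW : nat}.
Variables (T : R) (b : R -> 'cV[R]_d -> 'cV[R]_d) (sigma : R -> 'cV[R]_d -> 'M[R]_(d, dW)).
Hypotheses (T0 : 0 < T) (mb : measurable_coef T b) (ms : measurable_coef T sigma).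
Variables (l L K H eta C1 : R).
Hypotheses (l0 : 0 < l) (l1 : l <= 1) (L1 : 1 <= L) (eta01 : 0 < eta <= 1).
Hypothesis (C10 : 0 < C1).
Hypothesis ha : forall t x, 0 <= t <= T -> pdbounds l L (diffusion sigma t x).
Hypothesis hb : forall t x, 0 <= t <= T -> sqn (b t x) <= K.
Hypothesis hh : forall t x y i j, 0 <= t <= T ->
    `|(diffusion sigma t x - diffusion sigma t y) i j| <= H * sqn (x - y) `^ (eta / 2).
Hypothesis hC1 : forall (S a1 a2 : 'M[R]_d) (v w : 'cV[R]_d) (t D : R),
    0 < D -> D <= t -> D <= T ->
    pdbounds (t * l) (t * L) (S + D *: a1) ->
    pdbounds (t * l) (t * L) (S + D *: a2) ->
    (forall i j, `|(a1 - a2) i j| <= H * sqn v `^ (eta / 2)) -> sqn w <= K ->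
    gaussk (S + D *: a1) (v + D *: w) <= gaussk (S + D *: a2) v +
      C1 * D * (t `^ (eta / 2 - 1) + t `^ (- 2^-1)) * gaussk (4 * L * t)%:M v.
Let kappa := 1 + T `^ (2^-1 - eta / 2).

Section scheme.
Variables (N i : nat) (N0 : (1 <= N)%N).
Context {dO : measure_display} {Omega : measurableType dO} (P : probability Omega R).
Variables (W : R -> Omega -> 'cV[R]_dW) (X : nat -> Omega -> 'cV[R]_d).
Hypotheses (BM : brownian_motion P T W) (mXi : measurable_fun setT (X i)).
Hypothesis (ind0 : indep_future_increments P T (grid T N i) W (X i)).
Hypothesis (eul : euler_scheme b sigma W T N i X).
Local Notation t := (grid T N).
Local Notation D := (T / N%:R).
Local Open Scope ereal_scope.

(* Covariance of the scheme run from time t_(j - m) to t_j, started from a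
   centred Gaussian of covariance s and with diffusion coefficient frozen at y. *)
Definition frozen_cov (s : R) (y : 'cV[R]_d) (j m : nat) : 'M[R]_d :=
  s%:M + D *: \sum_(p < m) diffusion sigma (t (j - p.+1)) y.

Lemma frozen_covS s y j m :
  frozen_cov s y j m.+1 =
  (frozen_cov s y j m + D *: diffusion sigma (t (j - m.+1)) y)%R.
Proof. by rewrite /frozen_cov big_ord_recr /= scalerDr addrA. Qed.

(** The initial s I lies between s l and s L because l <= 1 <= L; each frozen step then adds D to
    the scale. *)
Lemma frozen_cov_pdbounds s y j m : (0 < s)%R -> (j <= N)%N ->
  pdbounds ((s + m%:R * D) * l) ((s + m%:R * D) * L) (frozen_cov s y j m).
Proof.
move=> s0 jN; elim: m => [|m IH].
  rewrite /frozen_cov big_ord0 scaler0 addr0 mul0r addr0.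
  apply: pdbounds_le (pdbounds_scalar _ s).
    by rewrite ler_piMr ?(ltW s0).
  by rewrite ler_peMr ?(ltW s0).
have -> : (s + m.+1%:R * D = (s + m%:R * D) + D)%R by rewrite -natr1; ring.
rewrite frozen_covS (mulrDl (s + _)%R) (mulrDl (s + _)%R).
apply: pdboundsD IH _; apply: pdboundsZ; first exact: step_gt0.
by apply: ha; apply: grid_in => //; exact: leq_trans (leq_subr _ _) jN.
Qed.

Let mX k : (i <= k <= N)%N -> measurable_fun setT (X k).
Proof. exact: (euler_measurable T0 N0 mb ms BM mXi eul). Qed.

Section scheme_step.
Variable (w : 'cV[R]_d -> R).
Hypotheses (mw : measurable_fun setT w) (w0 : forall x, (0 <= w x)%R).

Let mwg k (S : 'M[R]_d) (y : 'cV[R]_d) : (i <= k <= N)%N ->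
  measurable_fun setT (fun o => (w (X i o) * gaussk S (X k o - y))%:E).
Proof.
move=> ikN; apply/measurable_EFinP; apply: measurable_funM; first exact: measurableT_comp.
by apply: measurable_fun_gaussk; apply: measurable_fun_addmx => //; exact: mX.
Qed.

(** [hC1] replaces the diffusion at X_k by the one at y. The scale [tau] includes the step being
    added, hence D <= tau, and the singular power is taken at (m + 1) D, never at 0. *)
Lemma frozen_step_le s y j m : (0 < s)%R -> (j <= N)%N -> (i + m < j)%N ->
  \int[P]_o (w (X i o) * gaussk (frozen_cov s y j m) (X (j - m) o - y))%:E <=
  \int[P]_o (w (X i o) * gaussk (frozen_cov s y j m.+1) (X (j - m.+1) o - y))%:E +
  (C1 * kappa * (D * (m.+1%:R * D) `^ (eta / 2 - 1)))%:E *
  \int[P]_o (w (X i o) * gaussk (4 * L * (s + m.+1%:R * D))%:M (X (j - m.+1) o - y))%:E.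
Proof.
move=> s0 jN imj; set k := (j - m.+1)%N.
have D0 := step_gt0 T0 N0.
have mj : (m < j)%N := leq_ltn_trans (leq_addl i m) imj.
have jm : (j - m)%N = k.+1 by rewrite /k subnS prednK// subn_gt0.
have ik : (i <= k)%N by rewrite /k leq_subRL// addSn addnC.
have kN : (k < N)%N by apply: leq_trans jN; rewrite -jm leq_subr.
have tk : (0 <= t k <= T)%R by apply: grid_in => //; exact: ltnW.
have ikN : (i <= k <= N)%N by rewrite ik ltnW.
pose tau := (s + m.+1%:R * D)%R.
have mD0 : (0 < m.+1%:R * D)%R by rewrite mulr_gt0.
have tau0 : (0 < tau)%R by rewrite addr_gt0.
have Dm : (D <= m.+1%:R * D)%R by rewrite ler_peMl ?(ltW D0)// ler1n.
have mDT : (m.+1%:R * D <= T)%R 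
  by apply: (grid_leT T0 N0 (k := m.+1)); exact: leq_trans mj jN.
have mtau : (m.+1%:R * D <= tau)%R by rewrite lerDr ltW.
have hS := frozen_cov_pdbounds y m s0 jN.
have sm0 : (0 < (s + m%:R * D) * l)%R.
  by rewrite mulr_gt0// ltr_pwDl// mulr_ge0// ltW.
have [mg gE] := euler_one_step T0 N0 mb ms BM mXi ind0 eul mw w0 y
  (introT andP (conj ik kN)) sm0 hS.
rewrite jm gE; set g := (fun o => _) in mg *.
set c := (C1 * kappa * _)%R.
have c0 : (0 <= c)%R.
  apply: mulr_ge0; last by apply: mulr_ge0; [exact: ltW|exact: powR_ge0].
  by apply: mulr_ge0; [exact: ltW|rewrite addr_ge0 ?powR_ge0].
set S := frozen_cov s y j m in hS g mg gE *.
have wg0 S' o : 0 <= (w (X i o) * gaussk S' (X k o - y))%:E.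
  by rewrite lee_fin mulr_ge0 ?gaussk_ge0.
apply: (ge0_le_integral_affine P _ (mwg (frozen_cov s y j m.+1) y ikN)
  (mwg (4 * L * tau)%:M y ikN) _ (wg0 _) (wg0 _) c0).
- exact/measurable_EFinP.
- by move=> o; rewrite lee_fin mulr_ge0 ?gaussk_ge0.
move=> o; rewrite -EFinM -EFinD lee_fin /g.
have pd x : pdbounds (tau * l) (tau * L) (S + D *: diffusion sigma (t k) x).
  have -> : (tau = (s + m%:R * D) + D)%R by rewrite /tau -natr1; ring.
  rewrite (mulrDl (s + _)%R) (mulrDl (s + _)%R).
  by apply: pdboundsD hS _; apply: pdboundsZ => //; exact: ha.
have := hC1 D0 (le_trans Dm mtau) (step_leT T0 N0) (pd (X k o)) (pd y)
  (fun p q => hh (X k o) y p q tk) (hb (X k o) tk).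
rewrite -frozen_covS => h.
have h2 : (C1 * D * (tau `^ (eta / 2 - 1) + tau `^ (- 2^-1)) <= c)%R.
  rewrite /c -(mulrA C1 D) -(mulrA C1 kappa); apply: ler_wpM2l; first exact: ltW.
  rewrite (mulrCA kappa); apply: ler_wpM2l; first exact: ltW.
  by apply: powR_singular_le => //; rewrite mD0 mDT.
have h3 := ler_wpM2r (gaussk_ge0 (4 * L * tau)%:M (X k o - y)) h2.
have := ler_wpM2l (w0 (X i o)) (le_trans h (lerD (lexx _) h3)).
by rewrite mulrDr [X in (_ <= _ + X)%R -> _]mulrCA.
Qed.

Let lee_addCA (a x z c : \bar R) : a <= x + z -> a + c <= x + (c + z).
Proof. by move=> h; rewrite (addeC c) addeA leeD2r. Qed.

Lemma frozen_sum_le s (y : 'cV[R]_d) j n : (0 < s)%R -> (j <= N)%N -> (i + n <= j)%N ->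
  \int[P]_o (w (X i o) * gaussk s%:M (X j o - y))%:E <=
  \int[P]_o (w (X i o) * gaussk (frozen_cov s y j n) (X (j - n) o - y))%:E +
  \sum_(m < n) (C1 * kappa * (D * (m.+1%:R * D) `^ (eta / 2 - 1)))%:E *
  \int[P]_o (w (X i o) * gaussk (4 * L * (s + m.+1%:R * D))%:M (X (j - m.+1) o - y))%:E.
Proof.
move=> s0 jN; elim: n => [|n IH] inj.
  by rewrite big_ord0 adde0 /frozen_cov big_ord0 scaler0 addr0 subn0.
rewrite addnS in inj.
have h := frozen_step_le y s0 jN inj.
apply: le_trans (IH (ltnW inj)) _; rewrite big_ord_recr /=.
exact: lee_addCA h.
Qed.

End scheme_step.

Section scheme_bound.
Variables (cmu mu q C0 C2 K4 Lg pw : R).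
Hypotheses (cmu0 : (0 < cmu)%R) (pw0 : (0 <= pw)%R).
Hypotheses (C00 : (0 < C0)%R) (C20 : (0 < C2)%R) (Lg0 : (0 < Lg)%R).
Hypothesis K4E : K4 = (((1 + 4 * L) * (1 + T)) `^ pw)%R.
Hypothesis dens : has_density P (X i) (nu cmu mu).
Hypothesis hC0 : forall (s : R) (y : 'cV[R]_d), (0 < s)%R ->
   \int[lebesgue_cV d]_x (wnu cmu mu q x * gaussk s%:M (x - y))%:E <=
   (C0 * (1 + s) `^ pw * wnu cmu mu q y)%:E.
Hypothesis hC2 : forall (t : R) (S : 'M[R]_d) v, (0 < t)%R ->
  pdbounds (t * l) (t * L) S -> (gaussk S v <= C2 * gaussk (L * t)%:M v)%R.
Hypothesis hLg : forall (D : R) (n : nat), (0 < D)%R -> (n%:R * D <= T)%R ->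
  (\sum_(k < n) D * (k.+1%:R * D) `^ (eta / 2 - 1) * expR (- (Lg * (k.+1%:R * D)))
   <= (2 * (C1 * kappa * K4))^-1)%R.
Let w (x : 'cV[R]_d) : R := (((1 + sqn x) `^ q)^-1)%R.
Let h (y : 'cV[R]_d) : R := wnu cmu mu q y.

Let w0 x : (0 <= w x)%R.
Proof. by rewrite invr_ge0 powR_ge0. Qed.

Let mw : measurable_fun setT w.
Proof.
have -> : w = (fun x => (1 + sqn x) `^ (- q))%R by apply/funext => x; rewrite powRN.
exact: measurable_onesqn_powR.
Qed.

(** The error kernels have variance 4 L (s + r); [K4] is the price, uniform in s, of expressing
    their bounds through the original s. *)
Let widen s r : (0 < s)%R -> (0 <= r <= T)%R ->
  ((1 + 4 * L * (s + r)) `^ pw <= K4 * (1 + s) `^ pw)%R.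
Proof.
move=> s0 /andP[r0 rT]; have L0 : (0 <= L)%R := le_trans ler01 L1.
have T1 := ltW T0.
rewrite K4E -powRM; last 2 first.
- by rewrite mulr_ge0// addr_ge0// mulr_ge0.
- by rewrite addr_ge0// ltW.
have a0 : (0 <= 1 + 4 * L * (s + r))%R.
  by rewrite addr_ge0// !mulr_ge0// addr_ge0// ltW.
apply: ge0_ler_powR => //; rewrite ?nnegrE//.
  by rewrite !mulr_ge0// addr_ge0// ?mulr_ge0// ltW.
have prod1 (a c : R) : (0 <= a -> 0 <= c -> 1 + a * c <= (1 + a) * (1 + c))%R.
  by move=> ? ?; rewrite mulrDl mul1r mulrDr mulr1; lra.
apply: le_trans (prod1 _ _ _ _) _; [exact: mulr_ge0|by rewrite addr_ge0// ltW|].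
rewrite -mulrA ler_wpM2l// ?addr_ge0 ?mulr_ge0//.
by have := mulr_ge0 T1 (ltW s0); rewrite mulrDl mul1r mulrDr mulr1; lra.
Qed.

Lemma frozen_start_le n s y : (i + n <= N)%N -> (0 < s)%R ->
  \int[P]_o (w (X i o) * gaussk (frozen_cov s y (i + n) n) (X i o - y))%:E <=
  (C2 * C0 * K4 * ((1 + s) `^ pw * h y))%:E.
Proof.
move=> inN s0.
have D0 := step_gt0 T0 N0.
have r0 : (0 <= n%:R * D)%R by rewrite mulr_ge0// ltW.
have rT : (n%:R * D <= T)%R.
  by apply: (grid_leT T0 N0 (k := n)); exact: leq_trans (leq_addl i n) inN.
set r := (n%:R * D)%R in r0 rT *.
have t0 : (0 < s + r)%R by rewrite ltr_wpDr.
have L0 : (0 < L)%R := lt_le_trans ltr01 L1.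
have Lt0 : (0 < L * (s + r))%R by rewrite mulr_gt0.
have hS := frozen_cov_pdbounds y n s0 inN.
have mg S : measurable_fun setT (fun x : 'cV[R]_d => (w x * gaussk S (x - y))%R).
  by apply: measurable_funM => //; apply: measurable_fun_gaussk; exact: measurable_fun_addmx.
have g0 S x : (0 <= w x * gaussk S (x - y))%R by rewrite mulr_ge0 ?gaussk_ge0.
have nu0 (x : 'cV[R]_d) : (0 <= nu cmu mu x)%R by exact/ltW/nu_gt0.
rewrite (integral_has_density mXi (@measurable_nu R d cmu mu) nu0 dens (mg _) (g0 _)).
apply: (@le_trans _ _ (C2%:E *
    \int[lebesgue_cV d]_x (wnu cmu mu q x * gaussk (L * (s + r))%:M (x - y))%:E)).
  have E : C2%:E * \int[lebesgue_cV d]_x (wnu cmu mu q x * gaussk (L * (s + r))%:M (x - y))%:E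
    = \int[lebesgue_cV d]_x (C2%:E * (wnu cmu mu q x * gaussk (L * (s + r))%:M (x - y))%:E).
    rewrite ge0_integralZl ?lee_fin ?(ltW C20)//.
      apply/measurable_EFinP; apply: measurable_funM; first exact: measurable_wnu.
      by apply: measurable_fun_gaussk; exact: measurable_fun_addmx.
    by move=> x _; rewrite lee_fin mulr_ge0 ?gaussk_ge0// ltW// wnu_gt0.
  rewrite E; apply: ge0_le_integral => //.
  - by move=> x _; rewrite lee_fin mulr_ge0.
  - apply/measurable_EFinP; apply: measurable_funM => //; exact: measurable_nu.
  - apply: measurable_funeM; apply/measurable_EFinP; apply: measurable_funM; first exact: measurable_wnu.
    by apply: measurable_fun_gaussk; exact: measurable_fun_addmx.
  move=> x _; rewrite -EFinM lee_fin.
  have -> : (wnu cmu mu q x = w x * nu cmu mu x)%R by rewrite /wnu mulrC.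
  have := ler_wpM2l (mulr_ge0 (w0 x) (nu0 x)) (hC2 (x - y) t0 hS).
  rewrite mulrAC => /le_trans; apply.
  by rewrite mulrCA.
apply: (@le_trans _ _ (C2%:E * (C0 * (1 + L * (s + r)) `^ pw * h y)%:E)).
  by apply: lee_wpmul2l; [rewrite lee_fin ltW|exact: hC0].
rewrite -EFinM lee_fin -!mulrA; apply: ler_wpM2l; first exact: ltW.
apply: ler_wpM2l; first exact: ltW.
rewrite mulrA; apply: ler_wpM2r; first exact/ltW/wnu_gt0.
apply: le_trans (widen s0 (introT andP (conj r0 rT))).
apply: ge0_ler_powR => //; rewrite ?nnegrE ?addr_ge0 ?(ltW Lt0)//.
  by rewrite !mulr_ge0// ltW.
by rewrite lerD2l -!mulrA; have := ltW Lt0; lra.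
Qed.

(* The exponential absorbs the weakly singular sum. *)
Lemma euler_gaussk_le n s y : (i + n <= N)%N -> (0 < s)%R ->
  \int[P]_o (w (X i o) * gaussk s%:M (X (i + n) o - y))%:E <=
  (2 * (C2 * C0 * K4) * expR (Lg * (n%:R * D)) * ((1 + s) `^ pw * h y))%:E.
Proof.
(* Strong induction with [s] general: the error term of index k calls the bound at n - k - 1 with
   variance 4 L (s + (k + 1) D). *)
elim/ltn_ind: n s => n IH s inN s0.
have D0 := step_gt0 T0 N0.
have L0 : (0 < L)%R := lt_le_trans ltr01 L1.
have nT : (n%:R * D <= T)%R.
  by apply: (grid_leT T0 N0 (k := n)); exact: leq_trans (leq_addl i n) inN.
apply: le_trans (frozen_sum_le mw w0 y s0 inN (leqnn _)) _.
rewrite addnK.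
set Q := ((1 + s) `^ pw * h y)%R.
have Q0 : (0 <= Q)%R by rewrite mulr_ge0 ?powR_ge0//; exact/ltW/wnu_gt0.
set A := (C2 * C0 * K4)%R.
have K40 : (0 < K4)%R.
  by rewrite K4E powR_gt0// mulr_gt0// addr_gt0// mulr_gt0.
have A0 : (0 < A)%R by rewrite !mulr_gt0.
have ka0 : (0 < kappa)%R by rewrite ltr_pwDl// powR_ge0.
have cK0 : (0 < C1 * kappa * K4)%R by rewrite !mulr_gt0.
set E := expR (Lg * (n%:R * D)).
have E1 : (1 <= E)%R.
  by rewrite -expR0 ler_expR mulr_ge0 ?(ltW Lg0)// mulr_ge0// ltW.
pose u (k : nat) := (D * (k.+1%:R * D) `^ (eta / 2 - 1) * expR (- (Lg * (k.+1%:R * D))))%R.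
apply: (@le_trans _ _ ((A * Q)%:E + \sum_(k < n) (C1 * kappa * K4 * (2 * A) * E * Q * u k)%:E)).
  apply: leeD; first exact: frozen_start_le.
  apply: lee_sum => k _.
  have kn := ltn_ord k.
  have jk : (i + n - k.+1 = i + (n - k.+1))%N by rewrite addnBA.
  have kD0 : (0 < k.+1%:R * D)%R by rewrite mulr_gt0.
  have kT : (k.+1%:R * D <= T)%R.
    by apply: le_trans nT; rewrite ler_wpM2r ?(ltW D0)// ler_nat.
  have tau0 : (0 < 4 * L * (s + k.+1%:R * D))%R by rewrite !mulr_gt0// addr_gt0.
  rewrite jk.
  have nk : (n - k.+1 < n)%N by rewrite ltn_subrL (leq_trans _ kn).
  have iN : (i + (n - k.+1) <= N)%N by apply: leq_trans inN; rewrite leq_add2l leq_subr.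
  have := IH _ nk _ iN tau0.
  have c0 : 0 <= (C1 * kappa * (D * (k.+1%:R * D) `^ (eta / 2 - 1)))%:E.
    by rewrite lee_fin !mulr_ge0 ?powR_ge0// ltW.
  move=> /(lee_wpmul2l c0) /le_trans; apply.
  rewrite -EFinM lee_fin.
  (* Relative to E, the shorter time span gains the exponential that damps the singular sum. *)
  have -> : expR (Lg * ((n - k.+1)%:R * D)) = (E * expR (- (Lg * (k.+1%:R * D))))%R.
    by rewrite -expRD natrB//; congr expR; ring.
  have hw := ler_wpM2r (ltW (wnu_gt0 mu q y cmu0))
    (widen s0 (introT andP (conj (ltW kD0) kT))).
  set Z := ((1 + 4 * L * _) `^ pw)%R in hw *.
  set p := (_ `^ (eta / 2 - 1))%R; set e := expR (- _)%R.
  have B0 : (0 <= C1 * kappa * (D * p) * (2 * A * (E * e)))%R.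
    by rewrite !mulr_ge0 ?powR_ge0 ?expR_ge0// ltW.
  rewrite (mulrA _ _ (Z * h y)%R); apply: le_trans (ler_wpM2l B0 hw) _.
  by rewrite le_eqVlt /u -/p -/e /Q /h; apply/orP; left; apply/eqP; ring.
rewrite sumEFin -EFinD lee_fin -mulr_sumr.
have := hLg D0 nT; set U := (\sum_(k < n) _)%R => hU.
have c0 : (0 <= C1 * kappa * K4 * (2 * A) * E * Q)%R.
  by rewrite mulr_ge0// mulr_ge0 ?expR_ge0// !mulr_ge0// ltW.
(* The choice of [Lg] makes the sum at most A E Q, and the leading term A Q is at most A E Q since E
   >= 1: together 2 A E Q, as claimed. *)
apply: (@le_trans _ _ (A * Q + C1 * kappa * K4 * (2 * A) * E * Q * (2 * (C1 * kappa * K4))^-1)%R).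
  by rewrite lerD2l ler_wpM2l.
have -> : (C1 * kappa * K4 * (2 * A) * E * Q * (2 * (C1 * kappa * K4))^-1 = A * E * Q)%R.
  by field; rewrite !gt_eqF// mulr_gt0.
have := ler_wpM2r Q0 (ler_wpM2l (ltW A0) E1); rewrite mulr1; lra.
Qed.

End scheme_bound.
End scheme.
End parametrix.

Theorem theorem1 (R : realType) (d dW : nat) (T : R)
    (b : R -> 'cV[R]_d -> 'cV[R]_d) (sigma : R -> 'cV[R]_d -> 'M[R]_(d, dW))
    (eta mu cmu : R)
    (T_gt0 : 0 < T)
    (b_meas : measurable_coef T b) (b_bnd : bounded_coef T b)
    (sigma_meas : measurable_coef T sigma) (sigma_bnd : bounded_coef T sigma)
    (eta_gt0 : 0 < eta) (eta_le1 : eta <= 1)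
    (sigma_holder : holder_in_space T eta sigma)
    (sigma_elliptic : uniformly_elliptic T sigma)
    (mu_gt0 : 0 < mu) (cmu_gt0 : 0 < cmu)
    (cmu_pdf : (\int[lebesgue_measure]_y (nu_factor cmu mu y)%:E = 1)%E)
    (q : R) (q_ge0 : 0 <= q) :
  exists cnu : R, 0 < cnu /\
    forall (gamma : 'cV[R]_d -> R),
      measurable_fun setT gamma ->
      (\int[lebesgue_cV d]_x (gamma x ^+ 2 * nu cmu mu x)%:E < +oo)%E ->
    forall (N i j : nat), (1 <= N)%N -> (i <= j)%N -> (j <= N)%N ->
    forall (dO : measure_display) (Omega : measurableType dO)
      (P : probability Omega R) (W : R -> Omega -> 'cV[R]_dW)
      (X : nat -> Omega -> 'cV[R]_d),
      brownian_motion P T W ->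
      measurable_fun setT (X i) ->
      has_density P (X i) (nu cmu mu) ->
      indep_future_increments P T (grid T N i) W (X i) ->
      euler_scheme b sigma W T N i X ->
      ('E_P[(fun w => `|gamma (X j w)| ^+ 2 * (1 + enorm (X j w) ^+ 2) `^ q
                      / (1 + enorm (X i w) ^+ 2) `^ q)%R]
         <= cnu%:E * 'E_P[(fun w => `|gamma (X i w)| ^+ 2)%R])%E.
Proof.
have eta01 : 0 < eta <= 1 by rewrite eta_gt0.
have [lam lam0 hlam] := elliptic_bound sigma_elliptic.
have [Lam Lam0 hLam] := diffusion_upper sigma_bnd.
have [K K0 hK] := bounded_coef_sqn b_bnd.
have [H H0 hH] := diffusion_holder sigma_bnd sigma_holder.
(* Clamped around 1 so that s I satisfies the same bounds as the noise. *)
pose l := Num.min 1 lam; pose L := Num.max 1 Lam.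
have l0 : 0 < l by rewrite lt_min ltr01.
have l1 : l <= 1 by rewrite ge_min lexx.
have L1 : 1 <= L by rewrite le_max lexx.
have L0 : 0 < L := lt_le_trans ltr01 L1.
have ha t x : 0 <= t <= T -> pdbounds l L (diffusion sigma t x).
  move=> tT; split; first exact: diffusion_sym.
  move=> v; apply/andP; split.
    apply: le_trans (hlam t x v tT); rewrite ler_wpM2r ?sqn_ge0//.
    by rewrite ge_min lexx orbT.
  apply: le_trans (hLam t x v tT) _; rewrite ler_wpM2r ?sqn_ge0//.
  by rewrite le_max lexx orbT.
have [C1 C10 hC1] := @gaussk_step R d l L T K H eta l0 L0 T_gt0 K0 H0 eta01.
have [C2 C20 hC2] := @gaussk_upper R d l L l0 L0.
have [C0 C00 hC0] := @integral_wnu_gaussk_le R d cmu mu q cmu_gt0 mu_gt0 q_ge0.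
set pw := q + _ in hC0.
have pw0 : 0 <= pw by rewrite addr_ge0// mulr_ge0// divr_ge0// addr_ge0// ltW.
pose K4 := ((1 + 4 * L) * (1 + T)) `^ pw.
have K40 : 0 < K4 by rewrite powR_gt0// mulr_gt0// addr_gt0// mulr_gt0.
pose kappa := 1 + T `^ (2^-1 - eta / 2).
have ka0 : 0 < kappa by rewrite ltr_pwDl// powR_ge0.
(* Half the inverse of the Gronwall coefficient, which lets the induction reproduce its own
   constant. *)
have e0 : 0 < (2 * (C1 * kappa * K4))^-1 by rewrite invr_gt0 !mulr_gt0.
have eta2 : 0 < eta / 2 < 1 by apply/andP; split; lra.
have [Lg Lg0 hLg] := sum_weakly_singular_le eta2 T_gt0 e0.
pose A := 2 * (C2 * C0 * K4).
have A0 : 0 < A by rewrite !mulr_gt0.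
(* The bound of [euler_gaussk_le] for elapsed time at most T and s <= 1; it involves neither N nor i
   and j. *)
pose M := A * expR (Lg * T) * 2 `^ pw.
have M0 : 0 < M by rewrite mulr_gt0 ?powR_gt0// mulr_gt0 ?expR_gt0.
exists M; split => // gamma mgamma _ N i j N0 ij jN dO Omega P W X BM mXi dens ind0 eul.
pose w (x : 'cV[R]_d) : R := ((1 + sqn x) `^ q)^-1.
have mw : measurable_fun setT w.
  have -> : w = (fun x => (1 + sqn x) `^ (- q)) by apply/funext => x; rewrite powRN.
  exact: measurable_onesqn_powR.
(* As q >= 0, the weight is at most 1, so it does not enlarge the errors of Lipschitz
   approximation. *)
have w01 x : 0 <= w x <= 1.
  rewrite invr_ge0 powR_ge0/= invf_le1 ?powR_gt0 ?onesqn_gt0//.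
  rewrite -[leLHS](powRr0 (1 + sqn x)).
  by apply: ler_powR => //; rewrite lerDl sqn_ge0.
have mXj : measurable_fun setT (X j).
  by apply: (euler_measurable T_gt0 N0 b_meas sigma_meas BM mXi eul); rewrite ij.
have nu0 (x : 'cV[R]_d) : 0 <= nu cmu mu x by exact/ltW/nu_gt0.
have h0 (x : 'cV[R]_d) : 0 <= wnu cmu mu q x by exact/ltW/wnu_gt0.
pose F (x : 'cV[R]_d) : R := gamma x ^+ 2 * (1 + sqn x) `^ q.
have mF : measurable_fun setT F.
  by apply: measurable_funM; [exact: measurable_funX|exact: measurable_onesqn_powR].
have F0 x : 0 <= F x by rewrite mulr_ge0 ?sqr_ge0 ?powR_ge0.
have mwX : measurable_fun setT (fun o => w (X i o)) by exact: measurableT_comp.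
have moll (s : R) (y : 'cV[R]_d) : 0 < s <= 1 ->
    (\int[P]_o (w (X i o) * gaussk s%:M (X j o - y))%:E <= (M * wnu cmu mu q y)%:E)%E.
  move=> /andP[s0 s1].
  have ijN : (i + (j - i) <= N)%N by rewrite subnKC.
  have := euler_gaussk_le T_gt0 b_meas sigma_meas l0 l1 L1 eta01 C10 ha hK hH hC1 N0
    BM mXi ind0 eul cmu_gt0 pw0 C00 C20 Lg0 (erefl K4) dens hC0 hC2 hLg y ijN s0.
  rewrite subnKC// => /le_trans; apply; rewrite lee_fin mulrA ler_wpM2r//.
  apply: ler_pM.
  - exact: mulr_ge0 (ltW A0) (expR_ge0 _).
  - exact: powR_ge0.
  - apply: (ler_wpM2l (ltW A0)); rewrite ler_expR; apply: ler_wpM2l; first exact: ltW.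
    by apply: (grid_leT T_gt0 N0 (k := j - i)); exact: leq_trans (leq_subr _ _) jN.
  - by apply: ge0_ler_powR => //; rewrite ?nnegrE; lra.
have hY (f : 'cV[R]_d -> R) : measurable_fun setT f -> (forall x, 0 <= f x) ->
    (\int[P]_o (w (X i o) * f (X i o))%:E = \int[lebesgue_cV d]_y (f y * wnu cmu mu q y)%:E)%E.
  move=> mf f0.
  rewrite (integral_has_density mXi (@measurable_nu R d cmu mu) nu0 dens
    (f := fun x => w x * f x)).
  - by apply: eq_integral => x _; rewrite /wnu (mulrC (w x)) mulrAC mulrA.
  - exact: measurable_funM.
  - by move=> x; rewrite mulr_ge0//; have /andP[] := w01 x.
(* The reference variable is X_i with the same weight, whose weighted law has density [wnu] by
   [hY]. *)
have := integral_comparison mXj mwX (fun o => w01 (X i o)) (@measurable_wnu R d cmu mu q)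
  h0 (ltW M0) moll mXi mwX (fun o => w01 (X i o)) hY mF F0.
congr (_ <= _)%E.
  rewrite unlock; apply: eq_integral => o _; congr EFin.
  by rewrite /w /F !enorm_sqn real_normK ?num_real// mulrC.
congr (_ * _)%E; rewrite unlock; apply: eq_integral => o _; congr EFin.
(* At X_i the weight cancels the power of 1 + |X_i|^2 in [F]. *)
rewrite /w /F real_normK ?num_real// mulrC mulfK// gt_eqF//.
by rewrite powR_gt0// onesqn_gt0.
Qed.
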